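(* Let $n\ge2$ be an integer and let $\alpha=(\alpha_1,\alpha_2,\alpha_3;\alpha_1',\alpha_2')$ be a vector of non-negative integers with $\alpha_1+\alpha_2+\alpha_3=\alpha_1'+\alpha_2'=n$ for which both partitions of $n$ are most evenly distributed (i.e. $|\alpha_i-\alpha_j|\le1$ for all $i,j\in\{1,2,3\}$ and $|\alpha_1'-\alpha_2'|\le1$). Then the minimal codimension of the non-simple locus in the component of dimension vector $\alpha$, i.e. the minimum of $-\langle\beta,\gamma\rangle$ over all decompositions $\alpha=\beta+\gamma$ into non-zero dimension vectors $\beta,\gamma$, equals the dimension of the space of modular forms of weight $2n$ for $SL(2,\mathbf{Z})$.
   Context: Let $k$ be an algebraically closed field of characteristic zero and $A=k\langle x,y\rangle/(x^3-1,y^2-1)$ the group algebra of $PSL(2,\mathbf{Z})$. A dimension vector is a vector $\beta=(\beta_1,\beta_2,\beta_3;\beta_1',\beta_2')$ of non-negative integers with $\beta_1+\beta_2+\beta_3=\beta_1'+\beta_2'$, this common value being denoted $|\beta|$. For an $A$-module of dimension $|\beta|$, the $\beta_i$ are the dimensions of the eigenspaces of $x$ for the three cube roots of unity and the $\beta_j'$ those of $y$ for $\pm1$. Put $$\langle\beta,\gamma\rangle=\sum_{i=1}^3\beta_i\gamma_i+\sum_{j=1}^2\beta_j'\gamma_j'-|\beta|\,|\gamma|.$$ The most evenly distributed vectors $\alpha$ are those giving the components of highest dimension of the variety of semi-simple $n$-dimensional $A$-modules. In the paper, the codimension of the non-simple locus at a non-split extension of a simple module of dimension vector $\gamma$ by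 a simple module of dimension vector $\beta$, with $\beta+\gamma=\alpha$, is the number $-\langle\beta,\gamma\rangle$. The algebra of modular forms for $SL(2,\mathbf{Z})$ is freely generated by $E_4$ and $E_6$, so the dimension $f(n)$ of the space of modular forms of weight $2n$ has generating function $\sum_{n\ge0}f(n)x^n=\frac{1}{(1-x^2)(1-x^3)}$. *)

(* Defs.v *)
(* Stdlib reals and integers, with Coquelicot for complex analysis. *)
From Stdlib Require Import Reals ZArith.
From Coquelicot Require Import Coquelicot.

(** * Dimension vectors *)

Record vec : Type := Vec { v1 : nat; v2 : nat; v3 : nat; w1 : nat; w2 : nat }.

Definition is_dimvec (b : vec) : Prop :=
  (v1 b + v2 b + v3 b = w1 b + w2 b)%nat.

Definition vec0 : vec := Vec 0 0 0 0 0.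

Definition vec_add (b c : vec) : vec :=
  Vec (v1 b + v1 c) (v2 b + v2 c) (v3 b + v3 c) (w1 b + w1 c) (w2 b + w2 c).

(* |b|; for a dimension vector this is also [w1 b + w2 b]. *)
Definition size (b : vec) : nat := (v1 b + v2 b + v3 b)%nat.

Definition form (b c : vec) : Z :=
  (Z.of_nat (v1 b) * Z.of_nat (v1 c) + Z.of_nat (v2 b) * Z.of_nat (v2 c)
   + Z.of_nat (v3 b) * Z.of_nat (v3 c)
   + (Z.of_nat (w1 b) * Z.of_nat (w1 c) + Z.of_nat (w2 b) * Z.of_nat (w2 c))
   - Z.of_nat (size b) * Z.of_nat (size c))%Z.

Definition close (p q : nat) : Prop :=
  (Z.abs (Z.of_nat p - Z.of_nat q) <= 1)%Z.

Definition evenly_distributed (a : vec) : Prop :=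
  close (v1 a) (v2 a) /\ close (v1 a) (v3 a) /\ close (v2 a) (v3 a) /\
  close (w1 a) (w2 a).

Definition decomposition (a b c : vec) : Prop :=
  is_dimvec b /\ is_dimvec c /\ b <> vec0 /\ c <> vec0 /\ a = vec_add b c.

Definition codim (b c : vec) : Z := (- form b c)%Z.

Definition is_min_codim (a : vec) (m : Z) : Prop :=
  (exists b c, decomposition a b c /\ codim b c = m) /\
  (forall b c, decomposition a b c -> (m <= codim b c)%Z).

(** * Modular forms for SL(2,Z) *)

Definition upper_half_plane (z : C) : Prop := (0 < Im z)%R.

Definition Cexp (z : C) : C :=
  (exp (Re z) * cos (Im z), exp (Re z) * sin (Im z))%R.

Definition nome (z : C) : C := Cexp (RtoC (2 * PI) * Ci * z)%C.

(* Complex differentiability: the field of scalars is C, not R. *)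
Definition holomorphic_on (D : C -> Prop) (f : C -> C) : Prop :=
  forall z, D z -> ex_derive (K := C_AbsRing) (V := C_NormedModule) f z.

Definition ZtoC (m : Z) : C := RtoC (IZR m).

Definition weakly_modular (k : nat) (f : C -> C) : Prop :=
  forall a b c d : Z, (a * d - b * c = 1)%Z ->
  forall z, upper_half_plane z ->
  f ((ZtoC a * z + ZtoC b) / (ZtoC c * z + ZtoC d))%C
  = (Cpow (ZtoC c * z + ZtoC d) k * f z)%C.

(* Holomorphy at the cusp: the Fourier expansion has no negative powers of
   q = exp (2 pi i z). *)
Definition holomorphic_at_infinity (f : C -> C) : Prop :=
  exists a : nat -> C, forall z, upper_half_plane z ->
  is_pseries (K := C_AbsRing) (V := C_NormedModule) a (nome z) (f z).

(* Only the values of [f] on the upper half-plane matter. *)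
Definition modular_form (k : nat) (f : C -> C) : Prop :=
  holomorphic_on upper_half_plane f /\ weakly_modular k f /\
  holomorphic_at_infinity f.

(* The basis is indexed by 1, ..., d; the sum is 0 when d = 0. *)
Definition lin_comb (d : nat) (c : nat -> C) (e : nat -> C -> C) (z : C) : C :=
  sum_n_m (G := C_AbelianMonoid) (fun i => (c i * e i z)%C) 1 d.

(* [V] is a set of functions closed under linear combinations, in which two
   functions are identified when they agree on [D]; it has a basis of [d]
   elements. *)
Definition has_dimension (D : C -> Prop) (V : (C -> C) -> Prop) (d : nat)
  : Prop :=
  exists e : nat -> C -> C,
    (forall i, (1 <= i <= d)%nat -> V (e i)) /\
    (forall c : nat -> C,
       (forall z, D z -> lin_comb d c e z = RtoC 0) ->
       forall i, (1 <= i <= d)%nat -> c i = RtoC 0) /\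
    (forall f, V f ->
       exists c : nat -> C, forall z, D z -> f z = lin_comb d c e z).

(* Main.v *)
Require Import Defs.
From Stdlib Require Import Reals ZArith Lra Lia Psatz IndefiniteDescription.
From Coquelicot Require Import Coquelicot.

(** Both sides equal [form_dim n], the number f(n) of monomials E4^a E6^b of weight 2n: it is
    n/6 + 1 (rounded down), diminished by one when n = 1 modulo 6.

    The codimension.  Completing squares in the quadratic form gives
      24 codim b c = 4 |b| |c| - (defect of alpha) + (a sum of squares),
    where the defect is at most 7 because alpha is evenly distributed ([codim_lower]).  When
    |b|, |c| >= 2 this already exceeds f(n) - 1.  When |b| = 1 the codimension is
    n + 1 - p - q, with p and q the entries of alpha at the support of b; the minimum takes
    the largest entries, that is ceil(n/3) and ceil(n/2), and n + 1 - ceil(n/3) - ceil(n/2)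
    is f(n).

    The modular forms.  Everything is done with q-series, [qs a z] being the sum of
    a_n q^n at q = exp(2 pi i z); invariance under z -> z + 1 is then automatic and only
    z -> -1/z has to be examined.
    - The one transcendental input is the transformation law of E2 under z -> -1/z.  It is
      obtained from the doubly periodic series [wp], which up to a factor is the sum of
      1/(u + m + n z)^2 carried out over m first.  The series for the lattices (1, z) and
      (1, -1/z), the latter rescaled, differ by a function without poles that is its own
      average over the four halves of a point modulo the lattice; Herglotz's argument makes
      it constant ([herglotz], [wdiff_const]).  Comparing constant terms at u = 0 expresses
      the constant through E2 at z and at -1/z, and integrating over a period evaluates it
      ([G2_inv]).
    - Differentiating this law shows that E4 = E2^2 - 12 D E2 and E6 = E2 E4 - 3 D E4 are
      modular, where D = q d/dq.  The discriminant is defined as the solution of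
      D Delta = E2 Delta.  It is modular because Delta(-1/z) / (z^12 Delta(z)) has zero
      derivative and is 1 at z = i, and it has no zeros because the equation with the
      opposite sign provides its inverse.
    - A form of weight zero vanishing at infinity is zero ([weight_zero]): every orbit meets
      Im z >= 1/2, where |q| <= 1/4, and Cauchy's estimates there halve any bound for the
      form.  Applied to f^12 / Delta^k, this shows that a form of weight k whose order at
      infinity exceeds k/12 is zero ([valence]).
    - The forms Delta^j E4^a E6^b, one for each j < f(n), have orders 0, 1, ..., f(n) - 1.
      They are therefore independent, and subtracting a combination from a given form makes
      its order at least f(n), hence makes it zero ([modular_vanish], [dimension]).  When
      n = 6 l + 1, so that the weight is 12 l + 2 and f(n) = l, the order l does not exceed
      k/12; this case is [valence_2], by comparing squares and cubes with E4 and E6. *)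

Local Open Scope Z_scope.

(** * The minimal codimension *)

(** The coefficient of x^n in 1/((1 - x^2)(1 - x^3)): consecutive solutions (a, b) of
    2a + 3b = n differ by (3, -2), so there are n/6 + 1 of them (rounded down), or one fewer
    when n = 1 modulo 6. *)
Definition form_dim (n : nat) : nat := (n / 6 + if n mod 6 =? 1 then 0 else 1)%nat.

(** With p = ceil(n/3) and q = ceil(n/2) this is the codimension obtained by splitting off a
    one-dimensional summand at the largest entries of an evenly distributed vector. *)
Lemma form_dim_formula (n p q : nat) : (2 <= n)%nat ->
  (3 * p = n \/ 3 * p = n + 1 \/ 3 * p = n + 2)%nat -> (2 * q = n \/ 2 * q = n + 1)%nat ->
  Z.of_nat (form_dim n) = Z.of_nat n + 1 - Z.of_nat p - Z.of_nat q.
Proof.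
  intros Hn Hp Hq. unfold form_dim. pose proof (Nat.div_mod n 6 ltac:(lia)). pose proof (Nat.mod_upper_bound n 6 ltac:(lia)).
  destruct (n mod 6 =? 1)%nat eqn:E; [apply Nat.eqb_eq in E|apply Nat.eqb_neq in E]; lia.
Qed.

Lemma form_sym b c : form b c = form c b.
Proof. unfold form. ring. Qed.

Lemma form_dim_bound n : 6 * Z.of_nat (form_dim n) <= Z.of_nat n + 6.
Proof.
  unfold form_dim. pose proof (Nat.div_mod n 6 ltac:(lia)). pose proof (Nat.mod_upper_bound n 6 ltac:(lia)).
  destruct (n mod 6 =? 1)%nat eqn:E; lia.
Qed.

(** Writing the products through sums and differences of b and c, the squares of the sums
    are controlled by the even distribution of a, and the squares of the differences are
    nonnegative. *)
Lemma codim_lower a b c : evenly_distributed a -> decomposition a b c ->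
  4 * Z.of_nat (size b) * Z.of_nat (size c) - 7 <= 24 * codim b c.
Proof.
  intros (H1 & H2 & H3 & H4) (Db & Dc & _ & _ & ->).
  destruct b as [x1 x2 x3 y1 y2], c as [u1 u2 u3 t1 t2].
  unfold Defs.close, is_dimvec, vec_add, codim, form, size in *. cbn [v1 v2 v3 w1 w2] in *.
  repeat rewrite Nat2Z.inj_add. repeat rewrite Nat2Z.inj_add in H1, H2, H3, H4.
  assert (Db' : Z.of_nat x1 + Z.of_nat x2 + Z.of_nat x3 = Z.of_nat y1 + Z.of_nat y2) by lia.
  assert (Dc' : Z.of_nat u1 + Z.of_nat u2 + Z.of_nat u3 = Z.of_nat t1 + Z.of_nat t2) by lia.
  clear Db Dc.
  generalize dependent (Z.of_nat x1). intros a1. generalize dependent (Z.of_nat x2). intros a2.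
  generalize dependent (Z.of_nat x3). intros a3. generalize dependent (Z.of_nat u1). intros b1.
  generalize dependent (Z.of_nat u2). intros b2. generalize dependent (Z.of_nat u3). intros b3.
  generalize dependent (Z.of_nat y1). intros c1. generalize dependent (Z.of_nat y2). intros c2.
  generalize dependent (Z.of_nat t1). intros d1. generalize dependent (Z.of_nat t2). intros d2.
  intros.
  assert (S12 : forall x, Z.abs x <= 1 -> x * x <= 1) by
    (intros x X; assert (x = -1 \/ x = 0 \/ x = 1) as [->|[->| ->]] by lia; lia).
  assert (Q3 : forall x y, Z.abs x <= 1 -> Z.abs y <= 1 -> Z.abs (x - y) <= 1 -> x * x + y * y + (x - y) * (x - y) <= 2).
  { intros x y X Y XY. assert (x = -1 \/ x = 0 \/ x = 1) as [->|[->| ->]] by lia;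
    assert (y = -1 \/ y = 0 \/ y = 1) as [->|[->| ->]] by lia; lia. }
  pose proof (Q3 (a1 + b1 - (a2 + b2)) (a1 + b1 - (a3 + b3)) ltac:(lia) ltac:(lia) ltac:(lia)) as P3.
  pose proof (S12 (c1 + d1 - (c2 + d2)) ltac:(lia)) as P2.
  pose proof (Z.square_nonneg (a1 - b1 - (a2 - b2))) as D1.
  pose proof (Z.square_nonneg (a1 - b1 - (a3 - b3))) as D2.
  pose proof (Z.square_nonneg (a2 - b2 - (a3 - b3))) as D3.
  pose proof (Z.square_nonneg (c1 - d1 - (c2 - d2))) as D4.
  assert (c2 = a1 + a2 + a3 - c1) by lia. assert (d2 = b1 + b2 + b3 - d1) by lia. subst c2 d2.
  (* The entries of a, that is the sums such as a1 + b1, enter through the terms with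
     negative sign. *)
  match goal with |- _ <= 24 * ?f => assert (E : 24 * f = 4 * (a1 + a2 + a3) * (b1 + b2 + b3)
    - 2 * ((a1 + b1 - (a2 + b2)) * (a1 + b1 - (a2 + b2)) + (a1 + b1 - (a3 + b3)) * (a1 + b1 - (a3 + b3))
           + (a1 + b1 - (a2 + b2) - (a1 + b1 - (a3 + b3))) * (a1 + b1 - (a2 + b2) - (a1 + b1 - (a3 + b3))))
    - 3 * ((c1 + d1 - (a1 + a2 + a3 - c1 + (b1 + b2 + b3 - d1))) * (c1 + d1 - (a1 + a2 + a3 - c1 + (b1 + b2 + b3 - d1))))
    + 2 * ((a1 - b1 - (a2 - b2)) * (a1 - b1 - (a2 - b2)) + (a1 - b1 - (a3 - b3)) * (a1 - b1 - (a3 - b3))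
           + (a2 - b2 - (a3 - b3)) * (a2 - b2 - (a3 - b3)))
    + 3 * ((c1 - d1 - (a1 + a2 + a3 - c1 - (b1 + b2 + b3 - d1))) * (c1 - d1 - (a1 + a2 + a3 - c1 - (b1 + b2 + b3 - d1))))) by ring end.
  rewrite E. clear E. lia.
Qed.

(** For |b| = 1 the sum in the form has two terms, the entries of c at the support of b;
    these are entries of b + c lowered by one. *)
Lemma codim_unit (x1 x2 x3 y1 y2 u1 u2 u3 t1 t2 : nat) :
  (x1 + x2 + x3 = 1)%nat -> (y1 + y2 = 1)%nat -> (u1 + u2 + u3 = t1 + t2)%nat ->
  exists p q : Z,
   codim (Vec x1 x2 x3 y1 y2) (Vec u1 u2 u3 t1 t2) = Z.of_nat (u1 + u2 + u3) + 1 + 1 - p - q /\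
   (p = Z.of_nat (x1 + u1) \/ p = Z.of_nat (x2 + u2) \/ p = Z.of_nat (x3 + u3)) /\
   (q = Z.of_nat (y1 + t1) \/ q = Z.of_nat (y2 + t2)).
Proof.
  intros Hx Hy Hu.
  assert ((x1 = 1 /\ x2 = 0 /\ x3 = 0) \/ (x1 = 0 /\ x2 = 1 /\ x3 = 0) \/ (x1 = 0 /\ x2 = 0 /\ x3 = 1))%nat
    as [(-> & -> & ->)|[(-> & -> & ->)|(-> & -> & ->)]] by lia;
  assert ((y1 = 1 /\ y2 = 0) \/ (y1 = 0 /\ y2 = 1))%nat as [(-> & ->)|(-> & ->)] by lia;
  unfold codim, form, size; cbn [v1 v2 v3 w1 w2];
  [exists (Z.of_nat (1 + u1)), (Z.of_nat (1 + t1))|exists (Z.of_nat (1 + u1)), (Z.of_nat (1 + t2))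
  |exists (Z.of_nat (1 + u2)), (Z.of_nat (1 + t1))|exists (Z.of_nat (1 + u2)), (Z.of_nat (1 + t2))
  |exists (Z.of_nat (1 + u3)), (Z.of_nat (1 + t1))|exists (Z.of_nat (1 + u3)), (Z.of_nat (1 + t2))];
  (split; [lia|split; auto]).
Qed.

Lemma size_pos b : is_dimvec b -> b <> vec0 -> (1 <= size b)%nat.
Proof.
  intros D N. destruct b as [x1 x2 x3 y1 y2]. unfold is_dimvec, size in *. simpl in *.
  destruct (Nat.eq_dec (x1 + x2 + x3) 0) as [E|E]; [|lia].
  exfalso. apply N. unfold vec0. f_equal; lia.
Qed.

Lemma codim_ge_dim a b c : (2 <= size a)%nat -> evenly_distributed a -> decomposition a b c ->
  Z.of_nat (form_dim (size a)) <= codim b c.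
Proof.
  intros Hn He Hd.
  assert (Unit : forall b c, decomposition a b c -> size b = 1%nat -> Z.of_nat (form_dim (size a)) <= codim b c).
  { clear b c Hd. intros b c (Db & Dc & _ & _ & Ea) Hb. rewrite Ea in *.
    destruct b as [x1 x2 x3 y1 y2], c as [u1 u2 u3 t1 t2].
    unfold is_dimvec, size, evenly_distributed, Defs.close, vec_add in *. cbn [v1 v2 v3 w1 w2] in *.
    destruct (codim_unit x1 x2 x3 y1 y2 u1 u2 u3 t1 t2) as (p & q & E & Hp & Hq); [lia|lia|lia|].
    rewrite E. set (n := (x1 + u1 + (x2 + u2) + (x3 + u3))%nat) in *.
    assert (exists p0 : nat, (3 * p0 = n \/ 3 * p0 = n + 1 \/ 3 * p0 = n + 2)%nat) as [p0 Hp0].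
    { exists ((n + 2) / 3)%nat. pose proof (Nat.div_mod (n + 2) 3 ltac:(lia)).
      pose proof (Nat.mod_upper_bound (n + 2) 3 ltac:(lia)). lia. }
    assert (exists q0 : nat, (2 * q0 = n \/ 2 * q0 = n + 1)%nat) as [q0 Hq0].
    { exists ((n + 1) / 2)%nat. pose proof (Nat.div_mod (n + 1) 2 ltac:(lia)).
      pose proof (Nat.mod_upper_bound (n + 1) 2 ltac:(lia)). lia. }
    rewrite (form_dim_formula n p0 q0 Hn Hp0 Hq0). lia. }
  destruct (Hd) as (Db & Dc & Nb & Nc & Ea).
  pose proof (size_pos b Db Nb) as Sb. pose proof (size_pos c Dc Nc) as Sc.
  assert (Sa : size a = (size b + size c)%nat) by (rewrite Ea; unfold size, vec_add; simpl; lia).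
  destruct (Nat.eq_dec (size b) 1) as [B1|B1]; [now apply Unit|].
  destruct (Nat.eq_dec (size c) 1) as [C1|C1].
  - unfold codim. rewrite form_sym. apply (Unit c b); auto.
    repeat split; auto. rewrite Ea. unfold vec_add. f_equal; lia.
  - pose proof (codim_lower a b c He Hd) as L.
    (* Both sizes are at least 2, so their product is at least 2 (n - 2). *)
    assert (P : 2 * (Z.of_nat (size b) + Z.of_nat (size c) - 2) <= Z.of_nat (size b) * Z.of_nat (size c)) by nia.
    assert (Hs : (size a <= 5)%nat \/ (6 <= size a)%nat) by lia.
    pose proof (form_dim_bound (size a)) as Bd. rewrite Sa in *.
    destruct Hs as [Hs|Hs]; [|lia].
    assert (size b + size c = 4 \/ size b + size c = 5)%nat as [E|E] by lia;
      rewrite E; unfold form_dim; simpl; lia.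
Qed.

Lemma codim_attained a : (2 <= size a)%nat -> is_dimvec a -> evenly_distributed a ->
  exists b c, decomposition a b c /\ codim b c = Z.of_nat (form_dim (size a)).
Proof.
  intros Hn Da He. destruct a as [a1 a2 a3 c1 c2].
  unfold is_dimvec, size, evenly_distributed, Defs.close in *. cbn [v1 v2 v3 w1 w2] in *.
  set (n := (a1 + a2 + a3)%nat) in *.
  assert (X : exists x1 x2 x3 : nat, (x1 + x2 + x3 = 1 /\ x1 <= a1 /\ x2 <= a2 /\ x3 <= a3)%nat /\
    (forall i, i = a1 \/ i = a2 \/ i = a3 -> (i <= x1 * a1 + x2 * a2 + x3 * a3)%nat)).
  { destruct (le_lt_dec a2 a1) as [L1|L1]; [destruct (le_lt_dec a3 a1) as [L2|L2]|destruct (le_lt_dec a3 a2) as [L2|L2]].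
    - exists 1%nat, 0%nat, 0%nat. split; [lia|]. intros; lia.
    - exists 0%nat, 0%nat, 1%nat. split; [lia|]. intros; lia.
    - exists 0%nat, 1%nat, 0%nat. split; [lia|]. intros; lia.
    - exists 0%nat, 0%nat, 1%nat. split; [lia|]. intros; lia. }
  assert (Y : exists y1 y2 : nat, (y1 + y2 = 1 /\ y1 <= c1 /\ y2 <= c2)%nat /\
    (forall i, i = c1 \/ i = c2 -> (i <= y1 * c1 + y2 * c2)%nat)).
  { destruct (le_lt_dec c2 c1) as [L1|L1].
    - exists 1%nat, 0%nat. split; [lia|]. intros; lia.
    - exists 0%nat, 1%nat. split; [lia|]. intros; lia. }
  destruct X as (x1 & x2 & x3 & (Hx & Hx1 & Hx2 & Hx3) & Mx).
  destruct Y as (y1 & y2 & (Hy & Hy1 & Hy2) & My).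
  exists (Vec x1 x2 x3 y1 y2), (Vec (a1 - x1) (a2 - x2) (a3 - x3) (c1 - y1) (c2 - y2)).
  split.
  - unfold decomposition, is_dimvec, vec_add, vec0. cbn [v1 v2 v3 w1 w2]. repeat split; try lia.
    + intros E. injection E. lia.
    + intros E. injection E. lia.
    + f_equal; lia.
  - pose proof (Mx a1 ltac:(auto)). pose proof (Mx a2 ltac:(auto)). pose proof (Mx a3 ltac:(auto)).
    pose proof (My c1 ltac:(auto)). pose proof (My c2 ltac:(auto)). clear Mx My.
    set (p := (x1 * a1 + x2 * a2 + x3 * a3)%nat) in *. set (q := (y1 * c1 + y2 * c2)%nat) in *.
    assert ((x1 = 1 /\ x2 = 0 /\ x3 = 0) \/ (x1 = 0 /\ x2 = 1 /\ x3 = 0) \/ (x1 = 0 /\ x2 = 0 /\ x3 = 1))%nat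
      as Cx by lia.
    assert ((y1 = 1 /\ y2 = 0) \/ (y1 = 0 /\ y2 = 1))%nat as Cy by lia.
    rewrite (form_dim_formula n p q Hn).
    + unfold codim, form, size, p, q, n. cbn [v1 v2 v3 w1 w2].
      destruct Cx as [(-> & -> & ->)|[(-> & -> & ->)|(-> & -> & ->)]];
      destruct Cy as [(-> & ->)|(-> & ->)]; lia.
    + unfold p, n in *; destruct Cx as [(-> & -> & ->)|[(-> & -> & ->)|(-> & -> & ->)]]; lia.
    + unfold q, n in *; destruct Cy as [(-> & ->)|(-> & ->)]; lia.
Qed.

Local Close Scope Z_scope.
Local Open Scope R_scope.

Local Notation ex_series_ext_R := (@ex_series_ext R_AbsRing R_NormedModule).
Local Notation ex_series_scal_R := (@ex_series_scal R_AbsRing R_NormedModule).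
Local Notation ex_series_plus_R := (@ex_series_plus R_AbsRing R_NormedModule).
Local Notation ex_series_incr_1_R := (@ex_series_incr_1 R_AbsRing R_NormedModule).
Local Notation ex_series_incr_n_R := (@ex_series_incr_n R_AbsRing R_NormedModule).
Local Notation ex_series_le_R := (@ex_series_le R_AbsRing R_CompleteNormedModule).

(** * Absolutely convergent complex series *)

Lemma Ceq (x y : C) : Re x = Re y -> Im x = Im y -> x = y.
Proof. destruct x, y; simpl; intros; subst; reflexivity. Qed.

Lemma Im_plus (a b : C) : Im (a + b)%C = Im a + Im b. Proof. reflexivity. Qed.
Lemma Im_opp (a : C) : Im (- a)%C = - Im a. Proof. reflexivity. Qed.
Lemma Im_RtoC (r : R) : Im (RtoC r) = 0. Proof. reflexivity. Qed.

Lemma im_le_Cmod (c : C) : Rabs (Im c) <= Cmod c.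
Proof. eapply Rle_trans; [apply Rmax_r | apply (Rmax_Cmod c)]. Qed.

Lemma Cmod_le_ReIm (c : C) : Cmod c <= Rabs (Re c) + Rabs (Im c).
Proof.
  replace c with (RtoC (Re c) + Ci * RtoC (Im c))%C at 1.
  - eapply Rle_trans; [apply Cmod_triangle|].
    rewrite Cmod_mult, Cmod_Ci, !Cmod_R. lra.
  - apply Ceq; simpl; ring.
Qed.

Lemma Cmod_minus_sym (a b : C) : Cmod (a - b)%C = Cmod (b - a)%C.
Proof. rewrite <- Cmod_opp. f_equal. ring. Qed.

Lemma Cmod_triangle_sub (a b : C) : Cmod a - Cmod b <= Cmod (a - b)%C.
Proof.
  replace a with ((a - b) + b)%C at 1 by ring.
  pose proof (Cmod_triangle (a - b) b). lra.
Qed.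

Definition csummable (f : nat -> C) : Prop := ex_series (fun n => Cmod (f n)).

(** The real and imaginary parts are summed separately, which gives a total function and
    access to the theory of real series. *)
Definition CSum (f : nat -> C) : C :=
  (Series (fun n => Re (f n)), Series (fun n => Im (f n))).

Lemma csummable_re f : csummable f -> ex_series (fun n => Rabs (Re (f n))).
Proof.
  intros H. apply (ex_series_le_R _ (fun n => Cmod (f n))); auto.
  intros n. change (Rabs (Rabs (Re (f n))) <= Cmod (f n)). rewrite Rabs_Rabsolu. apply re_le_Cmod.
Qed.

Lemma csummable_im f : csummable f -> ex_series (fun n => Rabs (Im (f n))).
Proof.
  intros H. apply (ex_series_le_R _ (fun n => Cmod (f n))); auto.
  intros n. change (Rabs (Rabs (Im (f n))) <= Cmod (f n)). rewrite Rabs_Rabsolu. apply im_le_Cmod.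
Qed.

Lemma csummable_ex_series_re f : csummable f -> ex_series (fun n => Re (f n)).
Proof. intros H. apply ex_series_Rabs, csummable_re, H. Qed.
Lemma csummable_ex_series_im f : csummable f -> ex_series (fun n => Im (f n)).
Proof. intros H. apply ex_series_Rabs, csummable_im, H. Qed.

Lemma csummable_le f (b : nat -> R) :
  (forall n, Cmod (f n) <= b n) -> ex_series b -> csummable f.
Proof.
  intros H Hb. apply (ex_series_le_R _ b); auto.
  intros n. change (Rabs (Cmod (f n)) <= b n). rewrite Rabs_pos_eq by apply Cmod_ge_0. apply H.
Qed.

Lemma csummable_ext f g : (forall n, f n = g n) -> csummable f -> csummable g.
Proof. intros H. apply ex_series_ext. intros n. now rewrite H. Qed.

Lemma csummable_plus f g :
  csummable f -> csummable g -> csummable (fun n => f n + g n)%C.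
Proof.
  intros Hf Hg. apply csummable_le with (fun n => Cmod (f n) + Cmod (g n)).
  - intros; apply Cmod_triangle.
  - apply (ex_series_plus_R); assumption.
Qed.

Lemma csummable_scal c f : csummable f -> csummable (fun n => c * f n)%C.
Proof.
  intros H. apply csummable_le with (fun n => Cmod c * Cmod (f n)).
  - intros; rewrite Cmod_mult; lra.
  - apply (ex_series_scal_R (Cmod c)); assumption.
Qed.

Lemma csummable_S f : csummable f <-> csummable (fun n => f (S n)).
Proof. apply (ex_series_incr_1_R). Qed.

Lemma is_series_R0 : is_series (fun _ : nat => 0) 0.
Proof.
  apply (is_series_ext (K := R_AbsRing) (V := R_NormedModule) (fun n => 0 * 0 ^ n)); [intros n; change (0 * 0 ^ n = 0); ring|].
  replace (is_series (fun n : nat => 0 * 0 ^ n) 0) with (is_series (fun n : nat => 0 * 0 ^ n) (0 * / (1 - 0))) by (f_equal; field).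
  apply (is_series_scal_l (K := R_AbsRing) (V := R_NormedModule) 0).
  apply is_series_geom. rewrite Rabs_R0. lra.
Qed.

Lemma Series_R0 : Series (fun _ => 0) = 0.
Proof. apply is_series_unique, is_series_R0. Qed.

Lemma csummable_0 : csummable (fun _ => RtoC 0).
Proof. unfold csummable. rewrite Cmod_0. exists 0. apply is_series_R0. Qed.

Lemma CSum_ext f g : (forall n, f n = g n) -> CSum f = CSum g.
Proof.
  intros H. unfold CSum. f_equal; apply Series_ext; intros n; now rewrite H.
Qed.

Lemma CSum_plus f g : csummable f -> csummable g ->
  CSum (fun n => f n + g n)%C = (CSum f + CSum g)%C.
Proof.
  intros Hf Hg. apply Ceq; simpl.
  - apply (Series_plus (fun n => Re (f n)) (fun n => Re (g n)));
    apply csummable_ex_series_re; assumption.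
  - apply (Series_plus (fun n => Im (f n)) (fun n => Im (g n)));
    apply csummable_ex_series_im; assumption.
Qed.

Lemma CSum_scal c f : csummable f -> CSum (fun n => c * f n)%C = (c * CSum f)%C.
Proof.
  intros Hf. pose proof (csummable_ex_series_re f Hf). pose proof (csummable_ex_series_im f Hf).
  apply Ceq; unfold CSum; simpl.
  - rewrite <- (Series_scal_l (fst c)), <- (Series_scal_l (snd c)).
    rewrite <- Series_minus; [reflexivity | |];
    apply (ex_series_scal_R); assumption.
  - rewrite <- (Series_scal_l (fst c)), <- (Series_scal_l (snd c)).
    rewrite <- Series_plus; [reflexivity | |];
    apply (ex_series_scal_R); assumption.
Qed.

Lemma CSum_minus f g : csummable f -> csummable g ->
  CSum (fun n => f n - g n)%C = (CSum f - CSum g)%C.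
Proof.
  intros Hf Hg. rewrite (CSum_ext _ (fun n => f n + (-(1)) * g n)%C) by (intros; ring).
  rewrite CSum_plus, CSum_scal; auto using csummable_scal. ring.
Qed.

Lemma csummable_minus f g : csummable f -> csummable g ->
  csummable (fun n => f n - g n)%C.
Proof.
  intros Hf Hg. apply csummable_ext with (fun n => f n + (-(1)) * g n)%C; [intros; ring|].
  auto using csummable_plus, csummable_scal.
Qed.

Lemma CSum_S f : csummable f -> CSum f = (f O + CSum (fun n => f (S n)))%C.
Proof.
  intros Hf. apply Ceq; simpl.
  - apply Series_incr_1, csummable_ex_series_re, Hf.
  - apply Series_incr_1, csummable_ex_series_im, Hf.
Qed.

Lemma CSum_0 : CSum (fun _ => RtoC 0) = RtoC 0.
Proof. unfold CSum; simpl. rewrite Series_R0; reflexivity. Qed.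

(** With l the sum, |l|^2 is the sum of the real parts of conj(l) f_n, each at most |l| |f_n|. *)
Lemma Cmod_CSum_le f : csummable f -> Cmod (CSum f) <= Series (fun n => Cmod (f n)).
Proof.
  intros Hf. set (l := CSum f).
  assert (S0 : 0 <= Series (fun n => Cmod (f n))).
  { rewrite <- Series_R0. apply Series_le; [|exact Hf].
    intros n. pose proof (Cmod_ge_0 (f n)); simpl; lra. }
  assert (K : Cmod l * Cmod l <= Cmod l * Series (fun n => Cmod (f n))).
  { rewrite <- Series_scal_l.
    replace (Cmod l * Cmod l) with (Re (CSum (fun n => Cconj l * f n)%C)).
    - pose proof (csummable_scal (Cconj l) f Hf) as G.
      eapply Rle_trans; [apply Rle_abs|].
      eapply Rle_trans; [apply Series_Rabs, csummable_re, G|].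
      apply Series_le.
      + intros n. split; [apply Rabs_pos|].
        eapply Rle_trans; [apply re_le_Cmod|]. rewrite Cmod_mult, Cmod_conj; lra.
      + now apply (ex_series_scal_R (Cmod l)).
    - rewrite CSum_scal by assumption. fold l.
      replace (Cmod l * Cmod l) with (Cmod l ^ 2) by ring.
      rewrite Cmod2_alt. simpl. ring. }
  pose proof (Cmod_ge_0 l). nra.
Qed.

Lemma Cmod_CSum_le_bound f (b : nat -> R) :
  (forall n, Cmod (f n) <= b n) -> ex_series b -> Cmod (CSum f) <= Series b.
Proof.
  intros H Hb. eapply Rle_trans; [apply Cmod_CSum_le, (csummable_le f b H Hb)|].
  apply Series_le; auto. intros n; split; auto using Cmod_ge_0.
Qed.

Fixpoint csum (n : nat) (f : nat -> C) : C :=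
  match n with O => RtoC 0 | S m => (csum m f + f m)%C end.

Lemma csum_ext n f g : (forall k, (k < n)%nat -> f k = g k) -> csum n f = csum n g.
Proof.
  induction n; intros H; simpl; auto. rewrite IHn, H; auto.
Qed.

Lemma csum_plus n f g : csum n (fun k => f k + g k)%C = (csum n f + csum n g)%C.
Proof. induction n; simpl; [|rewrite IHn]; ring. Qed.

Lemma csum_scal n c f : csum n (fun k => c * f k)%C = (c * csum n f)%C.
Proof. induction n; simpl; [|rewrite IHn]; ring. Qed.

Lemma csum_0 n f : (forall k, (k < n)%nat -> f k = RtoC 0) -> csum n f = RtoC 0.
Proof. induction n; intros H; simpl; auto. rewrite IHn, H; auto. ring. Qed.

Lemma csum_S_l n f : csum (S n) f = (f O + csum n (fun k => f (S k)))%C.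
Proof. induction n; simpl in *; [ring|]. rewrite IHn. ring. Qed.

Lemma Cmod_csum_S n f : Cmod (csum (S n) f) <= sum_f_R0 (fun k => Cmod (f k)) n.
Proof.
  induction n.
  - simpl. rewrite Cplus_0_l. lra.
  - simpl in *. eapply Rle_trans; [apply Cmod_triangle|]. lra.
Qed.

Lemma Re_csum_S n f : Re (csum (S n) f) = sum_f_R0 (fun k => Re (f k)) n.
Proof.
  induction n.
  - change (0 + Re (f O) = Re (f O)). ring.
  - change (Re (csum (S n) f) + Re (f (S n)) = sum_f_R0 (fun k => Re (f k)) n + Re (f (S n))).
    now rewrite IHn.
Qed.
Lemma Im_csum_S n f : Im (csum (S n) f) = sum_f_R0 (fun k => Im (f k)) n.
Proof.
  induction n.
  - change (0 + Im (f O) = Im (f O)). ring.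
  - change (Im (csum (S n) f) + Im (f (S n)) = sum_f_R0 (fun k => Im (f k)) n + Im (f (S n))).
    now rewrite IHn.
Qed.

Lemma csummable_csum n (f : nat -> nat -> C) :
  (forall j, (j < n)%nat -> csummable (f j)) ->
  csummable (fun m => csum n (fun j => f j m)).
Proof.
  induction n; intros H; simpl; [apply csummable_0|].
  apply csummable_plus; auto.
Qed.

Lemma CSum_csum n (f : nat -> nat -> C) :
  (forall j, (j < n)%nat -> csummable (f j)) ->
  CSum (fun m => csum n (fun j => f j m)) = csum n (fun j => CSum (f j)).
Proof.
  induction n; intros H; simpl; [apply CSum_0|].
  rewrite CSum_plus; auto using csummable_csum. now rewrite IHn by auto.
Qed.

Definition conv_prod (f g : nat -> C) (n : nat) : C :=
  csum (S n) (fun k => f k * g (n - k)%nat)%C.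

Lemma csummable_prod f g : csummable f -> csummable g -> csummable (conv_prod f g).
Proof.
  intros Hf Hg.
  apply csummable_le with (fun n => sum_f_R0 (fun k => Cmod (f k) * Cmod (g (n - k)%nat)) n).
  - intros n. unfold conv_prod. eapply Rle_trans; [apply Cmod_csum_S|].
    right. apply sum_eq. intros. apply Cmod_mult.
  - eexists. apply (is_series_mult_pos (fun n => Cmod (f n)) (fun n => Cmod (g n))).
    + apply Series_correct, Hf.
    + apply Series_correct, Hg.
    + intros; apply Cmod_ge_0.
    + intros; apply Cmod_ge_0.
Qed.

Lemma CSum_prod f g : csummable f -> csummable g ->
  CSum (conv_prod f g) = (CSum f * CSum g)%C.
Proof.
  intros Hf Hg.
  pose proof (csummable_re f Hf) as Fr; pose proof (csummable_im f Hf) as Fi;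
  pose proof (csummable_re g Hg) as Gr; pose proof (csummable_im g Hg) as Gi.
  pose proof (Series_correct _ (csummable_ex_series_re f Hf)) as fr;
  pose proof (Series_correct _ (csummable_ex_series_im f Hf)) as fi;
  pose proof (Series_correct _ (csummable_ex_series_re g Hg)) as gr;
  pose proof (Series_correct _ (csummable_ex_series_im g Hg)) as gi.
  apply Ceq.
  - change (Re (CSum (conv_prod f g))) with (Series (fun n => Re (conv_prod f g n))).
    rewrite re_mult. apply is_series_unique.
    eapply is_series_ext;
      [|apply (is_series_minus _ _ _ _ (is_series_mult _ _ _ _ fr gr Fr Gr)
                                       (is_series_mult _ _ _ _ fi gi Fi Gi))].
    intros n. unfold conv_prod. rewrite Re_csum_S.
    unfold plus, opp; simpl.
    match goal with |- ?a + - ?b = _ => change (a - b = sum_f_R0 (fun k : nat => Re (f k * g (n - k)%nat)%C) n) end.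
    rewrite <- minus_sum. apply sum_eq. intros. symmetry. apply re_mult.
  - change (Im (CSum (conv_prod f g))) with (Series (fun n => Im (conv_prod f g n))).
    rewrite im_mult. apply is_series_unique.
    eapply is_series_ext;
      [|apply (is_series_plus _ _ _ _ (is_series_mult _ _ _ _ fr gi Fr Gi)
                                       (is_series_mult _ _ _ _ fi gr Fi Gr))].
    intros n. unfold conv_prod. rewrite Im_csum_S.
    unfold plus; simpl.
    rewrite <- plus_sum. apply sum_eq. intros. symmetry. apply im_mult.
Qed.

(** * Power series *)

Definition ps (a : nat -> C) (x : C) : C := CSum (fun n => a n * x ^ n)%C.

(** The radius of convergence is at least R.  Stated as absolute convergence at every smaller
    radius, the property passes to products and derivatives. *)
Definition conv (R : R) (a : nat -> C) : Prop :=
  forall r, 0 <= r < R -> ex_series (fun n => Cmod (a n) * r ^ n).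

Lemma conv_csummable R a x : conv R a -> Cmod x < R -> csummable (fun n => a n * x ^ n)%C.
Proof.
  intros H Hx. apply csummable_le with (fun n => Cmod (a n) * Cmod x ^ n).
  - intros n. rewrite Cmod_mult, Cmod_pow. lra.
  - apply H. split; auto using Cmod_ge_0.
Qed.

Lemma conv_le R a b : (forall n, Cmod (a n) <= Cmod (b n)) -> conv R b -> conv R a.
Proof.
  intros H Hb r Hr.
  apply (ex_series_le_R _ (fun n => Cmod (b n) * r ^ n)); auto.
  intros n. change (Rabs (Cmod (a n) * r ^ n) <= Cmod (b n) * r ^ n).
  assert (0 <= r ^ n) by (apply pow_le; lra). pose proof (Cmod_ge_0 (a n)).
  rewrite Rabs_pos_eq by nra. apply Rmult_le_compat_r; auto.
Qed.

Lemma conv_ext R a b : (forall n, a n = b n) -> conv R b -> conv R a.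
Proof. intros H. apply conv_le. intros; rewrite H; lra. Qed.

Lemma conv_plus R a b : conv R a -> conv R b -> conv R (fun n => a n + b n)%C.
Proof.
  intros Ha Hb r Hr.
  apply (ex_series_le_R _
    (fun n => Cmod (a n) * r ^ n + Cmod (b n) * r ^ n)).
  - intros n. change (Rabs (Cmod (a n + b n)%C * r ^ n) <= Cmod (a n) * r ^ n + Cmod (b n) * r ^ n).
    assert (0 <= r ^ n) by (apply pow_le; lra). pose proof (Cmod_ge_0 (a n + b n)).
    rewrite Rabs_pos_eq by nra. pose proof (Cmod_triangle (a n) (b n)). nra.
  - apply (ex_series_plus_R); auto.
Qed.

Lemma conv_scal R c a : conv R a -> conv R (fun n => c * a n)%C.
Proof.
  intros Ha r Hr.
  apply (ex_series_ext_R (fun n => Cmod c * (Cmod (a n) * r ^ n))).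
  - intros n. change (Cmod c * (Cmod (a n) * r ^ n) = Cmod (c * a n)%C * r ^ n).
    rewrite Cmod_mult. ring.
  - apply (ex_series_scal_R (Cmod c)). auto.
Qed.

Lemma ps_ext a b x : (forall n, a n = b n) -> ps a x = ps b x.
Proof. intros H. apply CSum_ext. intros; now rewrite H. Qed.

Lemma ps_plus R a b x : conv R a -> conv R b -> Cmod x < R ->
  ps (fun n => a n + b n)%C x = (ps a x + ps b x)%C.
Proof.
  intros Ha Hb Hx. unfold ps. rewrite <- CSum_plus.
  - apply CSum_ext; intros; ring.
  - now apply (conv_csummable R).
  - now apply (conv_csummable R).
Qed.

Lemma ps_scal R c a x : conv R a -> Cmod x < R ->
  ps (fun n => c * a n)%C x = (c * ps a x)%C.
Proof.
  intros Ha Hx. unfold ps. rewrite <- CSum_scal.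
  - apply CSum_ext; intros; ring.
  - now apply (conv_csummable R).
Qed.

Lemma ps_S R a x : conv R a -> Cmod x < R ->
  ps a x = (a O + x * ps (fun n => a (S n)) x)%C.
Proof.
  intros Ha Hx. pose proof (conv_csummable R a x Ha Hx) as H.
  unfold ps. rewrite CSum_S by assumption. simpl. f_equal; [ring|].
  destruct (Ceq_dec x (RtoC 0)) as [->|E].
  - rewrite (CSum_ext _ (fun _ => RtoC 0)) by (intros; ring). rewrite CSum_0. ring.
  - rewrite <- CSum_scal; [apply CSum_ext; intros; ring|].
    apply csummable_ext with (fun n => / x * (a (S n) * x ^ S n))%C.
    + intros; simpl. field. assumption.
    + apply csummable_scal. apply (csummable_S (fun n => a n * x ^ n)%C). assumption.
Qed.

Lemma conv_S R a : conv R a -> conv R (fun n => a (S n)).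
Proof.
  intros Ha r Hr.
  destruct (Req_dec r 0) as [->|E].
  - apply (ex_series_incr_1_R).
    apply (ex_series_ext_R (fun _ => 0)).
    + intros n; change (0 = Cmod (a (S (S n))) * (0 * 0 ^ n)); ring.
    + exists 0; apply is_series_R0.
  - apply (ex_series_ext_R (fun n => / r * (Cmod (a (S n)) * r ^ S n))).
    + intros n; change (/ r * (Cmod (a (S n)) * (r * r ^ n)) = Cmod (a (S n)) * r ^ n). field; auto.
    + apply (ex_series_scal_R (/ r)).
      apply (ex_series_incr_1_R (fun n => Cmod (a n) * r ^ n)). auto.
Qed.

Lemma conv_shift R a b : (forall n, b (S n) = a n) -> conv R a -> conv R b.
Proof.
  intros H Ha r Hr. apply (ex_series_incr_1_R).
  apply (ex_series_ext_R (fun n => r * (Cmod (a n) * r ^ n))).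
  - intros n; change (r * (Cmod (a n) * r ^ n) = Cmod (b (S n)) * (r * r ^ n)). rewrite H; ring.
  - apply (ex_series_scal_R r). auto.
Qed.

Definition pmul (a b : nat -> C) : nat -> C := conv_prod a b.

Lemma pmul_term a b x n :
  conv_prod (fun n => a n * x ^ n)%C (fun n => b n * x ^ n)%C n = (pmul a b n * x ^ n)%C.
Proof.
  unfold pmul, conv_prod. rewrite Cmult_comm, <- csum_scal. apply csum_ext.
  intros k Hk. replace (x ^ n)%C with (x ^ k * x ^ (n - k))%C; [ring|].
  rewrite <- Cpow_add_r. f_equal. lia.
Qed.

Lemma conv_pmul R a b : conv R a -> conv R b -> conv R (pmul a b).
Proof.
  intros Ha Hb r Hr.
  assert (Hm : Cmod (RtoC r) < R) by (rewrite Cmod_R, Rabs_pos_eq; lra).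
  pose proof (csummable_prod _ _ (conv_csummable R a r Ha Hm) (conv_csummable R b r Hb Hm)) as H.
  revert H. apply ex_series_ext. intros n. rewrite pmul_term, Cmod_mult, Cmod_pow, Cmod_R, Rabs_pos_eq by lra.
  reflexivity.
Qed.

Lemma ps_pmul R a b x : conv R a -> conv R b -> Cmod x < R ->
  ps (pmul a b) x = (ps a x * ps b x)%C.
Proof.
  intros Ha Hb Hx. unfold ps at 2 3. rewrite <- CSum_prod.
  - apply CSum_ext. intros; symmetry; apply pmul_term.
  - now apply (conv_csummable R).
  - now apply (conv_csummable R).
Qed.

(** Abel's lemma: bounded terms at a slightly larger radius give a geometric majorant. *)
Lemma conv_bounded R a :
  (forall r, 0 <= r < R -> exists M, forall n, Cmod (a n) * r ^ n <= M) -> conv R a.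
Proof.
  intros H r Hr. destruct (H ((r + R) / 2)) as [M HM]; [lra|].
  set (t := r / ((r + R) / 2)).
  assert (Ht : 0 <= t < 1).
  { unfold t; split.
    - apply Rmult_le_pos; [lra|]. left; apply Rinv_0_lt_compat; lra.
    - apply Rmult_lt_reg_r with ((r + R) / 2); [lra|]. unfold Rdiv at 1.
      rewrite Rmult_assoc, Rinv_l by lra. lra. }
  apply (ex_series_le_R _ (fun n => M * t ^ n)).
  - intros n. change (Rabs (Cmod (a n) * r ^ n) <= M * t ^ n).
    assert (0 <= r ^ n) by (apply pow_le; lra). pose proof (Cmod_ge_0 (a n)).
    rewrite Rabs_pos_eq by nra.
    replace (r ^ n) with (((r + R) / 2) ^ n * t ^ n).
    + rewrite <- Rmult_assoc. apply Rmult_le_compat_r; auto. apply pow_le; lra.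
    + rewrite <- Rpow_mult_distr. f_equal. unfold t. field. lra.
  - apply (ex_series_scal_R M).
    apply ex_series_geom. rewrite Rabs_pos_eq; lra.
Qed.

Lemma ex_series_term_bound (u : nat -> R) :
  (forall n, 0 <= u n) -> ex_series u -> forall n, u n <= Series u.
Proof.
  intros H Hu n. revert u H Hu. induction n; intros u H Hu.
  - rewrite Series_incr_1 by assumption.
    assert (0 <= Series (fun k => u (S k))).
    { rewrite <- Series_R0. apply Series_le.
      - intros; split; [lra|auto].
      - apply (ex_series_incr_1_R) in Hu. exact Hu. }
    lra.
  - rewrite Series_incr_1 by assumption.
    specialize (IHn (fun k => u (S k))). simpl in IHn.
    pose proof (H O).
    enough (u (S n) <= Series (fun k => u (S k))) by lra.
    apply IHn; auto.
    apply (ex_series_incr_1_R) in Hu. exact Hu.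
Qed.

Lemma conv_terms R a r : conv R a -> 0 <= r < R ->
  exists M, 0 <= M /\ forall n, Cmod (a n) * r ^ n <= M.
Proof.
  intros Ha Hr.
  assert (P : forall n, 0 <= Cmod (a n) * r ^ n)
    by (intros; apply Rmult_le_pos; [apply Cmod_ge_0 | apply pow_le; lra]).
  exists (Series (fun n => Cmod (a n) * r ^ n)).
  pose proof (ex_series_term_bound _ P (Ha r Hr)) as B.
  split; [apply Rle_trans with (1 := P O); apply (B O)|exact B].
Qed.

Lemma n_pow_bound t : 0 <= t < 1 -> exists K, 0 <= K /\ forall n, INR n * t ^ n <= K.
Proof.
  intros Ht. destruct (Req_dec t 0) as [->|E].
  - exists 0. split; [lra|]. intros [|n]; simpl; lra.
  - set (s := / t - 1). assert (0 < s).
    { unfold s. assert (1 < / t); [|lra]. rewrite <- Rinv_1. apply Rinv_lt_contravar; lra. }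
    exists (/ s). split; [left; now apply Rinv_0_lt_compat|].
    intros n. pose proof (poly n s H) as Pn.
    replace (1 + s) with (/ t) in Pn by (unfold s; ring).
    rewrite pow_inv in Pn.
    assert (0 < t ^ n) by (apply pow_lt; lra).
    apply Rmult_le_reg_l with s; auto. rewrite Rinv_r by lra.
    apply Rmult_le_compat_r with (r := t ^ n) in Pn; [|lra].
    rewrite Rinv_l in Pn by lra. nra.
Qed.

(** The factor n is absorbed by enlarging the radius, as n t^n is bounded for t < 1. *)
Lemma conv_n R a : conv R a -> conv R (fun n => RtoC (INR n) * a n)%C.
Proof.
  intros Ha. apply conv_bounded. intros r Hr.
  destruct (conv_terms R a ((r + R) / 2) Ha) as [M [M0 HM]]; [lra|].
  set (t := r / ((r + R) / 2)).
  assert (Ht : 0 <= t < 1).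
  { unfold t; split.
    - apply Rmult_le_pos; [lra|]. left; apply Rinv_0_lt_compat; lra.
    - apply Rmult_lt_reg_r with ((r + R) / 2); [lra|]. unfold Rdiv at 1.
      rewrite Rmult_assoc, Rinv_l by lra. lra. }
  destruct (n_pow_bound t Ht) as [K [K0 HK]].
  exists (K * M). intros n. rewrite Cmod_mult, Cmod_R, Rabs_pos_eq by apply pos_INR.
  replace (r ^ n) with (((r + R) / 2) ^ n * t ^ n).
  - replace (INR n * Cmod (a n) * (((r + R) / 2) ^ n * t ^ n))
      with ((INR n * t ^ n) * (Cmod (a n) * ((r + R) / 2) ^ n)) by ring.
    apply Rmult_le_compat; auto.
    + apply Rmult_le_pos; [apply pos_INR | apply pow_le; lra].
    + apply Rmult_le_pos; [apply Cmod_ge_0 | apply pow_le; lra].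
  - rewrite <- Rpow_mult_distr. f_equal. unfold t. field. lra.
Qed.

(** * Complex derivatives *)

(** The target carries the normed structure of the field itself, for which the product and
    chain rules of the library hold. *)
Definition cder (f : C -> C) (x l : C) : Prop :=
  is_derive (K := C_AbsRing) (V := AbsRing_NormedModule C_AbsRing) f x l.

Lemma cder_eps f x l : cder f x l <->
  forall eps, 0 < eps -> exists d, 0 < d /\ forall y, Cmod (y - x)%C < d ->
    Cmod (f y - f x - (y - x) * l)%C <= eps * Cmod (y - x)%C.
Proof.
  split.
  - intros [_ H] eps He.
    destruct (H x (fun P HP => HP) (mkposreal eps He)) as [d Hd].
    exists d. split; [apply cond_pos|]. intros y Hy. exact (Hd y Hy).
  - intros H. split; [apply is_linear_scal_l|].
    intros x' Hx' [eps He].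
    assert (x = x') as <-.
    { exact (@is_filter_lim_locally_unique C_AbsRing (AbsRing_NormedModule C_AbsRing) x x' Hx'). }
    destruct (H eps He) as [d [Hd0 Hd]].
    exists (mkposreal d Hd0). intros y Hy. exact (Hd y Hy).
Qed.

Lemma cder_ext f g x l : (forall y, f y = g y) -> cder f x l -> cder g x l.
Proof. exact (is_derive_ext (K := C_AbsRing) (V := AbsRing_NormedModule C_AbsRing) f g x l). Qed.

Lemma cder_ext_loc f g x l d : 0 < d -> (forall y, Cmod (y - x)%C < d -> f y = g y) ->
  cder f x l -> cder g x l.
Proof.
  intros Hd H. apply (is_derive_ext_loc (K := C_AbsRing) (V := AbsRing_NormedModule C_AbsRing) f g). exists (mkposreal d Hd). intros y Hy. apply H. exact Hy.
Qed.

Lemma cder_eq f x l l' : l = l' -> cder f x l -> cder f x l'.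
Proof. now intros ->. Qed.

Lemma cder_const c x : cder (fun _ => c) x (RtoC 0).
Proof. exact (is_derive_const (K := C_AbsRing) (V := AbsRing_NormedModule C_AbsRing) c x). Qed.

Lemma cder_id x : cder (fun y => y) x (RtoC 1).
Proof. exact (is_derive_id (K := C_AbsRing) x). Qed.

Lemma cder_plus f g x l m : cder f x l -> cder g x m -> cder (fun y => f y + g y)%C x (l + m)%C.
Proof. exact (is_derive_plus (K := C_AbsRing) (V := AbsRing_NormedModule C_AbsRing) f g x l m). Qed.

Lemma cder_mult f g x l m : cder f x l -> cder g x m ->
  cder (fun y => f y * g y)%C x (l * g x + f x * m)%C.
Proof.
  intros Hf Hg. exact (is_derive_mult (K := C_AbsRing) f g x l m Hf Hg Cmult_comm).
Qed.

Lemma cder_comp f g x l m : cder f (g x) l -> cder g x m ->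
  cder (fun y => f (g y)) x (m * l)%C.
Proof. exact (is_derive_comp (K := C_AbsRing) (V := AbsRing_NormedModule C_AbsRing) f g x l m). Qed.

Lemma cder_scal c f x l : cder f x l -> cder (fun y => c * f y)%C x (c * l)%C.
Proof.
  intros H. eapply cder_eq; [|apply (cder_mult _ _ _ _ _ (cder_const c x) H)]. ring.
Qed.

Lemma cder_opp f x l : cder f x l -> cder (fun y => - f y)%C x (- l)%C.
Proof.
  intros H. apply cder_ext with (fun y => (-(1)) * f y)%C; [intros; ring|].
  eapply cder_eq; [|apply cder_scal, H]. ring.
Qed.

Lemma cder_minus f g x l m : cder f x l -> cder g x m -> cder (fun y => f y - g y)%C x (l - m)%C.
Proof. intros. apply cder_plus; auto using cder_opp. Qed.

Lemma cder_pow f x l n : cder f x l ->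
  cder (fun y => f y ^ n)%C x (RtoC (INR n) * f x ^ pred n * l)%C.
Proof.
  intros H. induction n.
  - apply (cder_ext (fun _ => RtoC 1)); [reflexivity|].
    eapply cder_eq; [|apply cder_const]. simpl. ring.
  - apply (cder_ext (fun y => f y * f y ^ n)%C); [reflexivity|].
    eapply cder_eq; [|apply (cder_mult _ _ _ _ _ H IHn)].
    rewrite S_INR, RtoC_plus. simpl pred. destruct n; simpl; ring.
Qed.

Lemma cder_cont f x l : cder f x l -> forall eps, 0 < eps ->
  exists d, 0 < d /\ forall y, Cmod (y - x)%C < d -> Cmod (f y - f x)%C < eps.
Proof.
  intros H eps He. pose proof (proj1 (cder_eps f x l) H) as H'. destruct (H' 1 Rlt_0_1) as [d [d0 Hd]].
  pose proof (Cmod_ge_0 l) as Hl.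
  assert (0 < eps / (Cmod l + 2)) by (apply Rdiv_lt_0_compat; lra).
  exists (Rmin d (eps / (Cmod l + 2))). split; [now apply Rmin_pos|].
  intros y Hy. specialize (Hd y (Rlt_le_trans _ _ _ Hy (Rmin_l _ _))).
  replace (f y - f x)%C with ((f y - f x - (y - x) * l) + (y - x) * l)%C by ring.
  eapply Rle_lt_trans; [apply Cmod_triangle|]. rewrite Cmod_mult.
  assert (Hy' : Cmod (y - x)%C < eps / (Cmod l + 2)) by (eapply Rlt_le_trans; [exact Hy|apply Rmin_r]).
  apply Rmult_lt_compat_r with (r := Cmod l + 2) in Hy'; [|lra].
  unfold Rdiv in Hy'. rewrite Rmult_assoc, Rinv_l in Hy' by lra.
  pose proof (Cmod_ge_0 (y - x)). nra.
Qed.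

Lemma cder_inv x : x <> RtoC 0 -> cder Cinv x (- / (x * x))%C.
Proof.
  intros Hx. apply (proj2 (cder_eps _ _ _)). intros eps He.
  assert (Hm : 0 < Cmod x) by now apply Cmod_gt_0.
  set (M := Cmod x) in *.
  exists (Rmin (M / 2) (eps * (M * M * M) / 2)).
  assert (0 < M * M * M) by (repeat apply Rmult_lt_0_compat; auto).
  split; [apply Rmin_pos; [lra|]; apply Rdiv_lt_0_compat; [apply Rmult_lt_0_compat|]; lra|].
  intros y Hy.
  assert (Hy1 : Cmod (y - x)%C < M / 2) by (eapply Rlt_le_trans; [exact Hy|apply Rmin_l]).
  assert (Hy2 : Cmod (y - x)%C < eps * (M * M * M) / 2) by (eapply Rlt_le_trans; [exact Hy|apply Rmin_r]).
  assert (Hym : M / 2 <= Cmod y).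
  { pose proof (Cmod_triangle_sub x y). rewrite Cmod_minus_sym in H0. fold M in H0. lra. }
  assert (y <> RtoC 0) by (intros ->; rewrite Cmod_0 in Hym; lra).
  replace (/ y - / x - (y - x) * - / (x * x))%C with ((y - x) * ((y - x) / (x * x * y)))%C
    by (field; auto).
  rewrite Cmod_mult, Rmult_comm. apply Rmult_le_compat_r; [apply Cmod_ge_0|].
  rewrite Cmod_div by (repeat apply Cmult_neq_0; auto). rewrite !Cmod_mult. fold M.
  apply Rmult_le_reg_r with (M * M * Cmod y).
  - repeat apply Rmult_lt_0_compat; auto; lra.
  - unfold Rdiv. rewrite Rmult_assoc, Rinv_l.
    + assert (eps * (M * M * M) / 2 <= eps * (M * M * Cmod y)); [|lra].
      replace (eps * (M * M * M) / 2) with (eps * (M * M * (M / 2))) by field.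
      apply Rmult_le_compat_l; [lra|]. apply Rmult_le_compat_l; [nra|lra].
    + assert (0 < M * M * Cmod y); [|lra]. repeat apply Rmult_lt_0_compat; lra.
Qed.

Lemma cder_div f g x l m : g x <> RtoC 0 -> cder f x l -> cder g x m ->
  cder (fun y => f y / g y)%C x ((l * g x - f x * m) / (g x * g x))%C.
Proof.
  intros H Hf Hg. eapply cder_eq;
  [|exact (cder_mult _ _ _ _ _ Hf (cder_comp _ _ _ _ _ (cder_inv _ H) Hg))].
  cbv beta. field. exact H.
Qed.

Definition dps (a : nat -> C) (n : nat) : C := (RtoC (INR (S n)) * a (S n))%C.

Lemma conv_dps R a : conv R a -> conv R (dps a).
Proof. intros H. apply (conv_S R (fun n => RtoC (INR n) * a n)%C). now apply conv_n. Qed.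

(** Multiplied by rho^2 so as to avoid the exponent n - 2, and the division by rho^2 when
    rho = 0. *)
Lemma pow_remainder (x y : C) (rho : R) n :
  Cmod x <= rho -> Cmod y <= rho ->
  rho * rho * Cmod (y ^ n - x ^ n - (y - x) * (RtoC (INR n) * x ^ pred n))%C
  <= INR n * INR n * rho ^ n * (Cmod (y - x)%C * Cmod (y - x)%C).
Proof.
  intros Hx Hy. pose proof (Cmod_ge_0 x) as Px. pose proof (Cmod_ge_0 (y - x)) as Ph.
  set (h := Cmod (y - x)%C) in *.
  induction n.
  - replace (y ^ 0 - x ^ 0 - (y - x) * (RtoC (INR 0) * x ^ pred 0))%C with (RtoC 0) by (simpl; ring).
    rewrite Cmod_0. simpl. lra.
  - assert (E : (y ^ S n - x ^ S n - (y - x) * (RtoC (INR (S n)) * x ^ pred (S n)))%C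
      = (y * (y ^ n - x ^ n - (y - x) * (RtoC (INR n) * x ^ pred n))
         + (y - x) * (y - x) * (RtoC (INR n) * x ^ pred n))%C).
    { rewrite S_INR, RtoC_plus. destruct n; simpl; ring. }
    rewrite E.
    assert (B : rho * Cmod (RtoC (INR n) * x ^ pred n)%C <= INR n * rho ^ n).
    { rewrite Cmod_mult, Cmod_R, Cmod_pow, Rabs_pos_eq by apply pos_INR.
      destruct n; [simpl; lra|]. simpl pred.
      replace (rho * (INR (S n) * Cmod x ^ n)) with (INR (S n) * (rho * Cmod x ^ n)) by ring.
      apply Rmult_le_compat_l; [apply pos_INR|]. simpl. apply Rmult_le_compat_l; [lra|].
      apply pow_incr; lra. }
    eapply Rle_trans; [apply Rmult_le_compat_l; [nra|apply Cmod_triangle]|].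
    rewrite !Cmod_mult with (x := y). rewrite Cmod_mult with (x := ((y - x) * (y - x))%C).
    rewrite (Cmod_mult (y - x) (y - x)). fold h.
    set (A := Cmod (y ^ n - x ^ n - (y - x) * (RtoC (INR n) * x ^ pred n))%C) in *.
    set (D := Cmod (RtoC (INR n) * x ^ pred n)%C) in *.
    assert (0 <= A) by apply Cmod_ge_0. assert (0 <= rho) by lra.
    assert (0 <= rho ^ n) by (apply pow_le; lra).
    pose proof (pos_INR n). rewrite S_INR. simpl pow.
    apply Rle_trans with (rho * (rho * rho * A) + rho * (rho * D) * (h * h)).
    { assert (rho * rho * (Cmod y * A) <= rho * rho * (rho * A)); [|nra].
      apply Rmult_le_compat_l; [nra|]. apply Rmult_le_compat_r; lra. }
    assert (rho * (rho * rho * A) <= rho * (INR n * INR n * rho ^ n * (h * h)))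
      by (apply Rmult_le_compat_l; lra).
    assert (rho * (rho * D) * (h * h) <= rho * (INR n * rho ^ n) * (h * h)).
    { apply Rmult_le_compat_r; [nra|]. apply Rmult_le_compat_l; lra. }
    assert (0 <= (INR n + 1) * (rho * rho ^ n) * (h * h)).
    { repeat apply Rmult_le_pos; lra. }
    nra.
Qed.

Lemma ps_dps R a x : conv R a -> Cmod x < R ->
  ps (dps a) x = CSum (fun n => a n * (RtoC (INR n) * x ^ pred n))%C /\
  csummable (fun n => a n * (RtoC (INR n) * x ^ pred n))%C.
Proof.
  intros Ha Hx.
  assert (S0 : csummable (fun n => a n * (RtoC (INR n) * x ^ pred n))%C).
  { apply csummable_S.
    apply csummable_ext with (fun n => dps a n * x ^ n)%C; [intros; unfold dps; cbn [pred]; ring|].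
    apply (conv_csummable R); auto using conv_dps. }
  split; auto. rewrite (CSum_S _ S0).
  rewrite (CSum_ext (fun n => a (S n) * (RtoC (INR (S n)) * x ^ pred (S n)))%C
                    (fun n => dps a n * x ^ n)%C).
  - change (INR 0) with 0. unfold ps. ring.
  - intros; unfold dps; cbn [pred]; ring.
Qed.

(** The second-order remainders of the monomials are summed; the majorant converges because
    n^2 a_n has the same radius of convergence as a_n. *)
Lemma cder_ps R a x : conv R a -> Cmod x < R -> cder (ps a) x (ps (dps a) x).
Proof.
  intros Ha Hx. apply (proj2 (cder_eps _ _ _)). intros eps He. pose proof (Cmod_ge_0 x) as Px.
  set (rho := (Cmod x + R) / 2). assert (Hr : Cmod x < rho < R) by (unfold rho; lra).
  pose proof (conv_n R _ (conv_n R a Ha) rho ltac:(lra)) as HK.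
  set (K := Series (fun n => Cmod (RtoC (INR n) * (RtoC (INR n) * a n))%C * rho ^ n)) in *.
  assert (K0 : 0 <= K).
  { unfold K. rewrite <- Series_R0. apply Series_le; [|exact HK].
    intros n. split; [lra|]. apply Rmult_le_pos; [apply Cmod_ge_0|apply pow_le; lra]. }
  assert (Hrr : 0 < rho * rho) by nra.
  assert (Hd : 0 < eps * (rho * rho) / (K + 1)) by (apply Rdiv_lt_0_compat; nra).
  exists (Rmin (rho - Cmod x) (eps * (rho * rho) / (K + 1))).
  split; [apply Rmin_pos; lra|].
  intros y Hy.
  assert (Hy1 : Cmod (y - x)%C < rho - Cmod x) by (eapply Rlt_le_trans; [exact Hy|apply Rmin_l]).
  assert (Hy2 : Cmod (y - x)%C < eps * (rho * rho) / (K + 1)) by (eapply Rlt_le_trans; [exact Hy|apply Rmin_r]).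
  assert (Hyr : Cmod y <= rho) by (pose proof (Cmod_triangle_sub y x); lra).
  destruct (ps_dps R a x Ha Hx) as [E S1]. rewrite E.
  unfold ps at 1 2.
  rewrite <- CSum_minus by (apply (conv_csummable R); auto; lra).
  rewrite <- (CSum_scal (y - x)%C) by assumption.
  rewrite <- CSum_minus.
  2:{ apply csummable_minus; apply (conv_csummable R); auto; lra. }
  2:{ now apply csummable_scal. }
  set (h := Cmod (y - x)%C) in *. assert (Ph : 0 <= h) by apply Cmod_ge_0.
  assert (B : Cmod (CSum (fun n => a n * y ^ n - a n * x ^ n - (y - x) * (a n * (RtoC (INR n) * x ^ pred n)))%C)
     <= Series (fun n => (h * h / (rho * rho)) * (Cmod (RtoC (INR n) * (RtoC (INR n) * a n))%C * rho ^ n))).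
  { apply Cmod_CSum_le_bound.
    - intros n.
      replace (a n * y ^ n - a n * x ^ n - (y - x) * (a n * (RtoC (INR n) * x ^ pred n)))%C
        with (a n * (y ^ n - x ^ n - (y - x) * (RtoC (INR n) * x ^ pred n)))%C by ring.
      rewrite !Cmod_mult, !Cmod_R, !Rabs_pos_eq by apply pos_INR.
      pose proof (pow_remainder x y rho n ltac:(lra) Hyr) as P. fold h in P.
      apply Rmult_le_reg_l with (rho * rho); auto.
      replace (rho * rho * (h * h / (rho * rho) * (INR n * (INR n * Cmod (a n)) * rho ^ n)))
        with (Cmod (a n) * (INR n * INR n * rho ^ n * (h * h))) by (field; nra).
      rewrite (Rmult_comm (Cmod (a n))), <- Rmult_assoc, Rmult_comm.
      apply Rmult_le_compat_l; [apply Cmod_ge_0|exact P].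
    - apply (ex_series_scal_R (h * h / (rho * rho))). exact HK. }
  rewrite Series_scal_l in B. fold K in B.
  eapply Rle_trans; [exact B|].
  apply Rmult_le_reg_l with (rho * rho); auto.
  replace (rho * rho * (h * h / (rho * rho) * K)) with (h * (h * K)) by (field; nra).
  replace (rho * rho * (eps * h)) with (h * (eps * (rho * rho))) by ring.
  apply Rmult_le_compat_l; auto.
  apply Rmult_lt_compat_r with (r := K + 1) in Hy2; [|lra].
  unfold Rdiv in Hy2. rewrite Rmult_assoc, Rinv_l in Hy2 by lra. nra.
Qed.

(** * Functions with zero derivative, and the exponential *)

Lemma Im_scal_l (r : R) (c : C) : Im (RtoC r * c)%C = r * Im c.
Proof. rewrite im_mult, Im_RtoC, re_RtoC. ring. Qed.

Lemma Cmult_zero_r (a b : C) : a <> RtoC 0 -> (a * b = RtoC 0)%C -> b = RtoC 0.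
Proof.
  intros Ha H. replace b with (/ a * (a * b))%C by (field; auto). rewrite H. ring.
Qed.

Lemma cder_path (f : C -> C) (x h l : C) (t : R) : cder f (x + RtoC t * h)%C l ->
  is_derive (fun s : R => Re (f (x + RtoC s * h)%C)) t (Re (h * l)%C) /\
  is_derive (fun s : R => Im (f (x + RtoC s * h)%C)) t (Im (h * l)%C).
Proof.
  intros H.
  assert (P : forall eps, 0 < eps -> exists d, 0 < d /\ forall k, k <> 0 -> Rabs k < d ->
    Cmod (f (x + RtoC (t + k) * h) - f (x + RtoC t * h) - RtoC k * (h * l))%C < eps * Rabs k).
  { intros eps He. pose proof (Cmod_ge_0 h) as Hh.
    destruct (proj1 (cder_eps _ _ _) H (eps / (Cmod h + 1))) as [d [d0 Hd]].
    - apply Rdiv_lt_0_compat; lra.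
    - exists (d / (Cmod h + 1)). split; [apply Rdiv_lt_0_compat; lra|].
      intros k Hk Hkd. specialize (Hd (x + RtoC (t + k) * h)%C).
      replace (x + RtoC (t + k) * h - (x + RtoC t * h))%C with (RtoC k * h)%C in Hd
        by (rewrite RtoC_plus; ring).
      rewrite Cmod_mult, Cmod_R in Hd.
      assert (Hk0 : 0 < Rabs k) by now apply Rabs_pos_lt.
      apply Rmult_lt_compat_r with (r := Cmod h + 1) in Hkd; [|lra].
      unfold Rdiv in Hkd. rewrite Rmult_assoc, Rinv_l in Hkd by lra.
      replace (RtoC k * (h * l))%C with (RtoC k * h * l)%C by ring.
      eapply Rle_lt_trans; [apply Hd; nra|].
      apply Rmult_lt_reg_r with (Cmod h + 1); [lra|].
      replace (eps / (Cmod h + 1) * (Rabs k * Cmod h) * (Cmod h + 1))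
        with (eps * Rabs k * Cmod h) by (field; lra).
      assert (0 < eps * Rabs k) by nra. nra. }
  split; apply is_derive_Reals; intros eps He; destruct (P eps He) as [d [d0 Hd]];
  exists (mkposreal d d0); intros k Hk Hkd; specialize (Hd k Hk Hkd);
  assert (Hk0 : 0 < Rabs k) by now apply Rabs_pos_lt.
  - pose proof (re_le_Cmod (f (x + RtoC (t + k) * h) - f (x + RtoC t * h) - RtoC k * (h * l))%C) as G.
    unfold Cminus in G. rewrite !re_plus, !re_opp, re_scal_l in G.
    replace ((Re (f (x + RtoC (t + k) * h)%C) - Re (f (x + RtoC t * h)%C)) / k - Re (h * l)%C)
      with ((Re (f (x + RtoC (t + k) * h)%C) + - Re (f (x + RtoC t * h)%C) + - (k * Re (h * l)%C)) * / k)
      by (field; auto).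
    rewrite Rabs_mult, Rabs_inv. apply Rmult_lt_reg_r with (Rabs k); auto.
    rewrite Rmult_assoc, Rinv_l by lra. unfold Cminus in Hd. lra.
  - pose proof (im_le_Cmod (f (x + RtoC (t + k) * h) - f (x + RtoC t * h) - RtoC k * (h * l))%C) as G.
    unfold Cminus in G. rewrite !Im_plus, !Im_opp in G.
    replace (Im (RtoC k * (h * l))%C) with (k * Im (h * l)%C) in G by (symmetry; apply Im_scal_l).
    replace ((Im (f (x + RtoC (t + k) * h)%C) - Im (f (x + RtoC t * h)%C)) / k - Im (h * l)%C)
      with ((Im (f (x + RtoC (t + k) * h)%C) + - Im (f (x + RtoC t * h)%C) + - (k * Im (h * l)%C)) * / k)
      by (field; auto).
    rewrite Rabs_mult, Rabs_inv. apply Rmult_lt_reg_r with (Rabs k); auto.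
    rewrite Rmult_assoc, Rinv_l by lra. unfold Cminus in Hd. lra.
Qed.

(** The real and imaginary parts have zero derivative along the segment. *)
Lemma cder_zero_segment (f : C -> C) (x y : C) :
  (forall t, 0 <= t <= 1 -> cder f (x + RtoC t * (y - x))%C (RtoC 0)) -> f x = f y.
Proof.
  intros H.
  assert (P : forall t, 0 <= t <= 1 ->
    is_derive (fun s : R => Re (f (x + RtoC s * (y - x))%C)) t 0 /\
    is_derive (fun s : R => Im (f (x + RtoC s * (y - x))%C)) t 0).
  { intros t Ht. destruct (cder_path _ _ _ _ _ (H t Ht)) as [A B].
    replace ((y - x) * RtoC 0)%C with (RtoC 0) in A, B by ring. split; assumption. }
  assert (E0 : (x + RtoC 0 * (y - x))%C = x) by ring.
  assert (E1 : (x + RtoC 1 * (y - x))%C = y) by ring.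
  apply Ceq.
  - pose proof (eq_is_derive (fun s : R => Re (f (x + RtoC s * (y - x))%C)) 0 1) as Q.
    cbv beta in Q. rewrite E0, E1 in Q. apply Q; [|lra]. intros t Ht; apply (P t Ht).
  - pose proof (eq_is_derive (fun s : R => Im (f (x + RtoC s * (y - x))%C)) 0 1) as Q.
    cbv beta in Q. rewrite E0, E1 in Q. apply Q; [|lra]. intros t Ht; apply (P t Ht).
Qed.

Lemma Cexp_plus a b : Cexp (a + b)%C = (Cexp a * Cexp b)%C.
Proof.
  unfold Cexp. rewrite re_plus, Im_plus, exp_plus, cos_plus, sin_plus.
  apply Ceq; simpl; ring.
Qed.

Lemma Cexp_0 : Cexp (RtoC 0) = RtoC 1.
Proof. unfold Cexp; simpl. rewrite exp_0, cos_0, sin_0. apply Ceq; simpl; ring. Qed.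

Lemma Cexp_opp a : (Cexp a * Cexp (- a) = RtoC 1)%C.
Proof. rewrite <- Cexp_plus, Cplus_opp_r. apply Cexp_0. Qed.

Lemma Cexp_neq_0 a : Cexp a <> RtoC 0.
Proof.
  intros E. pose proof (Cexp_opp a) as H. rewrite E, Cmult_0_l in H.
  apply RtoC_inj in H. lra.
Qed.

Lemma Cexp_opp_inv a : Cexp (- a)%C = (/ Cexp a)%C.
Proof.
  pose proof (Cexp_opp a). pose proof (Cexp_neq_0 a).
  replace (Cexp (- a))%C with (/ Cexp a * (Cexp a * Cexp (- a)))%C by (field; auto).
  rewrite H. ring.
Qed.

Lemma Cexp_pow a n : Cexp (RtoC (INR n) * a)%C = (Cexp a ^ n)%C.
Proof.
  induction n.
  - simpl. rewrite Cmult_0_l. apply Cexp_0.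
  - rewrite S_INR, RtoC_plus.
    replace ((RtoC (INR n) + RtoC 1) * a)%C with (RtoC (INR n) * a + a)%C by ring.
    rewrite Cexp_plus, IHn. simpl. ring.
Qed.

Lemma Cmod_Cexp a : Cmod (Cexp a) = exp (Re a).
Proof.
  unfold Cmod, Cexp; simpl.
  replace (exp (Re a) * cos (Im a) * (exp (Re a) * cos (Im a) * 1) +
    exp (Re a) * sin (Im a) * (exp (Re a) * sin (Im a) * 1))
    with (exp (Re a) * exp (Re a)).
  - apply sqrt_square. left; apply exp_pos.
  - pose proof (sin2_cos2 (Im a)). unfold Rsqr in H.
    replace (exp (Re a) * exp (Re a)) with (exp (Re a) * exp (Re a) * (sin (Im a) * sin (Im a) + cos (Im a) * cos (Im a)))
      by (rewrite H; ring). ring.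
Qed.

Lemma Rderiv_eps (f : R -> R) l : derivable_pt_lim f 0 l -> forall eps, 0 < eps ->
  exists d, 0 < d /\ forall h, Rabs h < d -> Rabs (f h - f 0 - l * h) <= eps * Rabs h.
Proof.
  intros H eps He. destruct (H eps He) as [d Hd]. exists d. split; [apply cond_pos|].
  intros h Hh. destruct (Req_dec h 0) as [->|E].
  - replace (f 0 - f 0 - l * 0) with 0 by ring. rewrite Rabs_R0. lra.
  - specialize (Hd h E Hh). rewrite Rplus_0_l in Hd.
    replace (f h - f 0 - l * h) with (((f h - f 0) / h - l) * h) by (field; auto).
    rewrite Rabs_mult. apply Rmult_le_compat_r; [apply Rabs_pos|lra].
Qed.

(** By the addition formula it suffices to expand at 0, where the real functions exp, cos and
    sin have known derivatives. *)
Lemma cder_Cexp z : cder Cexp z (Cexp z).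
Proof.
  assert (P : forall eps, 0 < eps -> exists d, 0 < d /\ forall h, Cmod h < d ->
    Cmod (Cexp h - RtoC 1 - h)%C <= eps * Cmod h).
  { intros eps He. set (e := Rmin 1 (eps / 20)).
    assert (He0 : 0 < e) by (apply Rmin_pos; lra).
    assert (He1 : e <= 1) by apply Rmin_l. assert (He2 : e <= eps / 20) by apply Rmin_r.
    destruct (Rderiv_eps exp 1 (derivable_pt_lim_exp_0) e He0) as [d1 [D1 E1]].
    assert (HC : derivable_pt_lim cos 0 0).
    { pose proof (derivable_pt_lim_cos 0). rewrite sin_0, Ropp_0 in H. exact H. }
    assert (HS : derivable_pt_lim sin 0 1).
    { pose proof (derivable_pt_lim_sin 0). rewrite cos_0 in H. exact H. }
    destruct (Rderiv_eps cos 0 HC e He0) as [d2 [D2 E2]].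
    destruct (Rderiv_eps sin 1 HS e He0) as [d3 [D3 E3]].
    exists (Rmin (Rmin d1 d2) (Rmin d3 e)).
    split; [apply Rmin_pos; apply Rmin_pos; assumption|]. intros h Hh.
    assert (Cmod h < d1 /\ Cmod h < d2 /\ Cmod h < d3 /\ Cmod h < e) as (B1 & B2 & B3 & B4).
    { repeat split; (eapply Rlt_le_trans; [exact Hh|]).
      - eapply Rle_trans; [apply Rmin_l|apply Rmin_l].
      - eapply Rle_trans; [apply Rmin_l|apply Rmin_r].
      - eapply Rle_trans; [apply Rmin_r|apply Rmin_l].
      - eapply Rle_trans; [apply Rmin_r|apply Rmin_r]. }
    pose proof (re_le_Cmod h) as Ra. pose proof (im_le_Cmod h) as Rb.
    set (m := Cmod h) in *. set (a := Re h) in *. set (b := Im h) in *.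
    specialize (E1 a ltac:(lra)). specialize (E2 b ltac:(lra)). specialize (E3 b ltac:(lra)).
    rewrite exp_0 in E1. rewrite cos_0 in E2. rewrite sin_0 in E3.
    pose proof (Rabs_pos a). pose proof (Rabs_pos b).
    assert (X1 : Rabs (exp a - 1) <= 2 * m).
    { replace (exp a - 1) with ((exp a - 1 - 1 * a) + a) by ring.
      eapply Rle_trans; [apply Rabs_triang|]. nra. }
    assert (X2 : Rabs (exp a) <= 3).
    { replace (exp a) with ((exp a - 1) + 1) by ring.
      eapply Rle_trans; [apply Rabs_triang|]. rewrite Rabs_R1. lra. }
    eapply Rle_trans; [apply Cmod_le_ReIm|].
    unfold Cminus. rewrite !re_plus, !re_opp, !Im_plus, !Im_opp.
    change (Re (Cexp h)) with (exp a * cos b). change (Im (Cexp h)) with (exp a * sin b).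
    change (Re (RtoC 1)) with 1. change (Im (RtoC 1)) with 0. fold a b.
    assert (Y1 : Rabs (exp a * cos b + - (1) + - a) <= e * m + 3 * (e * m)).
    { replace (exp a * cos b + - (1) + - a) with ((exp a - 1 - 1 * a) + exp a * (cos b - 1 - 0 * b)) by ring.
      eapply Rle_trans; [apply Rabs_triang|]. rewrite Rabs_mult.
      apply Rplus_le_compat; [nra|]. apply Rmult_le_compat; try apply Rabs_pos; auto. nra. }
    assert (Y2 : Rabs (exp a * sin b + - 0 + - b) <= 3 * (e * m) + 2 * e * m).
    { replace (exp a * sin b + - 0 + - b) with (exp a * (sin b - 0 - 1 * b) + (exp a - 1) * b) by ring.
      eapply Rle_trans; [apply Rabs_triang|]. rewrite !Rabs_mult.
      apply Rplus_le_compat; apply Rmult_le_compat; try apply Rabs_pos; auto; try nra. }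
    nra. }
  apply (proj2 (cder_eps _ _ _)). intros eps He.
  pose proof (Cmod_ge_0 (Cexp z)) as Hz.
  destruct (P (eps / (Cmod (Cexp z) + 1))) as [d [d0 Hd]]; [apply Rdiv_lt_0_compat; lra|].
  exists d. split; auto. intros y Hy. specialize (Hd _ Hy).
  replace (Cexp y - Cexp z - (y - z) * Cexp z)%C with (Cexp z * (Cexp (y - z) - RtoC 1 - (y - z)))%C.
  - rewrite Cmod_mult.
    apply Rle_trans with (Cmod (Cexp z) * (eps / (Cmod (Cexp z) + 1) * Cmod (y - z)%C)).
    + apply Rmult_le_compat_l; auto.
    + replace (Cmod (Cexp z) * (eps / (Cmod (Cexp z) + 1) * Cmod (y - z)%C))
        with ((eps * Cmod (y - z)%C) * (Cmod (Cexp z) / (Cmod (Cexp z) + 1))) by (field; lra).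
      rewrite <- (Rmult_1_r (eps * Cmod (y - z)%C)) at 2.
      apply Rmult_le_compat_l; [apply Rmult_le_pos; [lra|apply Cmod_ge_0]|].
      apply Rmult_le_reg_r with (Cmod (Cexp z) + 1); [lra|].
      unfold Rdiv. rewrite Rmult_assoc, Rinv_l by lra. lra.
  - replace y with (z + (y - z))%C at 3 by ring. rewrite Cexp_plus. ring.
Qed.

Definition exp_coef (n : nat) : C := RtoC (/ INR (fact n)).

Lemma conv_exp_coef R : conv R exp_coef.
Proof.
  intros r Hr. exists (exp r).
  pose proof (is_exp_Reals r) as H. unfold is_pseries in H.
  revert H. apply is_series_ext. intros n. unfold exp_coef.
  rewrite Cmod_R, Rabs_pos_eq.
  - change (pow_n r n * / INR (fact n) = / INR (fact n) * r ^ n). rewrite pow_n_pow. ring.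
  - left. apply Rinv_0_lt_compat, INR_fact_lt_0.
Qed.

Lemma dps_exp_coef n : dps exp_coef n = exp_coef n.
Proof.
  unfold dps, exp_coef. rewrite <- RtoC_mult. f_equal.
  rewrite fact_simpl, mult_INR. field. split; [apply INR_fact_neq_0|apply not_0_INR; lia].
Qed.

(** The exponential series E has derivative E, so E(z) Cexp(-z) is constant. *)
Lemma Cexp_ps z : Cexp z = ps exp_coef z.
Proof.
  assert (D : forall y, cder (fun y => ps exp_coef y * Cexp (- y))%C y (RtoC 0)).
  { intros y. eapply cder_eq; [|apply cder_mult].
    3:{ apply (cder_comp Cexp (fun y => - y)%C); [apply cder_Cexp|apply cder_opp, cder_id]. }
    2:{ apply (cder_ps (Cmod y + 1)); [apply conv_exp_coef|lra]. }
    rewrite (ps_ext (dps exp_coef) exp_coef) by apply dps_exp_coef. ring. }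
  pose proof (cder_zero_segment _ z (RtoC 0) (fun t _ => D _)) as H. cbv beta in H.
  assert (E0 : ps exp_coef (RtoC 0) = RtoC 1).
  { rewrite (ps_S 1) by (try apply conv_exp_coef; rewrite Cmod_0; lra).
    unfold exp_coef at 1. simpl. rewrite Rinv_1. ring. }
  rewrite E0, Cexp_opp_inv in H. replace (- RtoC 0)%C with (RtoC 0) in H by ring.
  rewrite Cexp_0 in H. pose proof (Cexp_neq_0 z).
  replace (ps exp_coef z) with (ps exp_coef z * / Cexp z * Cexp z)%C by (field; auto).
  rewrite H. ring.
Qed.

Lemma cos_eq_1 t : -2 * PI < t < 2 * PI -> cos t = 1 -> t = 0.
Proof.
  intros Ht E.
  assert (Hs : sin (t / 2) = 0).
  { replace t with (2 * (t / 2)) in E by field. rewrite cos_2a_sin in E. nra. }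
  destruct (Rtotal_order t 0) as [L|[L|L]]; auto; exfalso.
  - pose proof (sin_gt_0 (- (t / 2)) ltac:(lra) ltac:(lra)) as P. rewrite sin_neg in P. lra.
  - pose proof (sin_gt_0 (t / 2) ltac:(lra) ltac:(lra)). lra.
Qed.

Lemma Cexp_eq_1 a : Cexp a = RtoC 1 -> -2 * PI < Im a < 2 * PI -> a = RtoC 0.
Proof.
  intros E H.
  assert (R0 : Re a = 0).
  { pose proof (Cmod_Cexp a) as M. rewrite E, Cmod_1 in M.
    rewrite <- exp_0 in M. symmetry in M. now apply exp_inv in M. }
  apply Ceq; [exact R0|]. simpl.
  assert (Q : Re (Cexp a) = 1) by (rewrite E; reflexivity).
  unfold Cexp in Q; simpl in Q. rewrite R0, exp_0, Rmult_1_l in Q.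
  now apply cos_eq_1.
Qed.

Lemma Cexp_2PI : Cexp (RtoC (2 * PI) * Ci)%C = RtoC 1.
Proof.
  unfold Cexp. rewrite re_scal_l, im_mult. simpl.
  replace (2 * PI * 0) with 0 by ring. replace (2 * PI * 1 + 0 * 0) with (2 * PI) by ring.
  rewrite exp_0, cos_2PI, sin_2PI. apply Ceq; simpl; ring.
Qed.

Lemma Cexp_PI : Cexp (RtoC PI * Ci)%C = (- (1))%C.
Proof.
  unfold Cexp. rewrite re_scal_l, im_mult. simpl.
  replace (PI * 0) with 0 by ring. replace (PI * 1 + 0 * 0) with PI by ring.
  rewrite exp_0, cos_PI, sin_PI. apply Ceq; simpl; ring.
Qed.

(** * Cauchy's estimate *)

Lemma CSum_split N f : csummable f ->
  CSum f = (csum N f + CSum (fun k => f (N + k)%nat))%C.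
Proof.
  revert f. induction N; intros f H.
  - cbn [csum]. rewrite Cplus_0_l. reflexivity.
  - rewrite (CSum_S f H), (IHN (fun n => f (S n))) by (now apply csummable_S in H).
    rewrite csum_S_l, Cplus_assoc. reflexivity.
Qed.

Lemma Series_tail (u : nat -> R) eps : ex_series u -> 0 < eps ->
  exists N0, forall N, (N0 <= N)%nat -> Rabs (Series (fun k => u (N + k)%nat)) < eps.
Proof.
  intros H He. pose proof (Series_correct u H) as HS. apply is_series_Reals in HS.
  destruct (HS eps He) as [N0 H0]. exists (S N0). intros N HN.
  rewrite (Series_incr_n u N) in H0 by (auto; lia).
  specialize (H0 (pred N) ltac:(lia)). unfold Rdist in H0.
  rewrite <- Rabs_Ropp.
  match type of H0 with Rabs ?x < _ => replace (- Series (fun k => u (N + k)%nat)) with x by ring end.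
  exact H0.
Qed.

Lemma csum_geom n z : ((RtoC 1 - z) * csum n (fun k => z ^ k) = RtoC 1 - z ^ n)%C.
Proof. induction n; simpl; [ring|]. rewrite Cmult_plus_distr_l, IHn. ring. Qed.

Lemma csum_const n c : csum n (fun _ => c) = (RtoC (INR n) * c)%C.
Proof. induction n; [simpl; ring|]. cbn [csum]. rewrite IHn, S_INR, RtoC_plus. ring. Qed.

Lemma Cmod_csum_le n f M : (forall k, (k < n)%nat -> Cmod (f k) <= M) ->
  Cmod (csum n f) <= INR n * M.
Proof.
  induction n; intros H.
  - simpl. rewrite Cmod_0. lra.
  - cbn [csum]. eapply Rle_trans; [apply Cmod_triangle|]. rewrite S_INR.
    pose proof (IHn ltac:(auto)). pose proof (H n ltac:(lia)). lra.
Qed.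

(** Averaging the values at r w^j, multiplied by w^(-jn), over the N-th roots of unity w^j
    keeps the coefficients of index congruent to n modulo N.  As N grows only a_n r^n
    remains, and the average is bounded by M. *)
Lemma Cauchy_estimate R a r M n : conv R a -> 0 < r < R ->
  (forall x, Cmod x = r -> Cmod (ps a x) <= M) -> Cmod (a n) * r ^ n <= M.
Proof.
  intros Ha Hr HM.
  apply Rnot_lt_le. intros Hlt.
  set (eps := Cmod (a n) * r ^ n - M).
  destruct (Series_tail (fun m => Cmod (a m) * r ^ m) eps) as [N0 HN]; [apply Ha; lra | unfold eps; lra|].
  set (N := (N0 + n + 1)%nat). specialize (HN N ltac:(lia)).
  assert (HNpos : 0 < INR N) by (apply lt_0_INR; lia).
  assert (HNC : RtoC (INR N) <> RtoC 0) by (intros E; apply RtoC_inj in E; lra).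
  set (w := Cexp (RtoC (2 * PI / INR N) * Ci)%C).
  assert (Hw : forall k, (w ^ k)%C = Cexp (RtoC (INR k * (2 * PI / INR N)) * Ci)%C).
  { intros k. unfold w. rewrite <- Cexp_pow. f_equal. rewrite !RtoC_mult. ring. }
  assert (HwN : (w ^ N = RtoC 1)%C).
  { rewrite Hw. replace (INR N * (2 * PI / INR N)) with (2 * PI) by (field; lra). apply Cexp_2PI. }
  assert (Hwm : Cmod w = 1).
  { unfold w. rewrite Cmod_Cexp, re_scal_l. simpl. rewrite Rmult_0_r. apply exp_0. }
  assert (Hw0 : w <> RtoC 0) by (intros E; rewrite E, Cmod_0 in Hwm; lra).
  assert (Hw1 : forall k, (0 < k < N)%nat -> (w ^ k)%C <> RtoC 1).
  { intros k Hk E. rewrite Hw in E.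
    assert (0 < INR k) by (apply lt_0_INR; lia).
    assert (INR k < INR N) by (apply lt_INR; lia).
    assert (Hq : 0 < INR k * (2 * PI / INR N) < 2 * PI).
    { pose proof PI_RGT_0. split.
      - apply Rmult_lt_0_compat; auto. apply Rdiv_lt_0_compat; lra.
      - replace (INR k * (2 * PI / INR N)) with (2 * PI * (INR k / INR N)) by (field; lra).
        rewrite <- (Rmult_1_r (2 * PI)) at 2. apply Rmult_lt_compat_l; [lra|].
        apply Rmult_lt_reg_r with (INR N); auto. unfold Rdiv. rewrite Rmult_assoc, Rinv_l; lra. }
    apply Cexp_eq_1 in E.
    - assert (Q : Im (RtoC (INR k * (2 * PI / INR N)) * Ci)%C = 0) by (rewrite E; reflexivity).
      rewrite im_mult in Q. simpl in Q. lra.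
    - rewrite im_mult. simpl. lra. }
  (* The weight with which the term of index m enters the average. *)
  set (d := fun m => (/ RtoC (INR N) * csum N (fun j => (w ^ m * / w ^ n) ^ j))%C).
  assert (Hz : forall m, Cmod (w ^ m * / w ^ n)%C = 1).
  { intros m. rewrite Cmod_mult, Cmod_inv by now apply Cpow_nz.
    rewrite !Cmod_pow, Hwm, !pow1. field. }
  assert (Hd : forall m, Cmod (d m) <= 1).
  { intros m. unfold d. rewrite Cmod_mult, Cmod_inv by auto. rewrite Cmod_R, Rabs_pos_eq by lra.
    apply Rmult_le_reg_l with (INR N); auto. rewrite <- Rmult_assoc, Rinv_r by lra.
    rewrite Rmult_1_l. apply Cmod_csum_le. intros k _. rewrite Cmod_pow, Hz, pow1. lra. }
  assert (Hdn : d n = RtoC 1).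
  { unfold d. rewrite (csum_ext _ _ (fun _ => RtoC 1)).
    - rewrite csum_const. field. auto.
    - intros k _. rewrite Cinv_r by now apply Cpow_nz. apply Cpow_1_l. }
  assert (Hd0 : forall m, (m < N)%nat -> m <> n -> d m = RtoC 0).
  { intros m Hm Hmn. unfold d.
    assert (Z1 : (w ^ m * / w ^ n)%C <> RtoC 1).
    { intros E. assert (E' : (w ^ m = w ^ n)%C).
      { replace (w ^ m)%C with (w ^ m * / w ^ n * w ^ n)%C by (field; now apply Cpow_nz).
        rewrite E. ring. }
      assert (K : forall i j, (i < j)%nat -> (j < N)%nat -> (w ^ i)%C <> (w ^ j)%C).
      { intros i j Hij Hj Eij. apply (Hw1 (j - i)%nat); [lia|].
        replace (w ^ j)%C with (w ^ i * w ^ (j - i))%C in Eij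
          by (rewrite <- Cpow_add_r; f_equal; lia).
        pose proof (Cpow_nz w i Hw0).
        replace (w ^ (j - i))%C with (/ w ^ i * (w ^ i * w ^ (j - i)))%C by (field; auto).
        rewrite <- Eij. field. auto. }
      destruct (Nat.lt_total m n) as [L|[L|L]]; [|contradiction|].
      - apply (K m n); auto; lia.
      - apply (K n m); auto; lia. }
    assert (G : ((RtoC 1 - w ^ m * / w ^ n) * csum N (fun j => (w ^ m * / w ^ n) ^ j))%C = RtoC 0).
    { rewrite csum_geom. rewrite Cpow_mult_l, Cpow_inv by now apply Cpow_nz.
      rewrite <- !Cpow_mult_r, !(Nat.mul_comm _ N), !Cpow_mult_r, HwN, !Cpow_1_l. field. }
    assert (Z2 : (RtoC 1 - w ^ m * / w ^ n)%C <> RtoC 0).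
    { intros E. apply Z1. replace (w ^ m * / w ^ n)%C with (RtoC 1 - (RtoC 1 - w ^ m * / w ^ n))%C by ring.
      rewrite E. ring. }
    replace (csum N (fun j => (w ^ m * / w ^ n) ^ j)%C) with (RtoC 0); [ring|].
    symmetry. exact (Cmult_zero_r _ _ Z2 G). }
  assert (Hx : forall j, Cmod (RtoC r * w ^ j)%C = r).
  { intros j. rewrite Cmod_mult, Cmod_pow, Hwm, pow1, Cmod_R, Rabs_pos_eq; lra. }
  assert (Hs : forall j, csummable (fun m => a m * (RtoC r * w ^ j) ^ m)%C).
  { intros j. apply (conv_csummable R); auto. rewrite Hx. lra. }
  set (T := (/ RtoC (INR N) * csum N (fun j => (/ w ^ n) ^ j * ps a (RtoC r * w ^ j)))%C).
  assert (HT : Cmod T <= M).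
  { unfold T. rewrite Cmod_mult, Cmod_inv by auto. rewrite Cmod_R, Rabs_pos_eq by lra.
    apply Rmult_le_reg_l with (INR N); auto. rewrite <- Rmult_assoc, Rinv_r by lra.
    rewrite Rmult_1_l. apply Cmod_csum_le. intros k _.
    rewrite Cmod_mult, Cmod_pow, Cmod_inv by now apply Cpow_nz.
    rewrite Cmod_pow, Hwm, pow1, Rinv_1, pow1, Rmult_1_l. apply HM, Hx. }
  assert (ET : T = CSum (fun m => d m * (a m * RtoC r ^ m))%C).
  { unfold T. rewrite (csum_ext _ _ (fun j => CSum (fun m => (/ w ^ n) ^ j * (a m * (RtoC r * w ^ j) ^ m))%C)).
    - rewrite <- CSum_csum by (intros; now apply csummable_scal).
      rewrite <- CSum_scal by (apply csummable_csum; intros; now apply csummable_scal).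
      apply CSum_ext. intros m. unfold d. rewrite <- Cmult_assoc. f_equal.
      rewrite Cmult_comm, <- csum_scal. apply csum_ext. intros j _.
      rewrite !Cpow_mult_l, <- !Cpow_mult_r, (Nat.mul_comm j m). ring.
    - intros j _. unfold ps. rewrite CSum_scal; auto. }
  assert (Hsum : csummable (fun m => d m * (a m * RtoC r ^ m))%C).
  { apply csummable_le with (fun m => Cmod (a m) * r ^ m); [|apply Ha; lra].
    intros m. rewrite !Cmod_mult, Cmod_pow, Cmod_R, Rabs_pos_eq by lra.
    rewrite <- (Rmult_1_l (Cmod (a m) * r ^ m)) at 2. apply Rmult_le_compat_r; [|apply Hd].
    apply Rmult_le_pos; [apply Cmod_ge_0|apply pow_le; lra]. }
  rewrite (CSum_split N _ Hsum) in ET.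
  assert (EN : csum N (fun m => d m * (a m * RtoC r ^ m))%C = (a n * RtoC r ^ n)%C).
  { assert (K : forall L, (L <= N)%nat -> csum L (fun m => d m * (a m * RtoC r ^ m))%C
       = if (n <? L)%nat then (a n * RtoC r ^ n)%C else RtoC 0).
    { induction L; intros HL; [reflexivity|]. cbn [csum]. rewrite IHL by lia.
      destruct (Nat.eq_dec L n) as [->|E].
      - rewrite Nat.ltb_irrefl, (proj2 (Nat.ltb_lt n (S n))) by lia. rewrite Hdn. ring.
      - rewrite Hd0 by (auto; lia).
        destruct (n <? L)%nat eqn:E1; destruct (n <? S L)%nat eqn:E2; try ring;
        [apply Nat.ltb_lt in E1; apply Nat.ltb_ge in E2|
         apply Nat.ltb_ge in E1; apply Nat.ltb_lt in E2]; lia. }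
    rewrite K by lia. rewrite (proj2 (Nat.ltb_lt n N)) by lia. reflexivity. }
  rewrite EN in ET.
  assert (HB : Cmod (CSum (fun k => d (N + k)%nat * (a (N + k)%nat * RtoC r ^ (N + k)))%C) < eps).
  { eapply Rle_lt_trans; [|exact HN]. eapply Rle_trans; [|apply Rle_abs].
    apply Cmod_CSum_le_bound.
    - intros k. rewrite !Cmod_mult, Cmod_pow, Cmod_R, Rabs_pos_eq by lra.
      rewrite <- (Rmult_1_l (Cmod (a (N + k)%nat) * r ^ (N + k))) at 2. apply Rmult_le_compat_r; [|apply Hd].
      apply Rmult_le_pos; [apply Cmod_ge_0|apply pow_le; lra].
    - apply (ex_series_incr_n_R (fun m => Cmod (a m) * r ^ m)). apply Ha; lra. }
  assert (EA : (a n * RtoC r ^ n)%C = (T - CSum (fun k => d (N + k)%nat * (a (N + k)%nat * RtoC r ^ (N + k)))%C)%C)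
    by (rewrite ET; ring).
  assert (Cmod (a n) * r ^ n < M + eps).
  { replace (Cmod (a n) * r ^ n) with (Cmod (a n * RtoC r ^ n)%C)
      by (rewrite Cmod_mult, Cmod_pow, Cmod_R, Rabs_pos_eq; lra).
    rewrite EA. unfold Cminus. eapply Rle_lt_trans; [apply Cmod_triangle|]. rewrite Cmod_opp. lra. }
  unfold eps in *. lra.
Qed.

Lemma ps_zero_coef R a : 0 < R -> conv R a ->
  (forall x, 0 < Cmod x < R -> ps a x = RtoC 0) -> forall n, a n = RtoC 0.
Proof.
  intros HR Ha H n. apply Cmod_eq_0.
  assert (K : Cmod (a n) * (R / 2) ^ n <= 0).
  { apply (Cauchy_estimate R a (R / 2) 0 n Ha); [lra|]. intros x Hx. rewrite H by lra. rewrite Cmod_0. lra. }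
  pose proof (Cmod_ge_0 (a n)). assert (0 < (R / 2) ^ n) by (apply pow_lt; lra). nra.
Qed.

(** * The nome *)

Lemma RtoC_neq_0 r : r <> 0 -> RtoC r <> RtoC 0.
Proof. intros H E. apply RtoC_inj in E. contradiction. Qed.

Lemma Ci_neq_0 : Ci <> RtoC 0.
Proof. intros E. apply (f_equal Cmod) in E. rewrite Cmod_Ci, Cmod_0 in E. lra. Qed.

Lemma Ci2 : (Ci * Ci = - (1))%C.
Proof. apply Ceq; simpl; ring. Qed.

Lemma C2_neq_0 : RtoC 2 <> RtoC 0. Proof. apply RtoC_neq_0; lra. Qed.

Definition two_pi_i : C := (RtoC (2 * PI) * Ci)%C.

Lemma two_pi_i_neq_0 : two_pi_i <> RtoC 0.
Proof.
  pose proof PI_RGT_0. apply Cmult_neq_0; [apply RtoC_neq_0; lra | apply Ci_neq_0].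
Qed.

Lemma nome_two_pi_i u : nome u = Cexp (two_pi_i * u)%C. Proof. reflexivity. Qed.

Lemma nome_plus u v : nome (u + v)%C = (nome u * nome v)%C.
Proof. rewrite !nome_two_pi_i, Cmult_plus_distr_l. apply Cexp_plus. Qed.

Lemma nome_opp u : nome (- u)%C = (/ nome u)%C.
Proof.
  rewrite !nome_two_pi_i. replace (two_pi_i * - u)%C with (- (two_pi_i * u))%C by ring. apply Cexp_opp_inv.
Qed.

Lemma nome_0 : nome (RtoC 0) = RtoC 1.
Proof. rewrite nome_two_pi_i, Cmult_0_r. apply Cexp_0. Qed.

Lemma nome_neq_0 u : nome u <> RtoC 0.
Proof. apply Cexp_neq_0. Qed.

Lemma nome_1 : nome (RtoC 1) = RtoC 1.
Proof. rewrite nome_two_pi_i, Cmult_1_r. apply Cexp_2PI. Qed.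

Lemma nome_half : nome (RtoC (1 / 2)) = (- (1))%C.
Proof.
  rewrite nome_two_pi_i. unfold two_pi_i.
  replace (RtoC (2 * PI) * Ci * RtoC (1 / 2))%C with (RtoC PI * Ci)%C; [apply Cexp_PI|].
  replace PI with (2 * PI * (1 / 2)) at 1 by field. rewrite RtoC_mult. ring.
Qed.

Lemma Cmod_nome u : Cmod (nome u) = exp (- (2 * PI * Im u)).
Proof.
  rewrite nome_two_pi_i, Cmod_Cexp. f_equal. unfold two_pi_i.
  rewrite <- Cmult_assoc, re_scal_l, Cmult_comm, re_mult_Ci. ring.
Qed.

Lemma cder_nome u : cder nome u (two_pi_i * nome u)%C.
Proof.
  apply (cder_ext (fun y => Cexp (two_pi_i * y))%C); [reflexivity|].
  eapply cder_eq; [|apply (cder_comp Cexp (fun y => two_pi_i * y)%C)].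
  2: apply cder_Cexp. 2: apply cder_scal, cder_id.
  rewrite nome_two_pi_i. ring.
Qed.

Lemma Cmod_nome_lt_1 z : 0 < Im z -> 0 < Cmod (nome z) < 1.
Proof.
  intros H. rewrite Cmod_nome. split; [apply exp_pos|].
  rewrite <- exp_0. apply exp_increasing. pose proof PI_RGT_0.
  assert (0 < 2 * PI * Im z) by (apply Rmult_lt_0_compat; lra). lra.
Qed.

(** * The lattice function and its duplication formula *)

(** The coefficients of the Lambert series: multiplication of a series by them amounts to
    summing it over the translates by positive multiples of the period. *)
Definition lambert_coef (q : C) (m : nat) : C :=
  match m with O => RtoC 0 | S _ => (q ^ m / (RtoC 1 - q ^ m))%C end.

Definition lambert_deriv (q : C) (m : nat) : C := (RtoC (INR m) * lambert_coef q m)%C.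

Lemma Cpow_lt_1 q m : Cmod q < 1 -> Cmod (q ^ S m) < 1.
Proof.
  intros H. rewrite Cmod_pow. pose proof (Cmod_ge_0 q).
  simpl. assert (Cmod q ^ m <= 1); [|nra].
  rewrite <- (pow1 m). apply pow_incr; lra.
Qed.

Lemma one_minus_neq_0 x : x <> RtoC 1 -> (RtoC 1 - x)%C <> RtoC 0.
Proof.
  intros H E. apply H. replace x with (RtoC 1 - (RtoC 1 - x))%C by ring. rewrite E. ring.
Qed.

Lemma Cmod_lt_1_neq_1 x : Cmod x < 1 -> x <> RtoC 1.
Proof. intros H ->. rewrite Cmod_1 in H. lra. Qed.

Lemma lambert_den_neq_0 q m : Cmod q < 1 -> (RtoC 1 - q ^ S m)%C <> RtoC 0.
Proof. intros H. apply one_minus_neq_0, Cmod_lt_1_neq_1, Cpow_lt_1, H. Qed.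

Lemma Cmod_lambert_coef q m : Cmod q < 1 -> Cmod (lambert_coef q m) <= Cmod q ^ m / (1 - Cmod q).
Proof.
  intros H. pose proof (Cmod_ge_0 q).
  destruct m as [|m].
  - simpl lambert_coef. rewrite Cmod_0. simpl. unfold Rdiv. rewrite Rmult_1_l. left; apply Rinv_0_lt_compat; lra.
  - unfold lambert_coef. rewrite Cmod_div by now apply lambert_den_neq_0. rewrite Cmod_pow.
    apply Rmult_le_compat_l; [apply pow_le; lra|].
    apply Rinv_le_contravar; [lra|].
    pose proof (Cmod_triangle_sub (RtoC 1) (q ^ S m)) as T. rewrite Cmod_1, Cmod_pow in T.
    assert (Cmod q ^ S m <= Cmod q); [|lra].
    simpl. assert (Cmod q ^ m <= 1); [|nra]. rewrite <- (pow1 m). apply pow_incr; lra.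
Qed.

Lemma conv_lambert_coef q : 0 < Cmod q < 1 -> conv (/ Cmod q) (lambert_coef q).
Proof.
  intros H. apply conv_bounded. intros r Hr. exists (/ (1 - Cmod q)). intros m.
  apply Rle_trans with (Cmod q ^ m / (1 - Cmod q) * r ^ m).
  - apply Rmult_le_compat_r; [apply pow_le; lra|]. apply Cmod_lambert_coef; lra.
  - replace (Cmod q ^ m / (1 - Cmod q) * r ^ m) with ((Cmod q * r) ^ m * / (1 - Cmod q))
      by (rewrite Rpow_mult_distr; field; lra).
    rewrite <- (Rmult_1_l (/ (1 - Cmod q))) at 2.
    apply Rmult_le_compat_r; [left; apply Rinv_0_lt_compat; lra|].
    rewrite <- (pow1 m). apply pow_incr. split; [nra|].
    replace 1 with (Cmod q * / Cmod q) by (field; lra). apply Rmult_le_compat_l; lra.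
Qed.

Lemma conv_lambert_deriv q : 0 < Cmod q < 1 -> conv (/ Cmod q) (lambert_deriv q).
Proof. intros H. apply conv_n, conv_lambert_coef, H. Qed.

(** In terms of x = exp(2 pi i u) this is - 1/(4 pi^2) times the sum of 1/(u + m)^2 over the
    integers m; it has double poles at the integers and nowhere else. *)
Definition dpole (x : C) : C := (x / ((RtoC 1 - x) * (RtoC 1 - x)))%C.

(** The sum over all integers n of dpole(q^n x): the terms with n > 0 and n < 0 are expanded
    in powers of x and of 1/x and resummed over n, which gives the two Lambert series.  The
    result is the Weierstrass function of the lattice (1, z) up to a factor and an additive
    constant. *)
Definition wp (q x : C) : C := (dpole x + ps (lambert_deriv q) x + ps (lambert_deriv q) (/ x))%C.

(** The domain on which both Lambert series in [wp] converge; it corresponds to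
    |Im u| < Im z. *)
Definition annulus (q x : C) : Prop := Cmod q < Cmod x /\ Cmod x < / Cmod q.

Lemma annulus_inv q x : 0 < Cmod q -> annulus q x -> annulus q (/ x)%C /\ x <> RtoC 0.
Proof.
  intros Hq [H1 H2].
  assert (x <> RtoC 0) by (intros ->; rewrite Cmod_0 in H1; lra).
  split; auto. unfold annulus. rewrite Cmod_inv by auto. split.
  - rewrite <- (Rinv_inv (Cmod q)). apply Rinv_lt_contravar; auto.
    apply Rmult_lt_0_compat; [lra|]. apply Rinv_0_lt_compat; lra.
  - apply Rinv_lt_contravar; auto. nra.
Qed.

Lemma conv_1 : conv 1 (fun _ => RtoC 1).
Proof.
  intros r Hr. apply (ex_series_ext_R (fun n => r ^ n)).
  - intros n. change (r ^ n = Cmod (RtoC 1) * r ^ n). rewrite Cmod_1; ring.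
  - apply ex_series_geom. rewrite Rabs_pos_eq; lra.
Qed.

Lemma ps_geom x : Cmod x < 1 -> ps (fun _ => RtoC 1) x = (/ (RtoC 1 - x))%C.
Proof.
  intros H. pose proof (ps_S 1 _ x conv_1 H) as E.
  pose proof (one_minus_neq_0 x (Cmod_lt_1_neq_1 x H)) as N.
  set (S := ps (fun _ => RtoC 1) x) in *. cbv beta in E.
  replace (/ (RtoC 1 - x))%C with (/ (RtoC 1 - x) * (S - x * S))%C by (rewrite E at 1; field; auto).
  field; auto.
Qed.

Lemma dpole_series x : Cmod x < 1 -> dpole x = ps (fun n => RtoC (INR n)) x /\ conv 1 (fun n => RtoC (INR n)).
Proof.
  intros H.
  assert (Cn : conv 1 (fun n => RtoC (INR n))).
  { apply (conv_ext 1 _ (fun n => RtoC (INR n) * RtoC 1)%C); [intros; ring|]. apply conv_n, conv_1. }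
  split; auto.
  pose proof (ps_S 1 _ x Cn H) as E.
  rewrite (ps_ext (fun n => RtoC (INR (S n))) (fun n => RtoC (INR n) + RtoC 1)%C) in E
    by (intros; rewrite S_INR; apply RtoC_plus).
  rewrite (ps_plus 1) in E by (auto using conv_1).
  rewrite ps_geom in E by auto. change (INR 0) with 0 in E.
  pose proof (one_minus_neq_0 x (Cmod_lt_1_neq_1 x H)) as N.
  set (S := ps (fun n => RtoC (INR n)) x) in *.
  assert (E2 : ((RtoC 1 - x) * S = x * / (RtoC 1 - x))%C).
  { replace ((RtoC 1 - x) * S)%C with (S - x * S)%C by ring. rewrite E at 1. ring. }
  unfold dpole. replace S with (/ (RtoC 1 - x) * ((RtoC 1 - x) * S))%C by (field; auto).
  rewrite E2. field. auto.
Qed.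

Lemma dpole_inv x : x <> RtoC 0 -> x <> RtoC 1 -> dpole (/ x)%C = dpole x.
Proof.
  intros H0 H1. pose proof (one_minus_neq_0 x H1). unfold dpole. field.
  repeat split; auto.
  intros E. apply H. replace (RtoC 1 - x)%C with (- (x - RtoC 1))%C by ring. rewrite E. ring.
Qed.

Lemma wp_inv q x : x <> RtoC 0 -> x <> RtoC 1 -> wp q (/ x)%C = wp q x.
Proof.
  intros H0 H1. unfold wp. rewrite dpole_inv by auto.
  replace (/ / x)%C with x by (field; auto). ring.
Qed.

(** The identity 1/sin(a)^2 + 1/cos(a)^2 = 4/sin(2a)^2 in exponential form. *)
Lemma dpole_double y : (y * y)%C <> RtoC 1 -> (dpole y + dpole (- y) = RtoC 4 * dpole (y * y))%C.
Proof.
  intros H.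
  assert (y <> RtoC 1) by (intros ->; apply H; ring).
  assert (RtoC 1 - - y <> RtoC 0)%C.
  { apply one_minus_neq_0. intros E. apply H. replace (y * y)%C with (- y * - y)%C by ring. rewrite E. ring. }
  unfold dpole. replace (RtoC 1 - y * y)%C with ((RtoC 1 - y) * (RtoC 1 - - y))%C by ring.
  field. split; auto using one_minus_neq_0.
Qed.

Lemma CSum_eq_lim f g (phi : nat -> nat) : csummable f -> csummable g ->
  (forall N, (N <= phi N)%nat) ->
  (forall eps, 0 < eps -> exists N0, forall N, (N0 <= N)%nat -> Cmod (csum (phi N) f - csum N g)%C < eps) ->
  CSum f = CSum g.
Proof.
  intros Hf Hg Hphi K.
  assert (E : (CSum f - CSum g)%C = RtoC 0).
  { apply Cmod_eq_0. apply Rle_antisym; [|apply Cmod_ge_0].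
    apply Rnot_lt_le. intros Hlt. set (e := Cmod (CSum f - CSum g)) in *.
    destruct (Series_tail _ (e / 3) Hf) as [N1 HN1]; [lra|].
    destruct (Series_tail _ (e / 3) Hg) as [N2 HN2]; [lra|].
    destruct (K (e / 3)) as [N3 HN3]; [lra|].
    set (N := (N1 + N2 + N3)%nat). pose proof (Hphi N).
    specialize (HN1 (phi N) ltac:(lia)). specialize (HN2 N ltac:(lia)). specialize (HN3 N ltac:(lia)).
    assert (Ee : (CSum f - CSum g)%C = ((csum (phi N) f - csum N g) + (CSum (fun k => f (phi N + k)%nat) - CSum (fun k => g (N + k)%nat)))%C).
    { rewrite (CSum_split (phi N) f Hf), (CSum_split N g Hg). ring. }
    assert (B1 : Cmod (CSum (fun k => f (phi N + k)%nat)) < e / 3).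
    { eapply Rle_lt_trans; [|exact HN1]. eapply Rle_trans; [|apply Rle_abs]. apply Cmod_CSum_le.
      apply (ex_series_incr_n_R (fun n => Cmod (f n))). exact Hf. }
    assert (B2 : Cmod (CSum (fun k => g (N + k)%nat)) < e / 3).
    { eapply Rle_lt_trans; [|exact HN2]. eapply Rle_trans; [|apply Rle_abs]. apply Cmod_CSum_le.
      apply (ex_series_incr_n_R (fun n => Cmod (g n))). exact Hg. }
    assert (e <= Cmod (csum (phi N) f - csum N g)%C + (Cmod (CSum (fun k => f (phi N + k)%nat)) + Cmod (CSum (fun k => g (N + k)%nat)))).
    { unfold e. rewrite Ee. eapply Rle_trans; [apply Cmod_triangle|]. apply Rplus_le_compat_l.
      unfold Cminus. eapply Rle_trans; [apply Cmod_triangle|]. rewrite Cmod_opp. lra. }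
    lra. }
  replace (CSum f) with (CSum g + (CSum f - CSum g))%C by ring. rewrite E. ring.
Qed.

Lemma CSum_even f g : csummable f -> csummable g ->
  (forall n, f (2 * n)%nat = g n) -> (forall n, f (2 * n + 1)%nat = RtoC 0) ->
  CSum f = CSum g.
Proof.
  intros Hf Hg H0 H1.
  assert (K : forall N, csum (2 * N) f = csum N g).
  { induction N; [reflexivity|]. replace (2 * S N)%nat with (S (S (2 * N))) by lia.
    cbn [csum]. rewrite IHN, H0. replace (S (2 * N)) with (2 * N + 1)%nat by lia. rewrite H1. ring. }
  apply CSum_eq_lim with (phi := fun N => (2 * N)%nat); auto; [intros; lia|].
  intros eps He. exists O. intros N _. rewrite K.
  replace (csum N g - csum N g)%C with (RtoC 0) by ring. now rewrite Cmod_0.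
Qed.

Lemma lambert_coef_even q m : lambert_coef q (2 * m) = lambert_coef (q * q) m.
Proof.
  destruct m; [reflexivity|].
  assert (E : (q ^ (2 * S m) = (q * q) ^ S m)%C) by (rewrite Cpow_mult_r; f_equal; simpl; ring).
  unfold lambert_coef. rewrite <- E. replace (2 * S m)%nat with (S (S (2 * m))) by lia. reflexivity.
Qed.

Lemma Cmod_sqr q : Cmod (q * q)%C = Cmod q * Cmod q. Proof. apply Cmod_mult. Qed.

Lemma sqr_lt_1 q : 0 < Cmod q < 1 -> 0 < Cmod (q * q) < 1.
Proof. rewrite Cmod_sqr. nra. Qed.

Lemma ps_lambert_deriv_double q y : 0 < Cmod q < 1 -> Cmod y < / Cmod q ->
  (ps (lambert_deriv q) y + ps (lambert_deriv q) (- y) = RtoC 4 * ps (lambert_deriv (q * q)) (y * y))%C.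
Proof.
  intros Hq Hy.
  assert (Hy' : Cmod (- y) < / Cmod q) by now rewrite Cmod_opp.
  pose proof (conv_csummable _ _ y (conv_lambert_deriv q Hq) Hy) as S1.
  pose proof (conv_csummable _ _ (- y)%C (conv_lambert_deriv q Hq) Hy') as S2.
  assert (S3 : csummable (fun n => lambert_deriv (q * q) n * (y * y) ^ n)%C).
  { apply (conv_csummable (/ Cmod (q * q))); [apply conv_lambert_deriv, sqr_lt_1, Hq|].
    rewrite !Cmod_sqr, Rinv_mult. pose proof (Cmod_ge_0 y). nra. }
  unfold ps. rewrite <- CSum_plus by assumption. rewrite <- CSum_scal by assumption.
  apply CSum_even.
  - now apply csummable_plus.
  - now apply csummable_scal.
  - intros n. unfold lambert_deriv. rewrite lambert_coef_even, !Cpow_mult_r, mult_INR, RtoC_mult.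
    change (INR 2) with 2. replace ((- y) ^ 2)%C with (y * y)%C by (simpl; ring).
    replace (y ^ 2)%C with (y * y)%C by (simpl; ring).
    replace (RtoC 4) with (RtoC 2 * RtoC 2)%C by (rewrite <- RtoC_mult; f_equal; ring). ring.
  - intros n. rewrite !Cpow_add_r, !Cpow_mult_r, !Cpow_1_r.
    replace ((- y) ^ 2)%C with (y ^ 2)%C by (simpl; ring). ring.
Qed.

(** Halving a point along the period 1 replaces the lattice (1, z) by (1, 2z), that is q by
    q^2. *)
Lemma wp_double q y : 0 < Cmod q < 1 -> annulus q y -> (y * y)%C <> RtoC 1 ->
  (wp q y + wp q (- y) = RtoC 4 * wp (q * q) (y * y))%C.
Proof.
  intros Hq Hy H1. destruct (annulus_inv q y (proj1 Hq) Hy) as [Hi H0].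
  pose proof (ps_lambert_deriv_double q y Hq (proj2 Hy)) as E1.
  pose proof (ps_lambert_deriv_double q (/ y) Hq (proj2 Hi)) as E2.
  pose proof (dpole_double y H1) as E3. unfold wp.
  replace (/ - y)%C with (- / y)%C by (field; auto).
  replace (/ (y * y))%C with (/ y * / y)%C by (field; auto).
  rewrite !Cmult_plus_distr_l, <- E1, <- E2, <- E3. ring.
Qed.

(** The translates by multiples of z are those by even and by odd multiples.  In coefficients:
    on the terms x^m the identity is
    q^2m/(1 - q^2m) + q^m/(1 - q^2m) = q^m/(1 - q^m), and the pole term of x/q is
    expanded in powers of q/x. *)
Lemma wp_step q x : 0 < Cmod q < 1 -> Cmod q < Cmod x -> Cmod x <= 1 ->
  (wp (q * q) x + wp (q * q) (x / q) = wp q x)%C.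
Proof.
  intros Hq Hx1 Hx2.
  assert (q0 : q <> RtoC 0) by (apply Cmod_gt_0; lra).
  assert (x0 : x <> RtoC 0) by (apply Cmod_gt_0; lra).
  assert (Hqx : Cmod (q / x) < 1).
  { rewrite Cmod_div by auto. apply Rmult_lt_reg_r with (Cmod x); [lra|].
    unfold Rdiv. rewrite Rmult_assoc, Rinv_l by lra. lra. }
  assert (Iq : 1 < / Cmod q) by (rewrite <- Rinv_1; apply Rinv_lt_contravar; lra).
  assert (Cq : conv (/ Cmod q) (lambert_deriv q)) by now apply conv_lambert_deriv.
  assert (Cq2 : conv (/ Cmod (q * q)) (lambert_deriv (q * q))) by now apply conv_lambert_deriv, sqr_lt_1.
  assert (Iqq : / Cmod (q * q) = / Cmod q * / Cmod q) by (rewrite Cmod_sqr; apply Rinv_mult).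
  assert (E0 : dpole (x / q) = ps (fun n => RtoC (INR n)) (q / x)).
  { rewrite <- (proj1 (dpole_series _ Hqx)). replace (x / q)%C with (/ (q / x))%C by (field; auto).
    apply dpole_inv.
    - apply Cmult_neq_0; auto. apply Cmod_gt_0. rewrite Cmod_inv by auto. apply Rinv_0_lt_compat; lra.
    - now apply Cmod_lt_1_neq_1. }
  unfold wp. rewrite E0. replace (/ (x / q))%C with (q / x)%C by (field; auto).
  assert (S1 : csummable (fun n => lambert_deriv (q * q) n * x ^ n)%C).
  { apply (conv_csummable _ _ _ Cq2). rewrite Iqq. nra. }
  assert (S2 : csummable (fun n => lambert_deriv (q * q) n * (/ x) ^ n)%C).
  { apply (conv_csummable _ _ _ Cq2). rewrite Iqq, Cmod_inv by auto.
    assert (/ Cmod x < / Cmod q) by (apply Rinv_lt_contravar; nra). nra. }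
  assert (S3 : csummable (fun n => lambert_deriv (q * q) n * (x / q) ^ n)%C).
  { apply (conv_csummable _ _ _ Cq2). rewrite Iqq, Cmod_div by auto. unfold Rdiv. nra. }
  assert (S4 : csummable (fun n => lambert_deriv (q * q) n * (q / x) ^ n)%C).
  { apply (conv_csummable _ _ _ Cq2). rewrite Iqq. nra. }
  assert (S5 : csummable (fun n => RtoC (INR n) * (q / x) ^ n)%C).
  { apply (conv_csummable 1); [exact (proj2 (dpole_series _ Hqx))|auto]. }
  assert (K : forall m, Cmod (q * q) < 1 /\ (RtoC 1 - q ^ S m)%C <> RtoC 0 /\ (RtoC 1 + q ^ S m)%C <> RtoC 0).
  { intros m. assert (Q : Cmod (q * q) < 1) by now apply sqr_lt_1.
    repeat split; auto.
    - now apply lambert_den_neq_0.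
    - intros E. pose proof (Cpow_lt_1 q m (proj2 Hq)) as L.
      replace (q ^ S m)%C with (- RtoC 1 + (RtoC 1 + q ^ S m))%C in L by ring.
      rewrite E, Cplus_0_r, Cmod_opp, Cmod_1 in L. lra. }
  assert (X1 : (ps (lambert_deriv (q * q)) x + ps (lambert_deriv (q * q)) (x / q) = ps (lambert_deriv q) x)%C).
  { unfold ps. rewrite <- CSum_plus by auto. apply CSum_ext. intros n.
    unfold lambert_deriv. destruct n; [simpl; ring|]. unfold lambert_coef.
    destruct (K n) as (K1 & K2 & K3).
    replace ((x / q) ^ S n)%C with (x ^ S n * / q ^ S n)%C
      by (unfold Cdiv; rewrite Cpow_mult_l, Cpow_inv; auto).
    rewrite Cpow_mult_l. pose proof (Cpow_nz q (S n) q0).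
    set (Q := (q ^ S n)%C) in *. set (X := (x ^ S n)%C).
    replace (RtoC 1 - Q * Q)%C with ((RtoC 1 - Q) * (RtoC 1 + Q))%C by ring.
    field. auto. }
  assert (X2 : (ps (lambert_deriv (q * q)) (/ x) + ps (lambert_deriv (q * q)) (q / x) + ps (fun n => RtoC (INR n)) (q / x)
     = ps (lambert_deriv q) (/ x))%C).
  { unfold ps. rewrite <- CSum_plus by auto. rewrite <- CSum_plus by auto using csummable_plus.
    apply CSum_ext. intros n.
    unfold lambert_deriv. destruct n; [simpl; ring|]. unfold lambert_coef.
    destruct (K n) as (K1 & K2 & K3).
    replace ((q / x) ^ S n)%C with (q ^ S n * (/ x) ^ S n)%C
      by (unfold Cdiv; rewrite Cpow_mult_l; auto).
    rewrite Cpow_mult_l. pose proof (Cpow_nz q (S n) q0).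
    set (Q := (q ^ S n)%C) in *. set (X := ((/ x) ^ S n)%C).
    replace (RtoC 1 - Q * Q)%C with ((RtoC 1 - Q) * (RtoC 1 + Q))%C by ring.
    field. auto. }
  rewrite <- X1, <- X2. ring.
Qed.

(** The four values are those at the halves of a point of the lattice quotient: with s a
    square root of q, the square roots of x = y^2 and of x/q are y, -y, y/s and -y/s. *)
Lemma wp_distribution q s y : 0 < Cmod q < 1 -> (s * s = q)%C ->
  Cmod s <= Cmod (y * y) -> Cmod (y * y) <= 1 -> (y * y)%C <> RtoC 1 ->
  (wp q y + wp q (- y) + wp q (y / s) + wp q (- (y / s)) = RtoC 4 * wp q (y * y))%C.
Proof.
  intros Hq Hs Hy1 Hy2 Hy3.
  assert (Ms : Cmod s * Cmod s = Cmod q) by (rewrite <- Cmod_mult, Hs; auto).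
  pose proof (Cmod_ge_0 s) as Ps. pose proof (Cmod_ge_0 y) as Py.
  assert (Hs0 : 0 < Cmod s < 1) by nra.
  assert (s0 : s <> RtoC 0) by (apply Cmod_gt_0; lra).
  rewrite Cmod_mult in Hy1, Hy2.
  assert (Iq : / Cmod q = / Cmod s * / Cmod s) by (rewrite <- Ms; apply Rinv_mult).
  assert (Is : 1 < / Cmod s) by (rewrite <- Rinv_1; apply Rinv_lt_contravar; lra).
  assert (Yl : Cmod s < Cmod y) by nra.
  assert (Yu : Cmod y <= 1) by nra.
  assert (A1 : annulus q y) by (split; [nra|rewrite Iq; nra]).
  assert (Ey : Cmod (y / s) = Cmod y * / Cmod s) by (apply Cmod_div; auto).
  assert (A2 : annulus q (y / s)).
  { unfold annulus. rewrite Ey. split.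
    - apply Rlt_le_trans with (1 * 1); [lra|].
      apply Rmult_lt_compat_r with (r := / Cmod s) in Yl; [|lra]. rewrite Rinv_r in Yl by lra. lra.
    - rewrite Iq. nra. }
  assert (y0 : y <> RtoC 0) by (apply Cmod_gt_0; lra).
  assert (N2 : (y / s * (y / s))%C <> RtoC 1).
  { intros E. apply (f_equal Cmod) in E. rewrite Cmod_mult, Ey, Cmod_1 in E.
    assert (1 < Cmod y * / Cmod s); [|nra].
    apply Rmult_lt_compat_r with (r := / Cmod s) in Yl; [|lra]. rewrite Rinv_r in Yl by lra. lra. }
  rewrite <- Cplus_assoc, (wp_double q (y / s) Hq A2 N2), (wp_double q y Hq A1 Hy3).
  rewrite <- (wp_step q (y * y)); auto.
  - replace (y / s * (y / s))%C with (y * y / q)%C by (rewrite <- Hs; field; auto). ring.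
  - rewrite Cmod_mult. nra.
  - rewrite Cmod_mult. lra.
Qed.

(** The same relation for |x| >= 1, obtained through x -> 1/x; the shift by the period then
    goes in the opposite direction so that all points stay in the annulus. *)
Lemma wp_distribution_outer q s y : 0 < Cmod q < 1 -> (s * s = q)%C ->
  1 <= Cmod (y * y) -> Cmod (y * y) <= / Cmod s -> (y * y)%C <> RtoC 1 ->
  (wp q y + wp q (- y) + wp q (y * s) + wp q (- (y * s)) = RtoC 4 * wp q (y * y))%C.
Proof.
  intros Hq Hs Hy1 Hy2 Hy3.
  assert (Ms : Cmod s * Cmod s = Cmod q) by (rewrite <- Cmod_mult, Hs; auto).
  pose proof (Cmod_ge_0 s) as Ps. pose proof (Cmod_ge_0 y) as Py.
  assert (Hs0 : 0 < Cmod s < 1) by nra.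
  assert (s0 : s <> RtoC 0) by (apply Cmod_gt_0; lra).
  assert (y0 : y <> RtoC 0) by (intros ->; rewrite Cmult_0_l, Cmod_0 in Hy1; lra).
  assert (yy0 : (y * y)%C <> RtoC 0) by now apply Cmult_neq_0.
  assert (E : (/ y * / y = / (y * y))%C) by (field; auto).
  pose proof (wp_distribution q s (/ y)%C Hq Hs) as D. rewrite !E in D.
  rewrite Cmod_inv in D by auto.
  assert (ym1 : forall w, (w * w)%C <> RtoC 1 -> w <> RtoC 1 /\ (- w)%C <> RtoC 1).
  { intros w Hw. split; intros Ew; apply Hw; [rewrite Ew; ring|].
    replace (w * w)%C with (- w * - w)%C by ring. rewrite Ew; ring. }
  assert (N2 : (y * s * (y * s))%C <> RtoC 1).
  { intros E1. apply (f_equal Cmod) in E1. rewrite !Cmod_mult, Cmod_1 in E1. rewrite Cmod_mult in Hy1, Hy2.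
    apply Rmult_le_compat_r with (r := Cmod s) in Hy2; [|lra]. rewrite Rinv_l in Hy2 by lra. nra. }
  destruct (ym1 _ Hy3) as [n1 n2]. destruct (ym1 _ N2) as [n3 n4].
  assert (o : forall w, w <> RtoC 0 -> (- w)%C <> RtoC 0).
  { intros w Hw E1. apply Hw. replace w with (- - w)%C by ring. rewrite E1. ring. }
  assert (ys : (y * s)%C <> RtoC 0) by now apply Cmult_neq_0.
  rewrite wp_inv in D by auto.
  replace (- / y)%C with (/ - y)%C in D by (field; auto).
  replace (/ y / s)%C with (/ (y * s))%C in D by (field; auto).
  replace (- / (y * s))%C with (/ - (y * s))%C in D by (field; auto).
  rewrite (wp_inv q (- y)), (wp_inv q (y * s)), (wp_inv q (- (y * s))), (wp_inv q (y * y)) in D by auto.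
  apply D.
  - rewrite <- (Rinv_inv (Cmod s)). apply Rinv_le_contravar; auto. lra.
  - rewrite <- Rinv_1. apply Rinv_le_contravar; lra.
  - intros E1. apply Hy3. replace (y * y)%C with (/ / (y * y))%C by (field; auto). rewrite E1. field.
Qed.

(** * Herglotz's argument *)

Definition in_box (a b : R) : Prop := Rabs a <= 1 / 2 /\ Rabs b <= 1 / 2.
Definition nonzero2 (a b : R) : Prop := a <> 0 \/ b <> 0.

(** Compactness, with the cover chosen so that the size of a neighbourhood also bounds the
    function there. *)
Lemma bounded_on_box (F : R -> R -> C) :
  (forall a0 b0, exists d K, 0 < d /\ forall a b, in_box a b -> nonzero2 a b ->
     in_box a0 b0 -> Rabs (a - a0) < d -> Rabs (b - b0) < d -> Cmod (F a b) <= K) ->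
  exists K, forall a b, in_box a b -> nonzero2 a b -> Cmod (F a b) <= K.
Proof.
  intros H.
  assert (H' : forall p : R * R, exists d : posreal, forall a b, in_box a b -> nonzero2 a b ->
     in_box (fst p) (snd p) -> Rabs (a - fst p) < d -> Rabs (b - snd p) < d -> Cmod (F a b) <= / d).
  { intros [a0 b0]. destruct (H a0 b0) as [d [K [d0 HK]]].
    assert (P : 0 < Rmin d (/ (Rabs K + 1))).
    { apply Rmin_pos; auto. apply Rinv_0_lt_compat. pose proof (Rabs_pos K); lra. }
    exists (mkposreal _ P). simpl. intros a b Hab Hn H0 Ha Hb.
    apply Rle_trans with K.
    - exact (HK a b Hab Hn H0 (Rlt_le_trans _ _ _ Ha (Rmin_l _ _)) (Rlt_le_trans _ _ _ Hb (Rmin_l _ _))).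
    - apply Rle_trans with (Rabs K + 1); [pose proof (Rle_abs K); lra|].
      rewrite <- (Rinv_inv (Rabs K + 1)) at 1. apply Rinv_le_contravar; auto. apply Rmin_r. }
  destruct (functional_choice _ H') as [delta Hdelta].
  destruct (compactness_value_2d (- (1 / 2)) (1 / 2) (- (1 / 2)) (1 / 2) (fun a b => delta (a, b))) as [d Hd].
  exists (/ d). intros a b Hab Hn. destruct Hab as [Ha Hb].
  apply Rnot_lt_le. intros Hlt.
  apply (Hd a b); [apply Rabs_le_between; exact Ha|apply Rabs_le_between; exact Hb|].
  intros (u & v & Hu & Hv & Hau & Hbv & Hduv).
  pose proof (Hdelta (u, v) a b (conj Ha Hb) Hn) as Q. simpl in Q.
  assert (Cmod (F a b) <= / delta (u, v)).
  { apply Q; auto. split; apply Rabs_le_between; assumption. }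
  assert (/ delta (u, v) <= / d) by (apply Rinv_le_contravar; [apply cond_pos|assumption]).
  lra.
Qed.

(** Let S be the supremum of |F|.  The relation bounds |F(a, b)| by 3/4 S + 1/4 |F(a/2, b/2)|,
    and after k steps by (1 - 4^-k) S + 4^-k |F(2^-k (a, b))|.  For large k the last value is
    below S/2, uniformly on the box, so S = 0. *)
Lemma herglotz (F : R -> R -> C) :
  (exists K, forall a b, in_box a b -> nonzero2 a b -> Cmod (F a b) <= K) ->
  (forall eps, 0 < eps -> exists d, 0 < d /\ forall a b, Rabs a < d -> Rabs b < d -> nonzero2 a b ->
     Cmod (F a b) < eps) ->
  (forall a b, in_box a b -> nonzero2 a b -> exists a1 b1, in_box a1 b1 /\ a1 <> 0 /\ b1 <> 0 /\
     (RtoC 4 * F a b = F (a / 2)%R (b / 2)%R + F a1 (b / 2)%R + F (a / 2)%R b1 + F a1 b1)%C) ->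
  forall a b, in_box a b -> nonzero2 a b -> F a b = RtoC 0.
Proof.
  intros [K HK] Hlim Hdist.
  set (E := fun x => exists a b, in_box a b /\ nonzero2 a b /\ x = Cmod (F a b)).
  assert (half : forall a b, in_box a b -> in_box (a / 2) (b / 2)).
  { intros a b [Ha Hb]. split; unfold Rdiv; rewrite Rabs_mult, (Rabs_pos_eq (/ 2)) by lra; lra. }
  assert (halfn : forall a b, nonzero2 a b -> nonzero2 (a / 2) (b / 2)).
  { intros a b [Ha|Hb]; [left|right]; lra. }
  destruct (completeness E) as [S [HS1 HS2]].
  { exists K. intros x (a & b & Hb & Hn & ->). auto. }
  { exists (Cmod (F (1/2) (1/2))), (1/2), (1/2). repeat split; try (rewrite Rabs_pos_eq; lra). left; lra. }
  assert (HS : forall a b, in_box a b -> nonzero2 a b -> Cmod (F a b) <= S).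
  { intros a b H1 H2. apply HS1. exists a, b. auto. }
  assert (S0 : S <= 0).
  { apply Rnot_lt_le. intros Hlt.
    destruct (Hlim (S / 2) ltac:(lra)) as [d [d0 Hd]].
    assert (it : forall k a b, in_box a b -> nonzero2 a b ->
      Cmod (F a b) <= (1 - (/ 4) ^ k) * S + (/ 4) ^ k * Cmod (F (a * (/ 2) ^ k) (b * (/ 2) ^ k))).
    { induction k; intros a b Hb Hn.
      - simpl. rewrite !Rmult_1_r. lra.
      - destruct (Hdist a b Hb Hn) as (a1 & b1 & Hb1 & Ha0 & Hb0 & EE).
        assert (4 * Cmod (F a b) <= Cmod (F (a / 2) (b / 2)) + 3 * S).
        { replace (4 * Cmod (F a b)) with (Cmod (RtoC 4 * F a b)%C)
            by (rewrite Cmod_mult, Cmod_R, Rabs_pos_eq; lra).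
          rewrite EE. destruct (half a b Hb) as [Q1 Q2]. destruct Hb1 as [Q3 Q4].
          pose proof (HS a1 (b / 2) (conj Q3 Q2) (or_introl Ha0)).
          pose proof (HS (a / 2) b1 (conj Q1 Q4) (or_intror Hb0)).
          pose proof (HS a1 b1 (conj Q3 Q4) (or_introl Ha0)).
          eapply Rle_trans; [apply Cmod_triangle|].
          eapply Rle_trans; [apply Rplus_le_compat_r, Cmod_triangle|].
          eapply Rle_trans; [apply Rplus_le_compat_r, Rplus_le_compat_r, Cmod_triangle|]. lra. }
        pose proof (IHk (a / 2) (b / 2) (half _ _ Hb) (halfn _ _ Hn)) as I.
        simpl pow. replace (a * (/ 2 * (/ 2) ^ k)) with (a / 2 * (/ 2) ^ k) by (unfold Rdiv; ring).
        replace (b * (/ 2 * (/ 2) ^ k)) with (b / 2 * (/ 2) ^ k) by (unfold Rdiv; ring). lra. }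
    assert (Hk : exists k, (/ 2) ^ k < d).
    { destruct (pow_lt_1_zero (/ 2) ltac:(rewrite Rabs_pos_eq; lra) d d0) as [k Hk].
      exists k. specialize (Hk k (le_n k)). rewrite Rabs_pos_eq in Hk; auto. apply pow_le; lra. }
    destruct Hk as [k Hk].
    assert (P2 : 0 < (/ 2) ^ k) by (apply pow_lt; lra).
    assert (P4 : 0 < (/ 4) ^ k) by (apply pow_lt; lra).
    assert (B : S <= (1 - (/ 4) ^ k) * S + (/ 4) ^ k * (S / 2)).
    { apply HS2. intros x (a & b & Hb & Hn & ->).
      eapply Rle_trans; [apply (it k a b Hb Hn)|]. apply Rplus_le_compat_l, Rmult_le_compat_l; [lra|].
      left. destruct Hb as [Ha Hb]. apply Hd.
      - rewrite Rabs_mult, (Rabs_pos_eq ((/ 2) ^ k)) by lra. nra.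
      - rewrite Rabs_mult, (Rabs_pos_eq ((/ 2) ^ k)) by lra. nra.
      - destruct Hn as [Hn|Hn]; [left|right]; apply Rmult_integral_contrapositive_currified; lra. }
    nra. }
  intros a b Hb Hn. apply Cmod_eq_0. pose proof (HS a b Hb Hn). pose proof (Cmod_ge_0 (F a b)). lra.
Qed.

(** * Derivatives and poles of the lattice function *)

Lemma cder_wp q u : 0 < Cmod q < 1 -> annulus q (nome u) -> nome u <> RtoC 1 ->
  exists l, cder (fun v => wp q (nome v)) u l.
Proof.
  intros Hq Ha H1. destruct (annulus_inv q _ (proj1 Hq) Ha) as [Hi H0].
  pose proof (cder_nome u) as Dn.
  assert (Dm : cder (fun v => nome (- v)%C) u (- (1) * (two_pi_i * nome (- u)))%C).
  { apply (cder_comp nome (fun v => - v)%C); [apply cder_nome|]. apply cder_opp, cder_id. }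
  eexists. unfold wp.
  apply cder_plus; [apply cder_plus|].
  - unfold dpole. apply cder_div; [|exact Dn|].
    + apply Cmult_neq_0; now apply one_minus_neq_0.
    + apply cder_mult; (apply cder_minus; [apply cder_const|exact Dn]).
  - apply (cder_comp (ps (lambert_deriv q)) nome); [|exact Dn].
    apply (cder_ps (/ Cmod q)); [now apply conv_lambert_deriv|apply Ha].
  - apply (cder_ext (fun v => ps (lambert_deriv q) (nome (- v)%C))); [intros; now rewrite nome_opp|].
    apply (cder_comp (ps (lambert_deriv q)) (fun v => nome (- v)%C)); [|exact Dm].
    apply (cder_ps (/ Cmod q)); [now apply conv_lambert_deriv|rewrite nome_opp; apply Hi].
Qed.

(** A primitive of [wp] up to the factor 2 pi i, in the variable u: up to normalization, the
    Weierstrass zeta function made periodic under u -> u + 1. *)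
Definition wzeta (q x : C) : C :=
  ((RtoC 1 + x) / (RtoC 2 * (RtoC 1 - x)) + ps (lambert_coef q) x - ps (lambert_coef q) (/ x))%C.

Lemma ps_lambert_deriv_dps q x : 0 < Cmod q < 1 -> Cmod x < / Cmod q ->
  (x * ps (dps (lambert_coef q)) x = ps (lambert_deriv q) x)%C.
Proof.
  intros Hq Hx. rewrite (ps_S _ (lambert_deriv q) x (conv_lambert_deriv q Hq) Hx).
  replace (lambert_deriv q 0) with (RtoC 0) by (unfold lambert_deriv, lambert_coef; ring). change (fun n => lambert_deriv q (S n)) with (dps (lambert_coef q)). ring.
Qed.

Lemma cder_wzeta q u : 0 < Cmod q < 1 -> annulus q (nome u) -> nome u <> RtoC 1 ->
  cder (fun v => wzeta q (nome v)) u (two_pi_i * wp q (nome u))%C.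
Proof.
  intros Hq Ha H1. destruct (annulus_inv q _ (proj1 Hq) Ha) as [Hi H0].
  pose proof (one_minus_neq_0 _ H1) as H2. pose proof C2_neq_0.
  pose proof (cder_nome u) as Dn.
  assert (Dm : cder (fun v => nome (- v)%C) u (- (1) * (two_pi_i * nome (- u)))%C).
  { apply (cder_comp nome (fun v => - v)%C); [apply cder_nome|]. apply cder_opp, cder_id. }
  eapply cder_eq; [|unfold wzeta; apply cder_minus; [apply cder_plus|]].
  2:{ apply cder_div; [now apply Cmult_neq_0| |].
      - apply cder_plus; [apply cder_const|exact Dn].
      - apply cder_scal. apply cder_minus; [apply cder_const|exact Dn]. }
  2:{ apply (cder_comp (ps (lambert_coef q)) nome); [|exact Dn].
      apply (cder_ps (/ Cmod q)); [now apply conv_lambert_coef|apply Ha]. }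
  2:{ apply (cder_ext (fun v => ps (lambert_coef q) (nome (- v)%C))); [intros; now rewrite nome_opp|].
      apply (cder_comp (ps (lambert_coef q)) (fun v => nome (- v)%C)); [|exact Dm].
      apply (cder_ps (/ Cmod q)); [now apply conv_lambert_coef|rewrite nome_opp; apply Hi]. }
  unfold wp. rewrite <- !ps_lambert_deriv_dps by (auto; first [apply Ha|apply Hi]). rewrite nome_opp.
  unfold dpole. field. auto.
Qed.

(** For q = x^2 one has q^m/(1 - q^m) (x^m - x^(-m)) = - x^m, so the two Lambert series
    differ by a geometric series. *)
Lemma wzeta_half_period q x : (x * x = q)%C -> 0 < Cmod q < 1 -> wzeta q x = RtoC (1 / 2).
Proof.
  intros E Hq.
  assert (Mx : Cmod x * Cmod x = Cmod q) by (rewrite <- Cmod_mult, E; auto).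
  pose proof (Cmod_ge_0 x). assert (Hx : 0 < Cmod x < 1) by nra.
  assert (x0 : x <> RtoC 0) by (apply Cmod_gt_0; lra).
  assert (Iq : / Cmod q = / Cmod x * / Cmod x) by (rewrite <- Mx; apply Rinv_mult).
  assert (Ix : 1 < / Cmod x) by (rewrite <- Rinv_1; apply Rinv_lt_contravar; lra).
  assert (S1 : csummable (fun n => lambert_coef q n * x ^ n)%C)
    by (apply (conv_csummable _ _ _ (conv_lambert_coef q Hq)); rewrite Iq; nra).
  assert (S2 : csummable (fun n => lambert_coef q n * (/ x) ^ n)%C)
    by (apply (conv_csummable _ _ _ (conv_lambert_coef q Hq)); rewrite Iq, Cmod_inv by auto; nra).
  assert (S3 : csummable (fun n => RtoC 1 * x ^ n)%C)
    by (apply (conv_csummable _ _ _ conv_1); lra).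
  pose proof (ps_geom x ltac:(lra)) as G.
  assert (X : (ps (lambert_coef q) x - ps (lambert_coef q) (/ x) + ps (fun _ => RtoC 1) x = RtoC 1)%C).
  { unfold ps. rewrite <- CSum_minus by auto.
    rewrite <- CSum_plus by auto using csummable_minus.
    rewrite CSum_S by (apply csummable_plus; auto using csummable_minus).
    rewrite (CSum_ext _ (fun _ => RtoC 0)).
    - rewrite CSum_0. unfold lambert_coef. simpl. ring.
    - intros n. assert (Hl : (RtoC 1 - q ^ S n)%C <> RtoC 0) by (apply lambert_den_neq_0; lra). unfold lambert_coef.
      revert Hl. rewrite <- E, Cpow_mult_l, Cpow_inv by auto.
      pose proof (Cpow_nz x (S n) x0). set (Y := (x ^ S n)%C) in *. intros. field. auto. }
  rewrite G in X.
  pose proof (one_minus_neq_0 x (Cmod_lt_1_neq_1 x ltac:(lra))) as N.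
  unfold wzeta.
  replace ((RtoC 1 + x) / (RtoC 2 * (RtoC 1 - x)) + ps (lambert_coef q) x - ps (lambert_coef q) (/ x))%C
    with ((RtoC 1 + x) / (RtoC 2 * (RtoC 1 - x)) + (ps (lambert_coef q) x - ps (lambert_coef q) (/ x) + / (RtoC 1 - x)) - / (RtoC 1 - x))%C
    by ring.
  rewrite X. rewrite RtoC_div by lra. field. exact N.
Qed.

Lemma wzeta_inv q x : x <> RtoC 0 -> x <> RtoC 1 -> wzeta q (/ x)%C = (- wzeta q x)%C.
Proof.
  intros H0 H1. pose proof (one_minus_neq_0 x H1) as N. pose proof C2_neq_0. unfold wzeta.
  replace (/ / x)%C with x by (field; auto).
  replace ((RtoC 1 + / x) / (RtoC 2 * (RtoC 1 - / x)))%C with (- ((RtoC 1 + x) / (RtoC 2 * (RtoC 1 - x))))%C.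
  - ring.
  - field. repeat split; auto.
    intros E. apply N. replace (RtoC 1 - x)%C with (- (x - RtoC 1))%C by ring. rewrite E. ring.
Qed.

(** The coefficients of (e^w - 1)/w. *)
Definition exp_quotient (n : nat) : C := exp_coef (S n).
Definition exp_defect (n : nat) : C := (exp_coef n - pmul exp_quotient exp_quotient n)%C.

(** Writing e^w = 1 + w A(w), the difference of x/(1 - x)^2 at x = e^w and 1/w^2 is
    (e^w - A^2)/(w A)^2, and the numerator is divisible by w^2 with quotient -1/12 at 0. *)
Lemma dpole_expansion : exists g l, cder g (RtoC 0) l /\ g (RtoC 0) = RtoC (- / 12) /\
  exists d, 0 < d /\ forall w, w <> RtoC 0 -> Cmod w < d ->
    dpole (Cexp w) = (/ (w * w) + g w)%C.
Proof.
  assert (CA : forall R, conv R exp_quotient) by (intros R; apply (conv_S R exp_coef), conv_exp_coef).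
  assert (CN : forall R, conv R exp_defect).
  { intros R. apply (conv_ext R _ (fun n => exp_coef n + (- (1)) * pmul exp_quotient exp_quotient n)%C); [intros; unfold exp_defect; ring|].
    apply conv_plus; [apply conv_exp_coef|]. apply conv_scal, conv_pmul; apply CA. }
  assert (V0 : exp_coef 0 = RtoC 1) by (unfold exp_coef; f_equal; simpl; field).
  assert (V1 : exp_coef 1 = RtoC 1) by (unfold exp_coef; f_equal; simpl; field).
  assert (V2 : exp_coef 2 = RtoC (/ 2)) by (unfold exp_coef; f_equal; simpl; field).
  assert (V3 : exp_coef 3 = RtoC (/ 6)) by (unfold exp_coef; f_equal; simpl; field).
  assert (z0 : Cmod (RtoC 0) < 1) by (rewrite Cmod_0; lra).
  assert (A0 : ps exp_quotient (RtoC 0) = RtoC 1).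
  { rewrite (ps_S 1) by auto. unfold exp_quotient at 1. rewrite V1. ring. }
  set (N2 := fun n => exp_defect (S (S n))).
  assert (CN2 : forall R, conv R N2) by (intros R; apply (conv_S R (fun n => exp_defect (S n))), (conv_S R exp_defect), CN).
  assert (N20 : ps N2 (RtoC 0) = RtoC (- / 12)).
  { rewrite (ps_S 1) by auto. unfold N2 at 1, exp_defect, pmul, conv_prod, exp_quotient. cbn [csum Nat.sub].
    rewrite V1, V2, V3. rewrite Cmult_0_l, Cplus_0_r, Cplus_0_l.
    rewrite <- !RtoC_mult, <- !RtoC_plus, <- RtoC_minus. f_equal. field. }
  assert (EN : forall w, (Cexp w - ps exp_quotient w * ps exp_quotient w = w * w * ps N2 w)%C).
  { intros w. assert (Hw : Cmod w < Cmod w + 1) by lra. set (R := Cmod w + 1) in *.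
    rewrite Cexp_ps, <- (ps_pmul R) by auto.
    replace (ps exp_coef w - ps (pmul exp_quotient exp_quotient) w)%C with (ps exp_coef w + (- (1)) * ps (pmul exp_quotient exp_quotient) w)%C by ring.
    rewrite <- (ps_scal R) by (auto using conv_pmul).
    rewrite <- (ps_plus R) by (auto using conv_exp_coef, conv_scal, conv_pmul).
    rewrite (ps_ext _ exp_defect) by (intros; unfold exp_defect; ring).
    rewrite (ps_S R) by auto. rewrite (ps_S R _ w (conv_S R exp_defect (CN R)) Hw).
    assert (E0 : exp_defect 0 = RtoC 0).
    { unfold exp_defect, pmul, conv_prod, exp_quotient. cbn [csum Nat.sub]. rewrite V0, V1. ring. }
    assert (E1 : exp_defect 1 = RtoC 0).
    { unfold exp_defect, pmul, conv_prod, exp_quotient. cbn [csum Nat.sub]. rewrite V1, V2.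
      rewrite <- !RtoC_mult, <- !RtoC_plus, <- RtoC_minus. f_equal. field. }
    rewrite E0, E1. fold N2. ring. }
  destruct (cder_cont _ _ _ (cder_ps 1 exp_quotient (RtoC 0) (CA 1) z0) 1 Rlt_0_1) as [d [d0 Hd]].
  assert (NZ : forall w, Cmod w < d -> ps exp_quotient w <> RtoC 0).
  { intros w Hw E. specialize (Hd w). rewrite A0, E in Hd.
    replace (w - RtoC 0)%C with w in Hd by ring. specialize (Hd Hw).
    replace (RtoC 0 - RtoC 1)%C with (- (1))%C in Hd by ring. rewrite Cmod_m1 in Hd. lra. }
  eexists (fun w => ps N2 w / (ps exp_quotient w * ps exp_quotient w))%C. eexists. split; [|split].
  - apply cder_div.
    + rewrite A0. replace (RtoC 1 * RtoC 1)%C with (RtoC 1) by ring. apply RtoC_neq_0; lra.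
    + apply (cder_ps 1); auto.
    + apply cder_mult; apply (cder_ps 1); auto.
  - rewrite A0, N20. field.
  - exists d. split; auto. intros w w0 Hw. specialize (NZ w Hw). specialize (EN w).
    assert (E1 : Cexp w = (RtoC 1 + w * ps exp_quotient w)%C).
    { rewrite Cexp_ps, (ps_S (Cmod w + 1)) by (try apply conv_exp_coef; lra). rewrite V0. reflexivity. }
    unfold dpole. replace (RtoC 1 - Cexp w)%C with (- (w * ps exp_quotient w))%C by (rewrite E1; ring).
    replace (Cexp w) with (ps exp_quotient w * ps exp_quotient w + w * w * ps N2 w)%C by (rewrite <- EN; ring).
    field. auto.
Qed.

(** The constant term of [wp] at its pole u = 0, which is - E2/12. *)
Definition G2 (z : C) : C := (RtoC (- / 12) + RtoC 2 * ps (lambert_deriv (nome z)) (RtoC 1))%C.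

Lemma wp_pole z : 0 < Im z -> exists g l, cder g (RtoC 0) l /\ g (RtoC 0) = G2 z /\
  exists d, 0 < d /\ forall u, u <> RtoC 0 -> Cmod u < d ->
    wp (nome z) (nome u) = (/ (two_pi_i * u * (two_pi_i * u)) + g u)%C.
Proof.
  intros Hz. pose proof (Cmod_nome_lt_1 z Hz) as Hq. set (q := nome z) in *.
  destruct dpole_expansion as (g & l & Dg & g0 & d & d0 & Hd).
  assert (Iq : 1 < / Cmod q) by (rewrite <- Rinv_1; apply Rinv_lt_contravar; lra).
  exists (fun u => g (two_pi_i * u) + ps (lambert_deriv q) (nome u) + ps (lambert_deriv q) (nome (- u)))%C.
  eexists. split; [|split].
  - apply cder_plus; [apply cder_plus|].
    + apply (cder_comp g (fun u => two_pi_i * u)%C).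
      * rewrite Cmult_0_r. exact Dg.
      * apply cder_scal, cder_id.
    + apply (cder_comp (ps (lambert_deriv q)) nome); [|apply cder_nome].
      apply (cder_ps (/ Cmod q)); [now apply conv_lambert_deriv|]. rewrite nome_0, Cmod_1. lra.
    + apply (cder_comp (ps (lambert_deriv q)) (fun v => nome (- v)%C)).
      * apply (cder_ps (/ Cmod q)); [now apply conv_lambert_deriv|].
        rewrite nome_opp, nome_0, Cmod_inv, Cmod_1 by (apply RtoC_neq_0; lra). lra.
      * apply (cder_comp nome (fun v => - v)%C); [apply cder_nome|]. apply cder_opp, cder_id.
  - rewrite Cmult_0_r, g0, nome_opp, nome_0. unfold G2. fold q.
    replace (/ RtoC 1)%C with (RtoC 1) by (field; apply RtoC_neq_0; lra). ring.
  - exists (d / (Cmod two_pi_i + 1)). pose proof (Cmod_ge_0 two_pi_i). split; [apply Rdiv_lt_0_compat; lra|].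
    intros u u0 Hu.
    assert (Hu' : Cmod (two_pi_i * u) < d).
    { rewrite Cmod_mult. apply Rmult_lt_compat_r with (r := Cmod two_pi_i + 1) in Hu; [|lra].
      unfold Rdiv in Hu. rewrite Rmult_assoc, Rinv_l in Hu by lra. pose proof (Cmod_ge_0 u). nra. }
    unfold wp. rewrite nome_opp. rewrite (nome_two_pi_i u) at 1.
    rewrite (Hd _ (Cmult_neq_0 _ _ two_pi_i_neq_0 u0) Hu'). ring.
Qed.

(** * The transformation law of E2 *)

Definition inv_pt (z : C) : C := (- / z)%C.

Lemma Im_inv_pt z : 0 < Im z -> z <> RtoC 0 /\ Im (inv_pt z) = Im z / (Cmod z * Cmod z) /\ 0 < Im (inv_pt z).
Proof.
  intros H. assert (z0 : z <> RtoC 0) by (intros E; rewrite E in H; simpl in H; lra).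
  assert (0 < Cmod z) by now apply Cmod_gt_0.
  assert (E : Im (inv_pt z) = Im z / (Cmod z * Cmod z)).
  { unfold inv_pt. replace (Cmod z * Cmod z) with (Re z ^ 2 + Im z ^ 2) by (rewrite <- Cmod2_alt; ring).
    rewrite Im_opp. unfold Cinv. simpl. unfold Im, Re. field. destruct z; simpl in *. nra. }
  repeat split; auto. rewrite E. apply Rdiv_lt_0_compat; nra.
Qed.

(** The point with coordinates (a, b) in the basis (1, z). *)
Definition lattice_pt (z : C) (a b : R) : C := (RtoC a + RtoC b * z)%C.

Lemma Im_lattice_pt z a b : Im (lattice_pt z a b) = b * Im z.
Proof. unfold lattice_pt. rewrite Im_plus, Im_scal_l, Im_RtoC. ring. Qed.

Lemma lattice_pt_neq_0 z a b : 0 < Im z -> nonzero2 a b -> lattice_pt z a b <> RtoC 0.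
Proof.
  intros Hz Hn E. assert (I : Im (lattice_pt z a b) = 0) by (rewrite E; reflexivity).
  rewrite Im_lattice_pt in I. assert (b = 0) by (apply Rmult_eq_reg_r with (Im z); lra). subst b.
  assert (Q : Re (lattice_pt z a 0) = 0) by (rewrite E; reflexivity).
  unfold lattice_pt in Q. rewrite re_plus, re_scal_l, re_RtoC in Q. destruct Hn; lra.
Qed.

Lemma nome_lattice_pt_neq_1 z a b : 0 < Im z -> in_box a b -> nonzero2 a b -> nome (lattice_pt z a b) <> RtoC 1.
Proof.
  intros Hz [Ha Hb] Hn E. pose proof PI_RGT_0.
  assert (M : Cmod (nome (lattice_pt z a b)) = 1) by (rewrite E; apply Cmod_1).
  rewrite Cmod_nome, Im_lattice_pt in M. rewrite <- exp_0 in M. apply exp_inv in M.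
  assert (b = 0).
  { assert (0 < 2 * PI * Im z) by (apply Rmult_lt_0_compat; lra).
    apply Rmult_eq_reg_r with (2 * PI * Im z); lra. }
  subst b.
  apply (lattice_pt_neq_0 z a 0 Hz Hn). rewrite nome_two_pi_i in E.
  assert (Ep : lattice_pt z a 0 = RtoC a) by (unfold lattice_pt; ring). rewrite Ep in *.
  apply Cexp_eq_1 in E.
  - exact (Cmult_zero_r _ _ two_pi_i_neq_0 E).
  - unfold two_pi_i. rewrite <- Cmult_assoc, Im_scal_l, im_mult, re_RtoC, Im_RtoC. simpl.
    apply Rabs_le_between in Ha. nra.
Qed.

Lemma annulus_lattice_pt z a b : 0 < Im z -> Rabs b <= 1 / 2 -> annulus (nome z) (nome (lattice_pt z a b)).
Proof.
  intros Hz Hb. apply Rabs_le_between in Hb. pose proof PI_RGT_0. unfold annulus.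
  rewrite !Cmod_nome, Im_lattice_pt, <- exp_Ropp.
  assert (0 < 2 * PI * Im z) by (apply Rmult_lt_0_compat; lra).
  set (K := 2 * PI * Im z) in *.
  replace (2 * PI * (b * Im z)) with (b * K) by (unfold K; ring).
  split; apply exp_increasing; nra.
Qed.

Definition wpab (z : C) (a b : R) : C := wp (nome z) (nome (lattice_pt z a b)).

Lemma nome_lattice_pt_shift_a z a b s : s = 1 \/ s = -1 ->
  nome (lattice_pt z ((a + s) / 2) b) = (- nome (lattice_pt z (a / 2) b))%C.
Proof.
  intros Hs. replace (lattice_pt z ((a + s) / 2) b) with (lattice_pt z (a / 2) b + RtoC (s / 2))%C.
  - rewrite nome_plus. assert (E : nome (RtoC (s / 2)) = (- (1))%C).
    { destruct Hs as [->| ->]; [apply nome_half|].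
      replace (RtoC (-1 / 2)) with (- RtoC (1 / 2))%C by (rewrite <- RtoC_opp; f_equal; field).
      rewrite nome_opp, nome_half. field. }
    rewrite E. ring.
  - unfold lattice_pt. replace ((a + s) / 2) with (a / 2 + s / 2) by field. rewrite RtoC_plus. ring.
Qed.

Lemma nome_lattice_pt_shift_b z a b s :
  nome (lattice_pt z a ((b + s) / 2)) = (nome (lattice_pt z a (b / 2)) * nome (RtoC (s / 2) * z))%C.
Proof.
  rewrite <- nome_plus. f_equal. unfold lattice_pt.
  replace ((b + s) / 2) with (b / 2 + s / 2) by field. rewrite RtoC_plus. ring.
Qed.

(** The signs of the shifts are chosen so that the four halves stay in the box
    |a|, |b| <= 1/2, which contains the single lattice point 0. *)
Lemma wpab_distribution z a b s1 s2 : 0 < Im z -> in_box a b -> nonzero2 a b ->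
  s1 = 1 \/ s1 = -1 -> (s2 = 1 /\ b <= 0) \/ (s2 = -1 /\ 0 <= b) ->
  (wpab z (a / 2)%R (b / 2)%R + wpab z ((a + s1) / 2)%R (b / 2)%R
   + wpab z (a / 2)%R ((b + s2) / 2)%R + wpab z ((a + s1) / 2)%R ((b + s2) / 2)%R
   = RtoC 4 * wpab z a b)%C.
Proof.
  intros Hz Hb Hn H1 H2. pose proof (Cmod_nome_lt_1 z Hz) as Hq. unfold wpab.
  rewrite !nome_lattice_pt_shift_a by assumption. rewrite !nome_lattice_pt_shift_b.
  set (s := nome (RtoC (1 / 2) * z)%C).
  set (y := nome (lattice_pt z (a / 2) (b / 2))).
  assert (Es : (s * s)%C = nome z).
  { unfold s. rewrite <- nome_plus. f_equal. rewrite <- Cmult_plus_distr_r, <- RtoC_plus.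
    replace (1 / 2 + 1 / 2) with 1 by field. ring. }
  assert (Ey : (y * y)%C = nome (lattice_pt z a b)).
  { unfold y. rewrite <- nome_plus. f_equal. unfold lattice_pt.
    replace (RtoC a) with (RtoC (a / 2) + RtoC (a / 2))%C by (rewrite <- RtoC_plus; f_equal; field).
    replace (RtoC b) with (RtoC (b / 2) + RtoC (b / 2))%C by (rewrite <- RtoC_plus; f_equal; field). ring. }
  pose proof (nome_lattice_pt_neq_1 z a b Hz Hb Hn) as N1. rewrite <- Ey in *.
  pose proof PI_RGT_0. assert (0 < 2 * PI * Im z) by (apply Rmult_lt_0_compat; lra).
  destruct Hb as [Ha Hb]. apply Rabs_le_between in Hb.
  assert (My : Cmod (y * y)%C = exp (- (b * (2 * PI * Im z)))).
  { rewrite Ey, Cmod_nome, Im_lattice_pt. f_equal. ring. }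
  assert (Ms : Cmod s = exp (- (1 / 2 * (2 * PI * Im z)))).
  { unfold s. rewrite Cmod_nome, Im_scal_l. f_equal. ring. }
  set (K := 2 * PI * Im z) in *.
  assert (emono : forall u v, u <= v -> exp u <= exp v).
  { intros u v [L| ->]; [left; now apply exp_increasing|right; auto]. }
  destruct H2 as [[-> Hb2]|[-> Hb2]].
  - fold s. rewrite <- (wp_distribution_outer (nome z) s y Hq Es); auto.
    + rewrite My, <- exp_0. apply emono. nra.
    + rewrite My, Ms, <- exp_Ropp. apply emono. nra.
  - replace (RtoC (-1 / 2) * z)%C with (- (RtoC (1 / 2) * z))%C.
    2:{ replace (-1 / 2) with (- (1 / 2)) by field. rewrite RtoC_opp. ring. }
    rewrite nome_opp. fold s.
    rewrite <- (wp_distribution (nome z) s y Hq Es); auto.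
    + rewrite My, Ms. apply emono. nra.
    + rewrite My, <- exp_0. apply emono. nra.
Qed.

(** Division by z turns the basis (1, z) into (-1/z, 1) up to signs. *)
Lemma lattice_pt_inv z a b : z <> RtoC 0 -> lattice_pt (inv_pt z) b (- a) = (lattice_pt z a b / z)%C.
Proof. intros H. unfold lattice_pt, inv_pt. rewrite RtoC_opp. field. auto. Qed.

(** The lattice functions of (1, z) and of (1, -1/z) have the same double pole after
    rescaling, so their difference is bounded near 0. *)
Definition wdiff (z u : C) : C :=
  (wp (nome z) (nome u) - / (z * z) * wp (nome (inv_pt z)) (nome (u / z)))%C.

Lemma wdiff_pt z a b : z <> RtoC 0 ->
  wdiff z (lattice_pt z a b) = (wpab z a b - / (z * z) * wpab (inv_pt z) b (- a)%R)%C.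
Proof. intros H. unfold wdiff, wpab. now rewrite lattice_pt_inv. Qed.

Lemma in_box_swap a b : in_box a b -> in_box b (- a).
Proof. intros [H1 H2]. split; auto. now rewrite Rabs_Ropp. Qed.

Lemma nonzero2_swap a b : nonzero2 a b -> nonzero2 b (- a).
Proof. intros [H|H]; [right|left]; lra. Qed.

Lemma wdiff_distribution z a b : 0 < Im z -> in_box a b -> nonzero2 a b ->
  exists a1 b1, in_box a1 b1 /\ a1 <> 0 /\ b1 <> 0 /\
  (RtoC 4 * wdiff z (lattice_pt z a b) = wdiff z (lattice_pt z (a / 2) (b / 2)) + wdiff z (lattice_pt z a1 (b / 2))
    + wdiff z (lattice_pt z (a / 2) b1) + wdiff z (lattice_pt z a1 b1))%C.
Proof.
  intros Hz Hb Hn. destruct (Im_inv_pt z Hz) as (z0 & _ & Ht).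
  assert (S : forall c, Rabs c <= 1 / 2 -> exists s, (s = 1 \/ s = -1) /\
     ((s = 1 /\ c <= 0) \/ (s = -1 /\ 0 <= c)) /\ Rabs ((c + s) / 2) <= 1 / 2 /\ (c + s) / 2 <> 0).
  { intros c Hc. apply Rabs_le_between in Hc. destruct (Rle_dec c 0) as [L|L].
    - exists 1. repeat split; auto; [apply Rabs_le_between; lra|lra].
    - exists (-1). repeat split; auto; [right; lra|apply Rabs_le_between; lra|lra]. }
  destruct (S a (proj1 Hb)) as (s1 & X1 & Y1 & B1 & N1).
  destruct (S b (proj2 Hb)) as (s2 & X2 & Y2 & B2 & N2).
  exists ((a + s1) / 2), ((b + s2) / 2). repeat split; auto.
  rewrite !wdiff_pt by assumption.
  pose proof (wpab_distribution z a b s1 s2 Hz Hb Hn X1 Y2) as D1.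
  assert (X1' : (- s1 = 1 /\ - a <= 0) \/ (- s1 = -1 /\ 0 <= - a)) by lra.
  pose proof (wpab_distribution (inv_pt z) b (- a) s2 (- s1) Ht (in_box_swap _ _ Hb) (nonzero2_swap _ _ Hn) X2 X1') as D2.
  replace (- a / 2) with (- (a / 2)) in D2 by field.
  replace ((- a + - s1) / 2) with (- ((a + s1) / 2)) in D2 by field.
  replace (RtoC 4 * (wpab z a b - / (z * z) * wpab (inv_pt z) b (- a)%R))%C
    with (RtoC 4 * wpab z a b - / (z * z) * (RtoC 4 * wpab (inv_pt z) b (- a)%R))%C by ring.
  rewrite <- D1, <- D2. ring.
Qed.

Lemma cder_wdiff z a b : 0 < Im z -> in_box a b -> nonzero2 a b ->
  exists l, cder (wdiff z) (lattice_pt z a b) l.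
Proof.
  intros Hz Hb Hn. destruct (Im_inv_pt z Hz) as (z0 & _ & Ht).
  destruct (cder_wp (nome z) (lattice_pt z a b)) as [l1 D1].
  - now apply Cmod_nome_lt_1.
  - apply annulus_lattice_pt; auto. apply Hb.
  - now apply nome_lattice_pt_neq_1.
  - destruct (cder_wp (nome (inv_pt z)) (lattice_pt z a b / z)%C) as [l2 D2].
    + now apply Cmod_nome_lt_1.
    + rewrite <- lattice_pt_inv by auto. apply annulus_lattice_pt; auto. apply (in_box_swap _ _ Hb).
    + rewrite <- lattice_pt_inv by auto. apply nome_lattice_pt_neq_1; auto using in_box_swap, nonzero2_swap.
    + eexists. unfold wdiff. apply cder_minus; [exact D1|]. apply cder_scal.
      apply (cder_comp (fun v => wp (nome (inv_pt z)) (nome v)) (fun u => u / z)%C); [exact D2|].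
      apply cder_mult; [apply cder_id|apply cder_const].
Qed.

Lemma wdiff_limit z : 0 < Im z -> forall eps, 0 < eps -> exists d, 0 < d /\
  forall u, u <> RtoC 0 -> Cmod u < d ->
    Cmod (wdiff z u - (G2 z - / (z * z) * G2 (inv_pt z)))%C < eps.
Proof.
  intros Hz eps He. destruct (Im_inv_pt z Hz) as (z0 & _ & Ht).
  assert (Zm : 0 < Cmod z) by now apply Cmod_gt_0.
  destruct (wp_pole z Hz) as (g & l & Dg & g0 & d1 & d10 & H1).
  destruct (wp_pole (inv_pt z) Ht) as (h & m & Dh & h0 & d2 & d20 & H2).
  assert (DD : exists k, cder (fun u => g u - / (z * z) * h (u / z))%C (RtoC 0) k).
  { eexists. apply cder_minus; [exact Dg|]. apply cder_scal.
    apply (cder_comp h (fun u => u / z)%C).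
    - replace (RtoC 0 / z)%C with (RtoC 0) by (field; auto). exact Dh.
    - apply cder_mult; [apply cder_id|apply cder_const]. }
  destruct DD as [k DD]. destruct (cder_cont _ _ _ DD eps He) as [d3 [d30 H3]].
  exists (Rmin d1 (Rmin (d2 * Cmod z) d3)).
  split; [repeat apply Rmin_pos; nra|].
  intros u u0 Hu.
  assert (B1 : Cmod u < d1) by (eapply Rlt_le_trans; [exact Hu|apply Rmin_l]).
  assert (B2 : Cmod u < d2 * Cmod z)
    by (eapply Rlt_le_trans; [exact Hu|eapply Rle_trans; [apply Rmin_r|apply Rmin_l]]).
  assert (B3 : Cmod u < d3)
    by (eapply Rlt_le_trans; [exact Hu|eapply Rle_trans; [apply Rmin_r|apply Rmin_r]]).
  unfold wdiff. rewrite (H1 u u0 B1).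
  assert (uz : (u / z)%C <> RtoC 0).
  { intros E. apply u0. replace u with (u / z * z)%C by (field; auto). rewrite E. ring. }
  assert (Buz : Cmod (u / z) < d2).
  { rewrite Cmod_div by auto. apply Rmult_lt_reg_r with (Cmod z); auto.
    unfold Rdiv. rewrite Rmult_assoc, Rinv_l by lra. lra. }
  rewrite (H2 _ uz Buz).
  specialize (H3 u). replace (u - RtoC 0)%C with u in H3 by ring. specialize (H3 B3).
  replace (RtoC 0 / z)%C with (RtoC 0) in H3 by (field; auto). rewrite g0, h0 in H3.
  pose proof two_pi_i_neq_0.
  match type of H3 with Cmod ?x < _ => match goal with |- Cmod ?y < _ => replace y with x; [exact H3|] end end.
  field. auto.
Qed.

Lemma nonzero2_dec a b : nonzero2 a b \/ (a = 0 /\ b = 0).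
Proof.
  unfold nonzero2. destruct (Req_dec a 0); destruct (Req_dec b 0); auto.
Qed.

Lemma wdiff_const z : 0 < Im z -> forall a b, in_box a b -> nonzero2 a b ->
  wdiff z (lattice_pt z a b) = (G2 z - / (z * z) * G2 (inv_pt z))%C.
Proof.
  intros Hz. set (c := (G2 z - / (z * z) * G2 (inv_pt z))%C).
  assert (Hpt : forall a b a0 b0 d, Rabs (a - a0) < d -> Rabs (b - b0) < d ->
     Cmod (lattice_pt z a b - lattice_pt z a0 b0)%C <= d * (1 + Cmod z)).
  { intros a b a0 b0 d Ha Hb.
    replace (lattice_pt z a b - lattice_pt z a0 b0)%C with (RtoC (a - a0) + RtoC (b - b0) * z)%C
      by (unfold lattice_pt; rewrite !RtoC_minus; ring).
    eapply Rle_trans; [apply Cmod_triangle|]. rewrite Cmod_mult, !Cmod_R.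
    pose proof (Cmod_ge_0 z). nra. }
  assert (Zp : 0 < 1 + Cmod z) by (pose proof (Cmod_ge_0 z); lra).
  assert (p00 : lattice_pt z 0 0 = RtoC 0) by (unfold lattice_pt; ring).
  assert (Lim : forall eps, 0 < eps -> exists d, 0 < d /\ forall a b, Rabs a < d -> Rabs b < d -> nonzero2 a b ->
     Cmod (wdiff z (lattice_pt z a b) - c)%C < eps).
  { intros eps He. destruct (wdiff_limit z Hz eps He) as [d [d0 Hd]].
    exists (d / 2 / (1 + Cmod z)). split; [repeat apply Rdiv_lt_0_compat; lra|].
    intros a b Ha Hb Hn. apply Hd; [now apply lattice_pt_neq_0|].
    rewrite <- (Rminus_0_r a) in Ha. rewrite <- (Rminus_0_r b) in Hb.
    pose proof (Hpt _ _ _ _ _ Ha Hb) as Q. rewrite p00 in Q.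
    replace (lattice_pt z a b - RtoC 0)%C with (lattice_pt z a b) in Q by ring.
    replace (d / 2 / (1 + Cmod z) * (1 + Cmod z)) with (d / 2) in Q by (field; lra). lra. }
  assert (H : forall a b, in_box a b -> nonzero2 a b -> (wdiff z (lattice_pt z a b) - c)%C = RtoC 0).
  { apply (herglotz (fun a b => wdiff z (lattice_pt z a b) - c)%C); auto.
    - apply bounded_on_box. intros a0 b0.
      destruct (nonzero2_dec a0 b0) as [Hn|[-> ->]].
      + destruct (Rle_dec (Rabs a0) (1 / 2)) as [A1|A1]; [destruct (Rle_dec (Rabs b0) (1 / 2)) as [A2|A2]|].
        * destruct (cder_wdiff z a0 b0 Hz (conj A1 A2) Hn) as [l Dl].
          destruct (cder_cont _ _ _ Dl 1 Rlt_0_1) as [d [d0 Hd]].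
          exists (d / 2 / (1 + Cmod z)), (1 + Cmod (wdiff z (lattice_pt z a0 b0) - c)%C).
          split; [repeat apply Rdiv_lt_0_compat; lra|].
          intros a b _ _ _ Ha Hb. pose proof (Hpt _ _ _ _ _ Ha Hb) as Q.
          replace (d / 2 / (1 + Cmod z) * (1 + Cmod z)) with (d / 2) in Q by (field; lra).
          specialize (Hd (lattice_pt z a b) ltac:(lra)).
          replace (wdiff z (lattice_pt z a b) - c)%C
            with ((wdiff z (lattice_pt z a b) - wdiff z (lattice_pt z a0 b0)) + (wdiff z (lattice_pt z a0 b0) - c))%C by ring.
          eapply Rle_trans; [apply Cmod_triangle|]. lra.
        * exists 1, 0. split; [lra|]. intros a b _ _ [_ B2]. contradiction.
        * exists 1, 0. split; [lra|]. intros a b _ _ [B1 _]. contradiction.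
      + destruct (Lim 1 Rlt_0_1) as [d [d0 Hd]]. exists d, 1. split; auto.
        intros a b _ Hn _ Ha Hb. rewrite Rminus_0_r in Ha, Hb. left. now apply Hd.
    - intros a b Hb Hn. destruct (wdiff_distribution z a b Hz Hb Hn) as (a1 & b1 & K1 & K2 & K3 & K4).
      exists a1, b1. repeat split; auto; try apply K1.
      replace (RtoC 4 * (wdiff z (lattice_pt z a b) - c))%C with (RtoC 4 * wdiff z (lattice_pt z a b) - RtoC 4 * c)%C by ring.
      rewrite K4. ring. }
  intros a b Hb Hn. specialize (H a b Hb Hn).
  replace (wdiff z (lattice_pt z a b)) with ((wdiff z (lattice_pt z a b) - c) + c)%C by ring. rewrite H. ring.
Qed.

(** The constant value c of [wdiff] is found by integrating along the segment from
    1/2 + z/2 to -1/2 + z/2.  The primitive belonging to z is periodic under u -> u + 1;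
    the one belonging to -1/z jumps from -1/2 to 1/2, its values at opposite half periods. *)
Lemma G2_inv z : 0 < Im z -> (G2 z - / (z * z) * G2 (inv_pt z) = / (two_pi_i * z))%C.
Proof.
  intros Hz. destruct (Im_inv_pt z Hz) as (z0 & _ & Ht).
  pose proof (wdiff_const z Hz) as HC. set (c := (G2 z - / (z * z) * G2 (inv_pt z))%C) in *.
  pose proof (Cmod_nome_lt_1 z Hz) as Hq. pose proof (Cmod_nome_lt_1 _ Ht) as Hq'.
  set (L := fun u => (wzeta (nome z) (nome u) - / z * wzeta (nome (inv_pt z)) (nome (u / z)) - two_pi_i * c * u)%C).
  assert (E : L (lattice_pt z (1 / 2) (1 / 2)) = L (lattice_pt z (- (1 / 2)) (1 / 2))).
  { apply cder_zero_segment. intros t Ht1.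
    set (a := 1 / 2 - t).
    assert (Ep : (lattice_pt z (1 / 2) (1 / 2) + RtoC t * (lattice_pt z (- (1 / 2)) (1 / 2) - lattice_pt z (1 / 2) (1 / 2)))%C = lattice_pt z a (1 / 2)).
    { unfold lattice_pt, a. rewrite RtoC_opp, RtoC_minus.
      replace (RtoC 1) with (RtoC (1 / 2) + RtoC (1 / 2))%C at 1 by (rewrite <- RtoC_plus; f_equal; field).
      replace (RtoC t * (- RtoC (1 / 2) + RtoC (1 / 2) * z - (RtoC (1 / 2) + RtoC (1 / 2) * z)))%C
        with (- RtoC t * (RtoC (1 / 2) + RtoC (1 / 2)))%C by ring.
      rewrite <- RtoC_plus. replace (1 / 2 + 1 / 2) with 1 by field. ring. }
    rewrite Ep.
    assert (Hb : in_box a (1 / 2)).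
    { split; apply Rabs_le_between; unfold a; lra. }
    assert (Hn : nonzero2 a (1 / 2)) by (right; lra).
    specialize (HC a (1 / 2) Hb Hn).
    eapply cder_eq; [|unfold L; apply cder_minus; [apply cder_minus|]].
    2:{ apply cder_wzeta; auto.
        - apply annulus_lattice_pt; auto. apply Hb.
        - now apply nome_lattice_pt_neq_1. }
    2:{ apply cder_scal.
        apply (cder_comp (fun v => wzeta (nome (inv_pt z)) (nome v)) (fun u => u / z)%C).
        - apply cder_wzeta; auto; rewrite <- lattice_pt_inv by auto.
          + apply annulus_lattice_pt; auto. apply (in_box_swap _ _ Hb).
          + apply nome_lattice_pt_neq_1; auto using in_box_swap, nonzero2_swap.
        - apply cder_mult; [apply cder_id|apply cder_const]. }
    2:{ apply cder_scal, cder_id. }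
    rewrite <- HC. unfold wdiff. field. auto. }
  unfold L in E. rewrite <- !lattice_pt_inv in E by auto.
  set (s := nome (lattice_pt (inv_pt z) (1 / 2) (1 / 2))).
  assert (N : nome (lattice_pt z (1 / 2) (1 / 2)) = nome (lattice_pt z (- (1 / 2)) (1 / 2))).
  { replace (lattice_pt z (1 / 2) (1 / 2)) with (lattice_pt z (- (1 / 2)) (1 / 2) + RtoC 1)%C.
    - rewrite nome_plus, nome_1. ring.
    - unfold lattice_pt. replace (1 / 2) with (- (1 / 2) + 1) at 3 by field. rewrite RtoC_plus. ring. }
  assert (s1 : s <> RtoC 1).
  { apply nome_lattice_pt_neq_1; auto; [split; apply Rabs_le_between; lra|left; lra]. }
  assert (S1 : nome (lattice_pt (inv_pt z) (1 / 2) (- (1 / 2))) = (/ s)%C).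
  { unfold s. rewrite <- nome_opp.
    replace (lattice_pt (inv_pt z) (1 / 2) (- (1 / 2))) with (- lattice_pt (inv_pt z) (1 / 2) (1 / 2) + RtoC 1)%C.
    - rewrite nome_plus, nome_1. ring.
    - unfold lattice_pt. rewrite RtoC_opp. replace (RtoC 1) with (RtoC (1 / 2) + RtoC (1 / 2))%C; [ring|].
      rewrite <- RtoC_plus. f_equal. field. }
  rewrite S1, Ropp_involutive in E. fold s in E.
  assert (Ss : (s * s)%C = nome (inv_pt z)).
  { unfold s. rewrite <- nome_plus.
    replace (lattice_pt (inv_pt z) (1 / 2) (1 / 2) + lattice_pt (inv_pt z) (1 / 2) (1 / 2))%C with (inv_pt z + RtoC 1)%C.
    - rewrite nome_plus, nome_1. ring.
    - unfold lattice_pt. replace (RtoC 1) with (RtoC (1 / 2) + RtoC (1 / 2))%C by (rewrite <- RtoC_plus; f_equal; field).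
      replace (inv_pt z) with ((RtoC (1 / 2) + RtoC (1 / 2)) * inv_pt z)%C at 1; [ring|].
      rewrite <- RtoC_plus. replace (1 / 2 + 1 / 2) with 1 by field. ring. }
  rewrite (wzeta_inv _ s (nome_neq_0 _) s1) in E. rewrite (wzeta_half_period _ s Ss Hq'), N in E.
  assert (Ed : (lattice_pt z (1 / 2) (1 / 2) = lattice_pt z (- (1 / 2)) (1 / 2) + (RtoC (1 / 2) + RtoC (1 / 2)))%C)
    by (unfold lattice_pt; rewrite RtoC_opp; ring).
  rewrite Ed, <- RtoC_plus in E. replace (1 / 2 + 1 / 2) with 1 in E by field.
  pose proof two_pi_i_neq_0.
  assert (E' : (two_pi_i * c = / z * (RtoC (1 / 2) + RtoC (1 / 2)))%C).
  { set (Z0 := wzeta (nome z) (nome (lattice_pt z (- (1 / 2)) (1 / 2)))) in *. set (w := lattice_pt z (- (1 / 2)) (1 / 2)) in *.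
    replace (/ z * (RtoC (1 / 2) + RtoC (1 / 2)))%C
      with ((Z0 - / z * - RtoC (1 / 2) - two_pi_i * c * (w + RtoC 1)) - (Z0 - / z * RtoC (1 / 2) - two_pi_i * c * w) + two_pi_i * c)%C by ring.
    rewrite E. ring. }
  rewrite <- RtoC_plus in E'. replace (1 / 2 + 1 / 2) with 1 in E' by field.
  replace c with (/ two_pi_i * (two_pi_i * c))%C by (field; auto). rewrite E'. field. auto.
Qed.

(** * Sums of divisors *)

(** The index m stands for the divisor m + 1. *)
Definition dvd_ind (m k : nat) : R := if (k mod S m =? 0)%nat then 1 else 0.

Definition sigma (n : nat) : C := csum n (fun m => RtoC (INR (S m) * dvd_ind m n))%C.

Lemma dvd_ind_bound m k : 0 <= dvd_ind m k <= 1.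
Proof. unfold dvd_ind. destruct (k mod S m =? 0)%nat; lra. Qed.

Lemma Cmod_sigma n : Cmod (sigma n) <= INR n * INR n.
Proof.
  apply Cmod_csum_le. intros k Hk. pose proof (dvd_ind_bound k n). rewrite Cmod_R.
  pose proof (pos_INR (S k)). assert (INR (S k) <= INR n) by (apply le_INR; lia).
  rewrite Rabs_pos_eq by nra. nra.
Qed.

Lemma conv_nn : conv 1 (fun n => RtoC (INR n) * (RtoC (INR n) * RtoC 1))%C.
Proof. apply conv_n, conv_n, conv_1. Qed.

Lemma conv_sigma : conv 1 sigma.
Proof.
  apply (conv_le 1 _ _) with (2 := conv_nn). intros n.
  rewrite !Cmod_mult, !Cmod_R, Rabs_R1, Rmult_1_r, Rabs_pos_eq by apply pos_INR. apply Cmod_sigma.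
Qed.

(** Divisors are at most the number itself. *)
Lemma sigma_extend k N : (k < N)%nat -> sigma (S k) = csum N (fun m => RtoC (INR (S m) * dvd_ind m (S k)))%C.
Proof.
  intros H. unfold sigma. induction N; [lia|].
  destruct (Nat.eq_dec k N) as [->|E]; [reflexivity|].
  rewrite IHN by lia. cbn [csum]. unfold dvd_ind at 3.
  rewrite Nat.mod_small by lia. cbn [Nat.eqb]. rewrite Rmult_0_r. ring.
Qed.

Lemma csum_swap n m (f : nat -> nat -> C) :
  csum n (fun i => csum m (fun j => f i j)) = csum m (fun j => csum n (fun i => f i j)).
Proof.
  induction n; cbn [csum].
  - symmetry. apply csum_0. auto.
  - rewrite IHn. symmetry. apply csum_plus.
Qed.

(** The geometric series of q^(m+1) truncated at exponent N; by induction on N, a new term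
    appears exactly when m + 1 divides the new exponent. *)
Lemma lambert_remainder q m N : Cmod q < 1 ->
  (lambert_coef q (S m) - csum N (fun j => RtoC (dvd_ind m (S j)) * q ^ S j)
   = q ^ (S m * (N / S m + 1)) / (RtoC 1 - q ^ S m))%C.
Proof.
  intros Hq. pose proof (lambert_den_neq_0 q m Hq) as D.
  induction N.
  - cbn [csum]. rewrite Nat.div_small by lia. rewrite Nat.mul_1_r. unfold lambert_coef. ring.
  - cbn [csum].
    replace (lambert_coef q (S m) - (csum N (fun j => RtoC (dvd_ind m (S j)) * q ^ S j) + RtoC (dvd_ind m (S N)) * q ^ S N))%C
      with ((lambert_coef q (S m) - csum N (fun j => RtoC (dvd_ind m (S j)) * q ^ S j)) - RtoC (dvd_ind m (S N)) * q ^ S N)%C by ring.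
    rewrite IHN. unfold dvd_ind.
    set (M := S m) in *. assert (HM : M <> O) by (unfold M; lia).
    pose proof (Nat.div_mod N M HM) as E. pose proof (Nat.mod_upper_bound N M HM) as B.
    set (n := (N / M)%nat) in *. set (r := (N mod M)%nat) in *.
    destruct (Nat.eq_dec (S r) M) as [Er|Er].
    + assert (E1 : (S N = M * (n + 1) + 0)%nat) by lia.
      rewrite <- (Nat.mod_unique _ _ _ _ (proj1 (Nat.neq_0_lt_0 M) HM) E1).
      rewrite <- (Nat.div_unique _ _ _ _ (proj1 (Nat.neq_0_lt_0 M) HM) E1).
      cbn [Nat.eqb]. rewrite E1, Nat.add_0_r.
      replace (M * (n + 1 + 1))%nat with (M * (n + 1) + M)%nat by lia. rewrite Cpow_add_r. field. auto.
    + assert (E1 : (S N = M * n + S r)%nat) by lia. assert (B1 : (S r < M)%nat) by lia.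
      rewrite <- (Nat.mod_unique _ _ _ _ B1 E1).
      rewrite <- (Nat.div_unique _ _ _ _ B1 E1).
      cbn [Nat.eqb]. ring.
Qed.

(** Partial sums up to N of both sides differ by multiples of powers q^e with e > N, of total
    size at most N^2 |q|^N / (1 - |q|). *)
Lemma lambert q : 0 < Cmod q < 1 -> ps (lambert_deriv q) (RtoC 1) = ps sigma q.
Proof.
  intros Hq. assert (Iq : 1 < / Cmod q) by (rewrite <- Rinv_1; apply Rinv_lt_contravar; lra).
  unfold ps. apply CSum_eq_lim with (phi := fun N => N); auto.
  - apply (conv_csummable (/ Cmod q)); [now apply conv_lambert_deriv|]. now rewrite Cmod_1.
  - apply (conv_csummable 1); [apply conv_sigma|lra].
  - intros eps He.
    pose proof (conv_nn (Cmod q) ltac:(lra)) as HS.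
    apply ex_series_lim_0 in HS. apply is_lim_seq_spec in HS.
    assert (He' : 0 < eps * (1 - Cmod q)) by nra.
    destruct (HS (mkposreal _ He')) as [N0 HN]. simpl in HN.
    exists (S N0). intros [|N] HN0; [lia|]. specialize (HN N ltac:(lia)).
    rewrite !csum_S_l.
    replace (lambert_deriv q 0 * RtoC 1 ^ 0)%C with (RtoC 0) by (unfold lambert_deriv, lambert_coef; ring).
    replace (sigma 0 * q ^ 0)%C with (RtoC 0) by (unfold sigma; cbn [csum]; ring).
    assert (E1 : csum N (fun k => sigma (S k) * q ^ S k)%C =
      csum N (fun m => RtoC (INR (S m)) * csum N (fun j => RtoC (dvd_ind m (S j)) * q ^ S j))%C).
    { rewrite (csum_ext N _ (fun k => csum N (fun m => RtoC (INR (S m)) * (RtoC (dvd_ind m (S k)) * q ^ S k)))%C).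
      - rewrite csum_swap. apply csum_ext. intros m _. apply csum_scal.
      - intros k Hk. rewrite (sigma_extend k N Hk), Cmult_comm, <- csum_scal. apply csum_ext.
        intros m _. rewrite RtoC_mult. ring. }
    rewrite E1, !Cplus_0_l.
    assert (E2 : (csum N (fun k => lambert_deriv q (S k) * RtoC 1 ^ S k)
      - csum N (fun m => RtoC (INR (S m)) * csum N (fun j => RtoC (dvd_ind m (S j)) * q ^ S j)))%C
      = csum N (fun m => RtoC (INR (S m)) * (q ^ (S m * (N / S m + 1)) / (RtoC 1 - q ^ S m)))%C).
    { replace (csum N (fun k => lambert_deriv q (S k) * RtoC 1 ^ S k)
      - csum N (fun m => RtoC (INR (S m)) * csum N (fun j => RtoC (dvd_ind m (S j)) * q ^ S j)))%C
      with (csum N (fun k => lambert_deriv q (S k) * RtoC 1 ^ S k)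
      + - (1) * csum N (fun m => RtoC (INR (S m)) * csum N (fun j => RtoC (dvd_ind m (S j)) * q ^ S j)))%C by ring.
      rewrite <- csum_scal, <- csum_plus. apply csum_ext. intros m _.
      rewrite <- lambert_remainder by lra. rewrite Cpow_1_l. unfold lambert_deriv. ring. }
    rewrite E2.
    assert (B : Cmod (csum N (fun m => RtoC (INR (S m)) * (q ^ (S m * (N / S m + 1)) / (RtoC 1 - q ^ S m)))%C)
      <= INR N * (INR N * (Cmod q ^ N / (1 - Cmod q)))).
    { apply Cmod_csum_le. intros m Hm. rewrite Cmod_mult, Cmod_R, Rabs_pos_eq by apply pos_INR.
      apply Rmult_le_compat; [apply pos_INR|apply Cmod_ge_0|apply le_INR; lia|].
      rewrite Cmod_div by (apply lambert_den_neq_0; lra). rewrite Cmod_pow.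
      assert (HM : S m <> O) by lia.
      pose proof (Nat.div_mod N (S m) HM) as E. pose proof (Nat.mod_upper_bound N (S m) HM) as Bd.
      apply Rmult_le_compat.
      - apply pow_le; lra.
      - left. apply Rinv_0_lt_compat, Cmod_gt_0, lambert_den_neq_0; lra.
      - replace (S m * (N / S m + 1))%nat with (N + (S m * (N / S m + 1) - N))%nat by lia.
        rewrite pow_add. rewrite <- (Rmult_1_r (Cmod q ^ N)) at 2.
        apply Rmult_le_compat_l; [apply pow_le; lra|].
        rewrite <- (pow1 (S m * (N / S m + 1) - N)). apply pow_incr; lra.
      - apply Rinv_le_contravar; [lra|].
        pose proof (Cmod_triangle_sub (RtoC 1) (q ^ S m)) as T. rewrite Cmod_1, Cmod_pow in T.
        assert (Cmod q ^ S m <= Cmod q); [|lra].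
        simpl. assert (Cmod q ^ m <= 1); [|nra]. rewrite <- (pow1 m). apply pow_incr; lra. }
    eapply Rle_lt_trans; [exact B|].
    rewrite !Cmod_mult, !Cmod_R, Rabs_R1, Rmult_1_r, (Rabs_pos_eq (INR N)) in HN by apply pos_INR.
    rewrite Rminus_0_r in HN. apply Rle_lt_trans with (1 := Rle_abs _) in HN.
    apply Rmult_lt_reg_r with (1 - Cmod q); [lra|].
    replace (INR N * (INR N * (Cmod q ^ N / (1 - Cmod q))) * (1 - Cmod q))
      with (INR N * INR N * Cmod q ^ N) by (field; lra). exact HN.
Qed.

(** * The Eisenstein series *)

Definition qs (a : nat -> C) (z : C) : C := ps a (nome z).

(** The operator q d/dq. *)
Definition theta_op (a : nat -> C) (n : nat) : C := (RtoC (INR n) * a n)%C.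

Lemma conv_theta_op R a : conv R a -> conv R (theta_op a).
Proof. apply conv_n. Qed.

Lemma ps_theta_op R a x : conv R a -> Cmod x < R -> (x * ps (dps a) x = ps (theta_op a) x)%C.
Proof.
  intros Ha Hx. rewrite (ps_S R (theta_op a) x (conv_n R a Ha) Hx).
  replace (theta_op a 0) with (RtoC 0) by (unfold theta_op; simpl; ring).
  change (fun n => theta_op a (S n)) with (dps a). ring.
Qed.

Lemma nome_disc z : 0 < Im z -> Cmod (nome z) < 1.
Proof. intros H. now apply Cmod_nome_lt_1. Qed.

Lemma cder_qs a z : conv 1 a -> 0 < Im z -> cder (qs a) z (two_pi_i * qs (theta_op a) z)%C.
Proof.
  intros Ha Hz. unfold qs. rewrite <- (ps_theta_op 1) by auto using nome_disc.
  eapply cder_eq; [|apply (cder_comp (ps a) nome); [apply (cder_ps 1)|apply cder_nome]]; auto using nome_disc.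
  ring.
Qed.

Lemma cder_unique f x l m : cder f x l -> cder f x m -> l = m.
Proof.
  intros Hl Hm.
  assert (E : (l - m)%C = RtoC 0).
  { apply Cmod_eq_0. apply Rle_antisym; [|apply Cmod_ge_0]. apply Rnot_lt_le. intros Hlt.
    set (e := Cmod (l - m)%C) in *.
    destruct (proj1 (cder_eps _ _ _) Hl (e / 4)) as [d1 [d10 H1]]; [lra|].
    destruct (proj1 (cder_eps _ _ _) Hm (e / 4)) as [d2 [d20 H2]]; [lra|].
    set (h := Rmin d1 d2 / 2). assert (Hh : 0 < h < d1 /\ h < d2).
    { pose proof (Rmin_l d1 d2). pose proof (Rmin_r d1 d2). pose proof (Rmin_pos d1 d2 d10 d20). unfold h. lra. }
    specialize (H1 (x + RtoC h)%C). specialize (H2 (x + RtoC h)%C).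
    replace (x + RtoC h - x)%C with (RtoC h) in H1, H2 by ring.
    rewrite Cmod_R, Rabs_pos_eq in H1, H2 by lra. specialize (H1 ltac:(lra)). specialize (H2 ltac:(lra)).
    assert (Q : e * h <= e / 4 * h + e / 4 * h).
    { unfold e at 1. rewrite <- (Rabs_pos_eq h) at 1 by lra. rewrite <- Cmod_R, <- Cmod_mult.
      replace ((l - m) * RtoC h)%C with ((f (x + RtoC h) - f x - RtoC h * m) - (f (x + RtoC h) - f x - RtoC h * l))%C by ring.
      unfold Cminus at 1. eapply Rle_trans; [apply Cmod_triangle|]. rewrite Cmod_opp. lra. }
    nra. }
  replace l with (m + (l - m))%C by ring. rewrite E. ring.
Qed.

Lemma Im_near z y : Cmod (y - z)%C < Im z -> 0 < Im y.
Proof.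
  intros H. pose proof (im_le_Cmod (y - z)%C) as K. unfold Cminus in K, H.
  rewrite Im_plus, Im_opp in K. apply Rabs_le_between in K. lra.
Qed.

Lemma cder_inv_pt z : z <> RtoC 0 -> cder inv_pt z (/ (z * z))%C.
Proof.
  intros H. eapply cder_eq; [|apply cder_opp, cder_inv; auto]. field. auto.
Qed.

(** Differentiation of a transformation rule under z -> -1/z. *)
Lemma qs_theta_op_inv a (Phi : C -> C) z l : conv 1 a -> 0 < Im z ->
  (forall y, 0 < Im y -> qs a (inv_pt y) = Phi y) -> cder Phi z l ->
  (two_pi_i * qs (theta_op a) (inv_pt z) = z * z * l)%C.
Proof.
  intros Ha Hz H D. destruct (Im_inv_pt z Hz) as (z0 & _ & Ht).
  assert (D1 : cder Phi z (/ (z * z) * (two_pi_i * qs (theta_op a) (inv_pt z)))%C).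
  { apply (cder_ext_loc (fun y => qs a (inv_pt y))) with (Im z); auto.
    - intros y Hy. apply H. now apply Im_near in Hy.
    - apply (cder_comp (qs a) inv_pt); [now apply cder_qs|now apply cder_inv_pt]. }
  rewrite (cder_unique _ _ _ _ D D1). field. auto.
Qed.

Definition e2 (n : nat) : C := match n with O => RtoC 1 | S _ => (RtoC (-24) * sigma n)%C end.

Lemma conv_e2 : conv 1 e2.
Proof.
  apply (conv_shift 1 (fun n => RtoC (-24) * sigma (S n))%C); [reflexivity|].
  apply (conv_S 1 (fun n => RtoC (-24) * sigma n)%C), conv_scal, conv_sigma.
Qed.

Lemma E2_G2 z : 0 < Im z -> qs e2 z = (RtoC (-12) * G2 z)%C.
Proof.
  intros Hz. unfold G2, qs. rewrite (lambert _ (Cmod_nome_lt_1 z Hz)).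
  pose proof (nome_disc z Hz) as Hd.
  rewrite (ps_S 1 e2), (ps_S 1 sigma) by auto using conv_e2, conv_sigma.
  cbn [e2].
  rewrite (ps_scal 1) by (auto; apply (conv_S 1 sigma), conv_sigma).
  replace (sigma 0) with (RtoC 0) by reflexivity.
  replace (RtoC (-24)) with (RtoC (-12) * RtoC 2)%C by (rewrite <- RtoC_mult; f_equal; ring).
  replace (RtoC 1) with (RtoC (-12) * RtoC (- / 12))%C by (rewrite <- RtoC_mult; f_equal; field). ring.
Qed.

Lemma E2_inv z : 0 < Im z -> qs e2 (inv_pt z) = (z * z * qs e2 z + RtoC 12 * z / two_pi_i)%C.
Proof.
  intros Hz. destruct (Im_inv_pt z Hz) as (z0 & _ & Ht). pose proof two_pi_i_neq_0.
  rewrite !E2_G2 by auto. pose proof (G2_inv z Hz) as G.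
  replace (G2 (inv_pt z)) with (z * z * (G2 z - (G2 z - / (z * z) * G2 (inv_pt z))))%C by (field; auto).
  rewrite G. replace (RtoC (-12)) with (- RtoC 12)%C by (rewrite <- RtoC_opp; f_equal; ring). field. auto.
Qed.

(** The modified derivative E2^2 - 12 D E2: the terms in which the transformation of E2
    deviates from that of a form of weight 2 cancel. *)
Definition e4 (n : nat) : C := (pmul e2 e2 n + RtoC (-12) * theta_op e2 n)%C.
(** The modified derivative E2 E4 - 3 D E4; see [e4]. *)
Definition e6 (n : nat) : C := (pmul e2 e4 n + RtoC (-3) * theta_op e4 n)%C.

Lemma conv_e4 : conv 1 e4.
Proof. apply conv_plus; [apply conv_pmul|apply conv_scal, conv_n]; apply conv_e2. Qed.

Lemma conv_e6 : conv 1 e6.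
Proof.
  apply conv_plus; [apply conv_pmul|apply conv_scal, conv_n]; auto using conv_e2, conv_e4.
Qed.

Lemma qs_e4 z : 0 < Im z -> qs e4 z = (qs e2 z * qs e2 z + RtoC (-12) * qs (theta_op e2) z)%C.
Proof.
  intros Hz. unfold qs, e4. pose proof (nome_disc z Hz). pose proof conv_e2.
  rewrite (ps_plus 1), (ps_pmul 1), (ps_scal 1) by (auto using conv_pmul, conv_scal, conv_theta_op). reflexivity.
Qed.

Lemma qs_e6 z : 0 < Im z -> qs e6 z = (qs e2 z * qs e4 z + RtoC (-3) * qs (theta_op e4) z)%C.
Proof.
  intros Hz. unfold qs, e6. pose proof (nome_disc z Hz). pose proof conv_e2. pose proof conv_e4.
  rewrite (ps_plus 1), (ps_pmul 1), (ps_scal 1) by (auto using conv_pmul, conv_scal, conv_theta_op). reflexivity.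
Qed.

Lemma E4_inv z : 0 < Im z -> qs e4 (inv_pt z) = (z ^ 4 * qs e4 z)%C.
Proof.
  intros Hz. destruct (Im_inv_pt z Hz) as (z0 & _ & Ht). pose proof two_pi_i_neq_0.
  rewrite !qs_e4 by auto. rewrite E2_inv by auto.
  assert (D : (two_pi_i * qs (theta_op e2) (inv_pt z) = z * z * (RtoC 2 * z * qs e2 z + z * z * (two_pi_i * qs (theta_op e2) z) + RtoC 12 / two_pi_i))%C).
  { apply (qs_theta_op_inv e2 (fun z => z * z * qs e2 z + RtoC 12 * z / two_pi_i)%C); auto using conv_e2, E2_inv.
    eapply cder_eq; [|apply cder_plus; [apply cder_mult; [apply cder_mult; apply cder_id|apply cder_qs; auto using conv_e2]
      |apply cder_mult; [apply cder_scal, cder_id|apply cder_const]]].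
    replace (RtoC 2) with (RtoC 1 + RtoC 1)%C by (rewrite <- RtoC_plus; f_equal; ring). field. auto. }
  replace (qs (theta_op e2) (inv_pt z)) with (/ two_pi_i * (two_pi_i * qs (theta_op e2) (inv_pt z)))%C by (field; auto).
  rewrite D. replace (RtoC (-12)) with (- RtoC 12)%C by (rewrite <- RtoC_opp; f_equal; ring). field. auto.
Qed.

Lemma E6_inv z : 0 < Im z -> qs e6 (inv_pt z) = (z ^ 6 * qs e6 z)%C.
Proof.
  intros Hz. destruct (Im_inv_pt z Hz) as (z0 & _ & Ht). pose proof two_pi_i_neq_0.
  rewrite !qs_e6 by auto. rewrite E2_inv, E4_inv by auto.
  assert (D : (two_pi_i * qs (theta_op e4) (inv_pt z) = z * z * (RtoC 4 * z ^ 3 * qs e4 z + z ^ 4 * (two_pi_i * qs (theta_op e4) z)))%C).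
  { apply (qs_theta_op_inv e4 (fun z => z ^ 4 * qs e4 z)%C); auto using conv_e4, E4_inv.
    eapply cder_eq; [|apply cder_mult; [apply (cder_pow (fun z => z) z (RtoC 1) 4), cder_id|apply cder_qs; auto using conv_e4]].
    replace (INR 4) with 4 by (simpl; ring). simpl. ring. }
  replace (qs (theta_op e4) (inv_pt z)) with (/ two_pi_i * (two_pi_i * qs (theta_op e4) (inv_pt z)))%C by (field; auto).
  rewrite D. replace (RtoC (-3)) with (- RtoC 3)%C by (rewrite <- RtoC_opp; f_equal; ring).
  replace (RtoC 12) with (RtoC 3 * RtoC 4)%C by (rewrite <- RtoC_mult; f_equal; ring). field. auto.
Qed.

Lemma e_coefs : e4 0 = RtoC 1 /\ e4 1 = RtoC 240 /\ e6 0 = RtoC 1 /\ e6 1 = RtoC (-504).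
Proof.
  assert (s1 : sigma 1 = RtoC 1).
  { unfold sigma. cbn [csum]. unfold dvd_ind. simpl Nat.modulo. simpl Nat.eqb. cbn [INR].
    rewrite Cplus_0_l. f_equal. ring. }
  assert (A0 : e4 0 = RtoC 1).
  { unfold e4, theta_op, pmul, conv_prod. cbn [csum Nat.sub]. change (INR 0) with 0. cbn [e2]. ring. }
  assert (A1 : e4 1 = RtoC 240).
  { unfold e4, theta_op, pmul, conv_prod. cbn [csum Nat.sub]. change (INR 1) with 1. cbn [e2]. rewrite s1.
    rewrite Cplus_0_l, <- !RtoC_mult, <- !RtoC_plus. f_equal. ring. }
  repeat split; auto.
  - unfold e6, theta_op, pmul, conv_prod. cbn [csum Nat.sub]. change (INR 0) with 0. rewrite A0. cbn [e2]. ring.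
  - unfold e6, theta_op, pmul, conv_prod. cbn [csum Nat.sub]. change (INR 1) with 1. rewrite A0, A1. cbn [e2]. rewrite s1.
    rewrite Cplus_0_l, <- !RtoC_mult, <- !RtoC_plus. f_equal. ring.
Qed.

(** * The discriminant *)

(** The recursion (n + 1) u_(n+1) = sum of b_j u_(n-j) refers to all earlier values, so the
    table of values up to n is built by structural recursion on n. *)
Fixpoint ode_table (b : nat -> C) (n : nat) : nat -> C :=
  match n with
  | O => fun _ => RtoC 1
  | S m => fun k => if (k <=? m)%nat then ode_table b m k else
      (csum (S m) (fun j => b j * ode_table b m (m - j)%nat) / RtoC (INR (S m)))%C
  end.

Definition ode (b : nat -> C) (n : nat) : C := ode_table b n n.

Lemma ode_table_stable b n k : (k <= n)%nat -> ode_table b n k = ode b k.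
Proof.
  induction n; intros H.
  - replace k with O by lia. reflexivity.
  - destruct (Nat.eq_dec k (S n)) as [->|E]; [reflexivity|].
    simpl. rewrite (proj2 (Nat.leb_le k n)) by lia. apply IHn. lia.
Qed.

Lemma INR_S_neq_0 n : RtoC (INR (S n)) <> RtoC 0.
Proof. apply RtoC_neq_0, not_0_INR. lia. Qed.

Lemma ode_eq b n : dps (ode b) n = pmul b (ode b) n.
Proof.
  unfold dps. unfold ode at 1. cbn [ode_table].
  rewrite (proj2 (Nat.leb_gt (S n) n)) by lia.
  unfold pmul, conv_prod. rewrite (csum_ext _ _ (fun k => b k * ode b (n - k)%nat)%C).
  - field. apply INR_S_neq_0.
  - intros k Hk. rewrite ode_table_stable by lia. reflexivity.
Qed.

Lemma sum_f_R0_le_series (u : nat -> R) n : (forall k, 0 <= u k) -> ex_series u ->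
  sum_f_R0 u n <= Series u.
Proof.
  intros H Hu. rewrite (Series_incr_n u (S n)) by (auto; lia). cbn [pred].
  assert (0 <= Series (fun k => u (S n + k)%nat)); [|lra].
  rewrite <- Series_R0. apply Series_le; [intros; split; [lra|auto]|].
  apply (ex_series_incr_n_R u). exact Hu.
Qed.

(** With S the sum of |b_j| r^j and w_n = |u_n| r^n, the recursion gives
    (n + 1) w_(n+1) <= S max_(k <= n) w_k.  Once n + 1 >= S the maximum no longer grows. *)
Lemma conv_ode b : conv 1 b -> conv 1 (ode b).
Proof.
  intros Hb. apply conv_bounded. intros r Hr.
  set (v := fun j => Cmod (b j) * r ^ j).
  assert (v0 : forall j, 0 <= v j) by (intros; apply Rmult_le_pos; [apply Cmod_ge_0|apply pow_le; lra]).
  pose proof (Hb r Hr) as Hv. fold v in Hv. set (S := Series v).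
  assert (S0 : 0 <= S) by (apply Rle_trans with (1 := v0 O), (ex_series_term_bound v v0 Hv)).
  (* Beyond N0 the recursion cannot increase the maximum M of the first values. *)
  destruct (INR_unbounded S) as [N0 HN0].
  set (w := fun k => Cmod (ode b k) * r ^ k).
  assert (w0 : forall j, 0 <= w j) by (intros; apply Rmult_le_pos; [apply Cmod_ge_0|apply pow_le; lra]).
  exists (sum_f_R0 w N0). set (M := sum_f_R0 w N0).
  assert (Hsmall : forall n, (n <= N0)%nat -> w n <= M).
  { unfold M. clear - w0. induction N0; intros n Hn.
    - replace n with O by lia. simpl. lra.
    - simpl. destruct (Nat.eq_dec n (Datatypes.S N0)) as [->|E].
      + pose proof (cond_pos_sum w N0 w0). lra.
      + pose proof (IHN0 n ltac:(lia)). pose proof (w0 (Datatypes.S N0)). lra. }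
  assert (M0 : 0 <= M) by (apply Rle_trans with (1 := w0 O), Hsmall; lia).
  intros n. change (w n <= M). induction n as [n IH] using (well_founded_induction lt_wf).
  destruct (le_lt_dec n N0) as [L|L]; [now apply Hsmall|].
  destruct n as [|n]; [lia|].
  assert (Hn : S <= INR (Datatypes.S n)) by (left; apply Rlt_trans with (1 := HN0), lt_INR; lia).
  assert (Hp : 0 < INR (Datatypes.S n)) by (apply lt_0_INR; lia).
  assert (B : INR (Datatypes.S n) * w (Datatypes.S n) <= S * M).
  { unfold w. rewrite <- Rmult_assoc.
    replace (INR (Datatypes.S n) * Cmod (ode b (Datatypes.S n))) with (Cmod (dps (ode b) n))
      by (unfold dps; rewrite Cmod_mult, Cmod_R, Rabs_pos_eq; lra).
    rewrite ode_eq. unfold pmul, conv_prod.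
    apply Rle_trans with (sum_f_R0 (fun k => Cmod (b k * ode b (n - k)%nat)%C) n * r ^ Datatypes.S n).
    { apply Rmult_le_compat_r; [apply pow_le; lra|apply Cmod_csum_S]. }
    rewrite Rmult_comm, scal_sum.
    apply Rle_trans with (sum_f_R0 (fun k => v k * M) n).
    - apply sum_Rle. intros k Hk. rewrite Cmod_mult.
      replace (Cmod (b k) * Cmod (ode b (n - k)%nat) * r ^ Datatypes.S n)
        with (r * (v k * w (n - k)%nat)).
      + pose proof (IH (n - k)%nat ltac:(lia)). pose proof (v0 k). pose proof (w0 (n - k)%nat).
        assert (v k * w (n - k)%nat <= v k * M) by (apply Rmult_le_compat_l; auto).
        assert (0 <= v k * w (n - k)%nat) by (apply Rmult_le_pos; auto). nra.
      + unfold v, w. replace (Datatypes.S n) with (1 + (k + (n - k)))%nat by lia.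
        rewrite !pow_add. ring.
    - rewrite <- (scal_sum v n M), Rmult_comm. apply Rmult_le_compat_r; auto.
      now apply sum_f_R0_le_series. }
  apply Rmult_le_reg_l with (INR (Datatypes.S n)); auto.
  apply Rle_trans with (1 := B). apply Rmult_le_compat_r; auto.
Qed.

(** The solutions for b and -b have a product with zero derivative. *)
Lemma ode_inverse b x : conv 1 b -> Cmod x < 1 ->
  (ps (ode b) x * ps (ode (fun n => - (1) * b n)) x = RtoC 1)%C.
Proof.
  intros Hb Hx. set (b' := fun n => (- (1) * b n)%C).
  assert (Hb' : conv 1 b') by now apply conv_scal.
  pose proof (conv_ode b Hb) as Hu. pose proof (conv_ode b' Hb') as Hv.
  assert (D : forall y, Cmod y < 1 -> cder (fun y => ps (ode b) y * ps (ode b') y)%C y (RtoC 0)).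
  { intros y Hy. eapply cder_eq; [|apply cder_mult; apply (cder_ps 1); auto].
    rewrite (ps_ext (dps (ode b)) _ y (ode_eq b)), (ps_ext (dps (ode b')) _ y (ode_eq b')).
    rewrite !(ps_pmul 1) by auto. unfold b' at 2. rewrite (ps_scal 1) by auto. ring. }
  assert (E : (ps (ode b) x * ps (ode b') x = ps (ode b) (RtoC 0) * ps (ode b') (RtoC 0))%C).
  { apply (cder_zero_segment (fun y => ps (ode b) y * ps (ode b') y)%C).
    intros t Ht. apply D. replace (x + RtoC t * (RtoC 0 - x))%C with (RtoC (1 - t) * x)%C
      by (rewrite RtoC_minus; ring).
    rewrite Cmod_mult, Cmod_R, Rabs_pos_eq by lra. pose proof (Cmod_ge_0 x). nra. }
  rewrite E. assert (z0 : Cmod (RtoC 0) < 1) by (rewrite Cmod_0; lra).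
  rewrite (ps_S 1 (ode b)), (ps_S 1 (ode b')) by auto.
  replace (ode b 0) with (RtoC 1) by reflexivity. replace (ode b' 0) with (RtoC 1) by reflexivity. ring.
Qed.

Definition delta_unit : nat -> C := ode (fun n => e2 (S n)).
Definition delta_unit_inv : nat -> C := ode (fun n => - (1) * e2 (S n))%C.
(** Delta = q u with u' = b u and b = (E2 - 1)/q, which means D Delta = E2 Delta. *)
Definition delta (n : nat) : C := match n with O => RtoC 0 | S m => delta_unit m end.

Lemma conv_e2S : conv 1 (fun n => e2 (S n)).
Proof. apply (conv_S 1 e2), conv_e2. Qed.

Lemma conv_delta_unit : conv 1 delta_unit. Proof. apply conv_ode, conv_e2S. Qed.
Lemma conv_delta_unit_inv : conv 1 delta_unit_inv. Proof. apply conv_ode, conv_scal, conv_e2S. Qed.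
Lemma conv_delta : conv 1 delta.
Proof. apply (conv_shift 1 delta_unit); [reflexivity|apply conv_delta_unit]. Qed.

Lemma ps_delta x : Cmod x < 1 -> ps delta x = (x * ps delta_unit x)%C.
Proof.
  intros H. rewrite (ps_S 1) by (auto using conv_delta).
  change (fun n => delta (S n)) with delta_unit. cbn [delta]. ring.
Qed.

Lemma delta_unit_inverse x : Cmod x < 1 -> (ps delta_unit x * ps delta_unit_inv x = RtoC 1)%C.
Proof. intros H. apply (ode_inverse (fun n => e2 (S n))); auto using conv_e2S. Qed.

Lemma ps_delta_neq_0 x : x <> RtoC 0 -> Cmod x < 1 -> ps delta x <> RtoC 0.
Proof.
  intros H0 H. rewrite ps_delta by auto. apply Cmult_neq_0; auto.
  intros E. pose proof (delta_unit_inverse x H) as D. rewrite E, Cmult_0_l in D. apply RtoC_inj in D. lra.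
Qed.

Lemma cder_qs_delta z : 0 < Im z -> cder (qs delta) z (two_pi_i * qs e2 z * qs delta z)%C.
Proof.
  intros Hz. pose proof (nome_disc z Hz) as Hd.
  eapply cder_eq; [|apply cder_qs; auto using conv_delta].
  unfold qs. rewrite <- (ps_theta_op 1) by auto using conv_delta.
  assert (E : ps (dps delta) (nome z) = (ps e2 (nome z) * ps delta_unit (nome z))%C); [|rewrite E, ps_delta by auto; ring].
  rewrite (ps_S 1 (dps delta)) by auto using conv_dps, conv_delta.
  rewrite (ps_S 1 e2) by auto using conv_e2.
  assert (D1 : (ps (fun n => dps delta (S n)) (nome z) = ps (fun n => dps delta_unit n + delta_unit (S n)) (nome z))%C).
  { apply ps_ext. intros n. unfold dps. cbn [delta]. rewrite (S_INR (S n)), RtoC_plus. ring. }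
  rewrite D1, (ps_plus 1) by (auto using conv_dps, conv_delta_unit; apply (conv_S 1 delta_unit), conv_delta_unit).
  rewrite (ps_ext (dps delta_unit) _ _ (ode_eq _)). fold delta_unit.
  rewrite (ps_pmul 1) by auto using conv_e2S, conv_delta_unit.
  rewrite (ps_S 1 delta_unit) by auto using conv_delta_unit.
  unfold dps at 1. cbn [delta]. change (INR 1) with 1. replace (delta_unit 0) with (RtoC 1) by reflexivity.
  cbn [e2]. ring.
Qed.

(** Both Delta(-1/z) and z^12 Delta(z) have logarithmic derivative 2 pi i E2(z) + 12/z by the
    transformation law of E2, so their quotient is constant; at z = i it is 1. *)
Lemma delta_inv z : 0 < Im z -> qs delta (inv_pt z) = (z ^ 12 * qs delta z)%C.
Proof.
  assert (NZ : forall y, 0 < Im y -> qs delta y <> RtoC 0).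
  { intros y Hy. apply ps_delta_neq_0; [apply nome_neq_0|now apply nome_disc]. }
  intros Hz. pose proof two_pi_i_neq_0.
  set (Rt := fun y => (qs delta (inv_pt y) / (y ^ 12 * qs delta y))%C).
  assert (D : forall y, 0 < Im y -> cder Rt y (RtoC 0)).
  { intros y Hy. destruct (Im_inv_pt y Hy) as (y0 & _ & Ht).
    pose proof (NZ y Hy). pose proof (Cpow_nz y 12 y0).
    eapply cder_eq; [|unfold Rt; apply cder_div; [now apply Cmult_neq_0| |apply cder_mult]].
    2:{ apply (cder_comp (qs delta) inv_pt); [now apply cder_qs_delta|now apply cder_inv_pt]. }
    2:{ apply (cder_pow (fun z => z) y (RtoC 1) 12), cder_id. }
    2:{ now apply cder_qs_delta. }
    rewrite E2_inv by auto. replace (INR 12) with 12 by (simpl; ring).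
    cbn [pred]. replace (y ^ 12)%C with (y * y ^ 11)%C by reflexivity.
    pose proof (Cpow_nz y 11 y0). set (Y := (y ^ 11)%C) in *. field. auto. }
  assert (E : Rt z = Rt Ci).
  { apply cder_zero_segment. intros t Ht. apply D.
    rewrite Im_plus, Im_scal_l. unfold Cminus. rewrite Im_plus, Im_opp. simpl (Im Ci).
    destruct (Req_dec t 1) as [->|]; nra. }
  assert (I0 : 0 < Im Ci) by (simpl; lra).
  assert (Ei : inv_pt Ci = Ci).
  { unfold inv_pt. replace Ci with (/ (/ Ci))%C at 2 by (field; apply Ci_neq_0).
    rewrite <- (Cmult_1_l (/ Ci)) at 1. replace (RtoC 1) with (- (Ci * Ci))%C by (rewrite Ci2; ring). field. apply Ci_neq_0. }
  assert (Ri : Rt Ci = RtoC 1).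
  { unfold Rt. rewrite Ei. replace (Ci ^ 12)%C with (RtoC 1).
    - field. now apply NZ.
    - replace 12%nat with (2 * 6)%nat by reflexivity. rewrite Cpow_mult_r.
      replace (Ci ^ 2)%C with (Ci * Ci)%C by (simpl; ring). rewrite Ci2. simpl; ring. }
  rewrite Ri in E. unfold Rt in E. destruct (Im_inv_pt z Hz) as (z0 & _ & _).
  pose proof (NZ z Hz). pose proof (Cpow_nz z 12 z0).
  replace (qs delta (inv_pt z)) with (qs delta (inv_pt z) / (z ^ 12 * qs delta z) * (z ^ 12 * qs delta z))%C
    by (field; auto).
  rewrite E. ring.
Qed.

(** * Forms of weight zero *)

Lemma nome_Z m : nome (RtoC (IZR m)) = RtoC 1.
Proof.
  assert (P : forall n : nat, nome (RtoC (INR n)) = RtoC 1).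
  { intros n. rewrite nome_two_pi_i. replace (two_pi_i * RtoC (INR n))%C with (RtoC (INR n) * two_pi_i)%C by ring.
    rewrite Cexp_pow. unfold two_pi_i. rewrite Cexp_2PI. apply Cpow_1_l. }
  destruct (Z_le_dec 0 m) as [H|H].
  - rewrite <- (Z2Nat.id m H), <- INR_IZR_INZ. apply P.
  - replace m with (- Z.of_nat (Z.to_nat (- m)))%Z by (rewrite Z2Nat.id; lia).
    rewrite opp_IZR, <- INR_IZR_INZ, RtoC_opp, nome_opp, P. field.
Qed.

Lemma qs_translate a z m : qs a (z + RtoC (IZR m))%C = qs a z.
Proof. unfold qs. rewrite nome_plus, nome_Z, Cmult_1_r. reflexivity. Qed.

Lemma near_integer x : exists m : Z, Rabs (x + IZR m) <= 1 / 2.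
Proof.
  exists (- up (x - 1 / 2))%Z. rewrite opp_IZR. destruct (archimed (x - 1 / 2)) as [H1 H2].
  apply Rabs_le_between. lra.
Qed.

(** While Im z < 1/2, a translation makes |Re z| <= 1/2, hence |z|^2 <= 1/2, and then
    z -> -1/z at least doubles the imaginary part. *)
Lemma reduce_bound b M :
  (forall z, 0 < Im z -> qs b (inv_pt z) = qs b z) ->
  (forall z, 1 / 2 <= Im z -> Cmod (qs b z) <= M) ->
  forall z, 0 < Im z -> Cmod (qs b z) <= M.
Proof.
  intros HS HM.
  assert (K : forall n z, 0 < Im z -> (/ 2) ^ S n <= Im z -> Cmod (qs b z) <= M).
  { induction n; intros z Hz Hn; [apply HM; simpl in Hn; lra|].
    destruct (Rle_dec (1 / 2) (Im z)) as [L|L]; [now apply HM|].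
    destruct (near_integer (Re z)) as [m Hm].
    rewrite <- (qs_translate b z m). set (w := (z + RtoC (IZR m))%C).
    assert (Iw : Im w = Im z) by (unfold w; rewrite Im_plus, Im_RtoC; ring).
    assert (Rw : Re w = Re z + IZR m) by (unfold w; rewrite re_plus, re_RtoC; ring).
    assert (Hw : 0 < Im w) by lra.
    rewrite <- HS by auto. destruct (Im_inv_pt w Hw) as (w0 & E & Ht).
    apply IHn; auto. rewrite E.
    assert (W : Cmod w * Cmod w = Re w ^ 2 + Im w ^ 2) by (rewrite <- Cmod2_alt; ring).
    assert (0 < Cmod w) by now apply Cmod_gt_0.
    apply Rabs_le_between in Hm. rewrite <- Rw in Hm.
    assert (Cmod w * Cmod w <= 1 / 2) by (rewrite W; nra).
    apply Rmult_le_reg_r with (Cmod w * Cmod w); [nra|].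
    unfold Rdiv. rewrite Rmult_assoc, Rinv_l by nra. rewrite Rmult_1_r, Iw.
    assert (0 < (/ 2) ^ S n) by (apply pow_lt; lra).
    change ((/ 2) ^ S (S n)) with (/ 2 * (/ 2) ^ S n) in Hn. nra. }
  intros z Hz.
  destruct (pow_lt_1_zero (/ 2) ltac:(rewrite Rabs_pos_eq; lra) (Im z) Hz) as [k Hk].
  apply (K k); auto. left. specialize (Hk (S k) ltac:(lia)).
  rewrite Rabs_pos_eq in Hk; auto. apply pow_le; lra.
Qed.

(** A complex logarithm, with the argument taken from the arc cosine. *)
Lemma nome_surj x : 0 < Cmod x < 1 -> exists z, 0 < Im z /\ nome z = x.
Proof.
  intros Hx. set (r := Cmod x) in *. pose proof PI_RGT_0.
  set (a := Re x / r). set (b := Im x / r).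
  assert (Hab : a * a + b * b = 1).
  { unfold a, b. replace (Re x / r * (Re x / r) + Im x / r * (Im x / r))
      with ((Re x ^ 2 + Im x ^ 2) / (r * r)) by (field; lra).
    rewrite <- Cmod2_alt. fold r. field. lra. }
  assert (Ht : exists t, cos t = a /\ sin t = b).
  { assert (Ha : -1 <= a <= 1) by nra.
    pose proof (cos_acos a Ha) as C1. pose proof (sin_acos a Ha) as S1.
    assert (E : sqrt (1 - a²) = Rabs b).
    { replace (1 - a²) with (b²) by (unfold Rsqr; lra). apply sqrt_Rsqr_abs. }
    rewrite E in S1. destruct (Rle_dec 0 b) as [L|L].
    - exists (acos a). rewrite Rabs_pos_eq in S1 by auto. auto.
    - exists (- acos a). rewrite cos_neg, sin_neg, S1, Rabs_left by lra. split; auto. ring. }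
  destruct Ht as (t & Ct & St).
  exists ((t / (2 * PI))%R, (- ln r / (2 * PI))%R).
  assert (ln r < 0) by (rewrite <- ln_1; apply ln_increasing; lra).
  split; [simpl; apply Rdiv_lt_0_compat; lra|].
  rewrite nome_two_pi_i. unfold two_pi_i, Cexp.
  replace (RtoC (2 * PI) * Ci * ((t / (2 * PI))%R, (- ln r / (2 * PI))%R))%C with ((ln r, t) : C).
  - cbn [Re Im fst snd]. rewrite exp_ln by lra. rewrite Ct, St. unfold a, b.
    apply Ceq; cbn [Re Im fst snd]; field; lra.
  - apply Ceq; simpl; field; lra.
Qed.

(** On Im z >= 1/2 this bounds |q|. *)
Lemma exp_PI_bound : exp (- PI) <= 1 / 4.
Proof.
  pose proof PI2_1. pose proof (exp_ineq1 1 ltac:(lra)).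
  apply Rle_trans with (exp (- (1 + 1))).
  - left. apply exp_increasing. lra.
  - rewrite exp_Ropp, exp_plus. replace (1 / 4) with (/ 4) by field.
    apply Rinv_le_contravar; nra.
Qed.

(** A bound M for the function gives |b_n| (3/4)^n <= M by Cauchy's estimate.  Where
    |q| <= 1/4 the function is then at most the sum of M / 3^n over n >= 1, which is M/2,
    and invariance carries this new bound to the whole upper half-plane. *)
Lemma weight_zero b : conv 1 b -> b O = RtoC 0 ->
  (forall z, 0 < Im z -> qs b (inv_pt z) = qs b z) ->
  forall z, 0 < Im z -> qs b z = RtoC 0.
Proof.
  intros Hb b0 HS. pose proof PI_RGT_0.
  assert (small : forall z, 1 / 2 <= Im z -> Cmod (nome z) <= 1 / 4).
  { intros z Hz. apply Rle_trans with (2 := exp_PI_bound). rewrite Cmod_nome.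
    destruct (Req_dec (Im z) (1 / 2)) as [E|E].
    - rewrite E. right. f_equal. field.
    - left. apply exp_increasing. nra. }
  assert (start : exists M, 0 <= M /\ forall z, 0 < Im z -> Cmod (qs b z) <= M).
  { pose proof (Hb (1 / 4) ltac:(lra)) as HS4.
    exists (Series (fun n => Cmod (b n) * (1 / 4) ^ n)). split.
    - rewrite <- Series_R0. apply Series_le; auto. intros n. split; [lra|].
      apply Rmult_le_pos; [apply Cmod_ge_0|apply pow_le; lra].
    - apply reduce_bound; auto. intros z Hz. apply Cmod_CSum_le_bound; auto.
      intros n. rewrite Cmod_mult, Cmod_pow. apply Rmult_le_compat_l; [apply Cmod_ge_0|].
      apply pow_incr. split; [apply Cmod_ge_0|now apply small]. }
  assert (step : forall M, 0 <= M -> (forall z, 0 < Im z -> Cmod (qs b z) <= M) ->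
     forall z, 0 < Im z -> Cmod (qs b z) <= M / 2).
  { intros M M0 HM. apply reduce_bound; auto. intros z Hz. specialize (small z Hz).
    assert (Hc : forall n, Cmod (b n) * (3 / 4) ^ n <= M).
    { intros n. apply (Cauchy_estimate 1 b (3 / 4) M n Hb); [lra|].
      intros x Hx. destruct (nome_surj x) as (w & Hw & <-); [lra|]. now apply HM. }
    unfold qs, ps. rewrite CSum_S by (apply (conv_csummable 1); auto; lra).
    rewrite b0. replace (RtoC 0 * nome z ^ 0)%C with (RtoC 0) by ring. rewrite Cplus_0_l.
    assert (G : is_series (fun n => M / 3 * (1 / 3) ^ n) (M / 3 * / (1 - 1 / 3))).
    { apply (is_series_scal_l (K := R_AbsRing) (V := R_NormedModule) (M / 3)). apply is_series_geom.
      rewrite Rabs_pos_eq; lra. }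
    apply Rle_trans with (Series (fun n => M / 3 * (1 / 3) ^ n)).
    - apply Cmod_CSum_le_bound; [|eexists; exact G].
      intros n. rewrite Cmod_mult, Cmod_pow.
      apply Rle_trans with (Cmod (b (S n)) * (1 / 4) ^ S n).
      + apply Rmult_le_compat_l; [apply Cmod_ge_0|]. apply pow_incr. split; [apply Cmod_ge_0|auto].
      + replace ((1 / 4) ^ S n) with ((3 / 4) ^ S n * (1 / 3) ^ S n)
          by (rewrite <- Rpow_mult_distr; f_equal; field).
        rewrite <- Rmult_assoc. change ((1 / 3) ^ S n) with (1 / 3 * (1 / 3) ^ n).
        rewrite <- Rmult_assoc. apply Rmult_le_compat_r; [apply pow_le; lra|].
        specialize (Hc (S n)). lra.
    - rewrite (is_series_unique _ _ G). right. field. }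
  destruct start as (M & M0 & HM).
  assert (it : forall n z, 0 < Im z -> Cmod (qs b z) <= M * (/ 2) ^ n).
  { induction n; intros z Hz; [simpl; rewrite Rmult_1_r; auto|].
    change ((/ 2) ^ S n) with (/ 2 * (/ 2) ^ n).
    replace (M * (/ 2 * (/ 2) ^ n)) with (M * (/ 2) ^ n / 2) by (unfold Rdiv; ring).
    apply step; auto. apply Rmult_le_pos; auto. apply pow_le; lra. }
  intros z Hz. apply Cmod_eq_0. apply Rle_antisym; [|apply Cmod_ge_0].
  apply Rnot_lt_le. intros Hlt. set (e := Cmod (qs b z)) in *.
  destruct (pow_lt_1_zero (/ 2) ltac:(rewrite Rabs_pos_eq; lra) (e / (M + 1))) as [k Hk].
  { apply Rdiv_lt_0_compat; lra. }
  specialize (Hk k (le_n k)). rewrite Rabs_pos_eq in Hk by (apply pow_le; lra).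
  pose proof (it k z Hz) as I. fold e in I.
  apply Rmult_lt_compat_r with (r := M + 1) in Hk; [|lra].
  unfold Rdiv in Hk. rewrite Rmult_assoc, Rinv_l in Hk by lra.
  assert (0 < (/ 2) ^ k) by (apply pow_lt; lra). nra.
Qed.

Lemma qs_zero_coef a : conv 1 a -> (forall z, 0 < Im z -> qs a z = RtoC 0) -> forall n, a n = RtoC 0.
Proof.
  intros Ha H. apply (ps_zero_coef 1); auto; [lra|].
  intros x Hx. destruct (nome_surj x Hx) as (z & Hz & <-). now apply H.
Qed.

(** * Modular q-series and their order at infinity *)

(** Modularity in weight k of a q-series: periodicity is built in, so only z -> -1/z is
    required. *)
Definition modular_series (k : nat) (a : nat -> C) : Prop :=
  conv 1 a /\ forall z, 0 < Im z -> qs a (inv_pt z) = (z ^ k * qs a z)%C.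

Definition one_series (n : nat) : C := match n with O => RtoC 1 | _ => RtoC 0 end.

Fixpoint ppow (a : nat -> C) (n : nat) : nat -> C :=
  match n with O => one_series | S m => pmul a (ppow a m) end.

Lemma conv_one : conv 1 one_series.
Proof.
  apply (conv_shift 1 (fun _ => RtoC 0)); [reflexivity|].
  apply (conv_le 1 _ (fun _ => RtoC 1)); [|apply conv_1]. intros. rewrite Cmod_0, Cmod_1. lra.
Qed.

Lemma conv_zero : conv 1 (fun _ => RtoC 0).
Proof. apply (conv_le 1 _ (fun _ => RtoC 1)); [|apply conv_1]. intros. rewrite Cmod_0, Cmod_1. lra. Qed.

Lemma ps_zero x : ps (fun _ => RtoC 0) x = RtoC 0.
Proof. unfold ps. rewrite (CSum_ext _ (fun _ => RtoC 0)) by (intros; ring). apply CSum_0. Qed.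

Lemma ps_one x : Cmod x < 1 -> ps one_series x = RtoC 1.
Proof.
  intros H. rewrite (ps_S 1) by auto using conv_one.
  rewrite (ps_ext (fun n => one_series (S n)) (fun _ => RtoC 0)) by reflexivity.
  rewrite ps_zero. cbn [one_series]. ring.
Qed.

Lemma conv_ppow a n : conv 1 a -> conv 1 (ppow a n).
Proof. intros H. induction n; [apply conv_one|]. now apply conv_pmul. Qed.

Lemma ps_ppow a n x : conv 1 a -> Cmod x < 1 -> ps (ppow a n) x = (ps a x ^ n)%C.
Proof.
  intros H Hx. induction n; [now apply ps_one|]. cbn [ppow].
  rewrite (ps_pmul 1), IHn by auto using conv_ppow. reflexivity.
Qed.

Lemma qs_pmul a b z : conv 1 a -> conv 1 b -> 0 < Im z -> qs (pmul a b) z = (qs a z * qs b z)%C.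
Proof. intros. apply (ps_pmul 1); auto using nome_disc. Qed.

Lemma qs_ppow a n z : conv 1 a -> 0 < Im z -> qs (ppow a n) z = (qs a z ^ n)%C.
Proof. intros. apply ps_ppow; auto using nome_disc. Qed.

Lemma modular_pmul k l a b : modular_series k a -> modular_series l b -> modular_series (k + l) (pmul a b).
Proof.
  intros [Ha Ma] [Hb Mb]. split; [now apply conv_pmul|]. intros z Hz.
  destruct (Im_inv_pt z Hz) as (z0 & _ & Ht).
  rewrite !qs_pmul, Ma, Mb, Cpow_add_r by auto. ring.
Qed.

Lemma modular_one : modular_series 0 one_series.
Proof.
  split; [apply conv_one|]. intros z Hz. destruct (Im_inv_pt z Hz) as (z0 & _ & Ht).
  unfold qs. rewrite !ps_one by auto using nome_disc. simpl. ring.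
Qed.

Lemma modular_ppow k a n : modular_series k a -> modular_series (n * k) (ppow a n).
Proof. intros H. induction n; [apply modular_one|]. simpl. now apply modular_pmul. Qed.

Lemma modular_comb k a b c : modular_series k a -> modular_series k b -> modular_series k (fun n => a n + c * b n)%C.
Proof.
  intros [Ha Ma] [Hb Mb]. split; [apply conv_plus; auto using conv_scal|]. intros z Hz.
  destruct (Im_inv_pt z Hz) as (z0 & _ & Ht). unfold qs in *.
  rewrite !(ps_plus 1), !(ps_scal 1) by auto using nome_disc, conv_scal.
  rewrite Ma, Mb by auto. ring.
Qed.

Lemma qs_comb a b c z : conv 1 a -> conv 1 b -> 0 < Im z ->
  qs (fun n => a n + c * b n)%C z = (qs a z + c * qs b z)%C.
Proof.
  intros. unfold qs. rewrite (ps_plus 1), (ps_scal 1) by auto using nome_disc, conv_scal. reflexivity.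
Qed.

Lemma modular_zero k : modular_series k (fun _ => RtoC 0).
Proof. split; [apply conv_zero|]. intros. unfold qs. rewrite !ps_zero. ring. Qed.

Lemma modular_e4 : modular_series 4 e4. Proof. split; [apply conv_e4|apply E4_inv]. Qed.
Lemma modular_e6 : modular_series 6 e6. Proof. split; [apply conv_e6|apply E6_inv]. Qed.
Lemma modular_delta : modular_series 12 delta. Proof. split; [apply conv_delta|apply delta_inv]. Qed.

Definition ord_ge (m : nat) (a : nat -> C) : Prop := forall i, (i < m)%nat -> a i = RtoC 0.

Definition lead (m : nat) (c : C) (a : nat -> C) : Prop := ord_ge m a /\ a m = c.

Lemma csum_single n m f : (m < n)%nat -> (forall k, (k < n)%nat -> k <> m -> f k = RtoC 0) ->
  csum n f = f m.
Proof.
  induction n; intros Hm H; [lia|]. cbn [csum].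
  destruct (Nat.eq_dec m n) as [->|E].
  - rewrite csum_0; [ring|]. intros k Hk. apply H; lia.
  - rewrite (H n) by lia. rewrite IHn; [ring|lia|]. intros; apply H; lia.
Qed.

Lemma lead_pmul m l c d a b : lead m c a -> lead l d b -> lead (m + l) (c * d)%C (pmul a b).
Proof.
  intros [Ha <-] [Hb <-]. split.
  - intros i Hi. apply csum_0. intros k Hk.
    destruct (lt_dec k m) as [L|L]; [rewrite Ha by auto; ring|]. rewrite (Hb (i - k)%nat) by lia. ring.
  - unfold pmul, conv_prod. rewrite (csum_single _ m); [f_equal; f_equal; lia|lia|].
    intros k Hk Hkm. destruct (lt_dec k m) as [L|L]; [rewrite Ha by auto; ring|].
    rewrite (Hb (m + l - k)%nat) by lia. ring.
Qed.

Lemma lead_ppow m c a n : lead m c a -> lead (n * m) (c ^ n)%C (ppow a n).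
Proof.
  intros H. induction n.
  - split; [intros i Hi; simpl in Hi; lia|]. reflexivity.
  - simpl. now apply lead_pmul.
Qed.

Lemma lead_e4 : lead 0 (RtoC 1) e4.
Proof. split; [intros i Hi; lia|apply e_coefs]. Qed.
Lemma lead_e6 : lead 0 (RtoC 1) e6.
Proof. split; [intros i Hi; lia|apply e_coefs]. Qed.
Lemma lead_delta : lead 1 (RtoC 1) delta.
Proof. split; [intros i Hi; replace i with O by lia; reflexivity|reflexivity]. Qed.

Lemma lead_S m c a : lead m c a -> c = RtoC 0 -> ord_ge (S m) a.
Proof.
  intros [H E] ->. intros i Hi. destruct (Nat.eq_dec i m) as [->|]; auto. apply H; lia.
Qed.

(** * The valence bound *)

Lemma ps_factor m a : conv 1 a -> ord_ge m a ->
  exists h, conv 1 h /\ forall y, Cmod y < 1 -> ps a y = (y ^ m * ps h y)%C.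
Proof.
  revert a. induction m; intros a Ha Ho.
  - exists a. split; auto. intros; simpl; ring.
  - destruct (IHm (fun n => a (S n))) as (h & Hh & E); auto.
    + now apply conv_S.
    + intros i Hi. apply Ho. lia.
    + exists h. split; auto. intros y Hy. rewrite (ps_S 1) by auto. rewrite (Ho O) by lia.
      rewrite E by auto. simpl. ring.
Qed.

Lemma ps_shift_up j h : conv 1 h -> exists b, conv 1 b /\ ord_ge j b /\
  forall y, Cmod y < 1 -> ps b y = (y ^ j * ps h y)%C.
Proof.
  intros Hh. induction j.
  - exists h. repeat split; auto; [intros i Hi; lia|intros; simpl; ring].
  - destruct IHj as (b & Hb & Ob & E).
    set (b' := fun n => match n with O => RtoC 0 | S m => b m end).
    assert (Hb' : conv 1 b') by (apply (conv_shift 1 b); [reflexivity|auto]).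
    exists b'. repeat split; auto.
    + intros [|i] Hi; [reflexivity|]. apply Ob. lia.
    + intros y Hy. rewrite (ps_S 1) by auto. change (fun n => b' (S n)) with b. rewrite E by auto.
      cbn [b']. simpl. ring.
Qed.

Lemma Cpow_eq_0 x n : (x ^ n)%C = RtoC 0 -> x = RtoC 0.
Proof.
  intros H. destruct (Ceq_dec x (RtoC 0)) as [E|E]; auto. exfalso. exact (Cpow_nz x n E H).
Qed.

(** f^12 / Delta^k has weight zero, and it is a power series in q without constant term
    because 12 m > k. *)
Lemma valence k m a : modular_series k a -> ord_ge m a -> (k < 12 * m)%nat -> forall n, a n = RtoC 0.
Proof.
  intros [Ha Ma] Ho Hk. apply qs_zero_coef; auto.
  destruct (ps_factor m a Ha Ho) as (h & Hh & Eh).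
  (* With f = q^m h and Delta = q u this is f^12 / Delta^k up to the power q^(12m - k). *)
  set (g := pmul (ppow h 12) (ppow delta_unit_inv k)).
  assert (Hg : conv 1 g) by (apply conv_pmul; apply conv_ppow; auto using conv_delta_unit_inv).
  destruct (ps_shift_up (12 * m - k) g Hg) as (b & Hb & Ob & Eb).
  assert (F : forall z, 0 < Im z -> (qs b z * qs delta z ^ k = qs a z ^ 12)%C).
  { intros z Hz. unfold qs. pose proof (nome_disc z Hz) as D.
    rewrite Eb, Eh, ps_delta by auto. unfold g.
    rewrite (ps_pmul 1), !ps_ppow by auto using conv_ppow, conv_delta_unit_inv.
    rewrite !Cpow_mult_l, <- Cpow_mult_r. set (q := nome z) in *.
    replace (m * 12)%nat with ((12 * m - k) + k)%nat by lia. rewrite Cpow_add_r.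
    pose proof (delta_unit_inverse q D) as U.
    assert (U' : (ps delta_unit q ^ k * ps delta_unit_inv q ^ k)%C = RtoC 1) by (rewrite <- Cpow_mult_l, U; apply Cpow_1_l).
    replace (q ^ (12 * m - k) * (ps h q ^ 12 * ps delta_unit_inv q ^ k) * (q ^ k * ps delta_unit q ^ k))%C
      with (q ^ (12 * m - k) * q ^ k * ps h q ^ 12 * (ps delta_unit q ^ k * ps delta_unit_inv q ^ k))%C by ring.
    rewrite U'. ring. }
  assert (NZ : forall z, 0 < Im z -> (qs delta z ^ k)%C <> RtoC 0).
  { intros z Hz. apply Cpow_nz, ps_delta_neq_0; [apply nome_neq_0|now apply nome_disc]. }
  assert (B0 : forall z, 0 < Im z -> qs b z = RtoC 0).
  { apply weight_zero; auto; [apply Ob; lia|].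
    intros z Hz. destruct (Im_inv_pt z Hz) as (z0 & _ & Ht).
    pose proof (F _ Ht) as F1. pose proof (F _ Hz) as F2. rewrite Ma, delta_inv in F1 by auto.
    rewrite !Cpow_mult_l, <- !Cpow_mult_r in F1. rewrite (Nat.mul_comm k 12), <- F2 in F1.
    pose proof (NZ z Hz) as N1. pose proof (Cpow_nz z (12 * k) z0) as N2.
    set (W := (z ^ (12 * k))%C) in *. set (D := (qs delta z ^ k)%C) in *.
    replace (qs b (inv_pt z)) with (qs b (inv_pt z) * (W * D) * / (W * D))%C by (field; auto).
    rewrite F1. field. auto. }
  intros z Hz. apply (Cpow_eq_0 _ 12). rewrite <- F, B0 by auto. ring.
Qed.

(** The coefficients of q are 3 * 240 and 2 * (-504). *)
Lemma E4_cube_neq_E6_square : ~ (forall z, 0 < Im z -> (qs e4 z ^ 3 = qs e6 z ^ 2)%C).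
Proof.
  intros H. destruct e_coefs as (A0 & A1 & B0 & B1).
  assert (K : forall n, (ppow e4 3 n + - (1) * ppow e6 2 n)%C = RtoC 0).
  { apply qs_zero_coef.
    - apply conv_plus; [|apply conv_scal]; apply conv_ppow; auto using conv_e4, conv_e6.
    - intros z Hz. rewrite qs_comb, !qs_ppow by auto using conv_ppow, conv_e4, conv_e6.
      rewrite H by auto. ring. }
  specialize (K 1%nat). cbn [ppow] in K. unfold pmul, conv_prod in K. cbn [csum Nat.sub one_series] in K.
  rewrite A0, A1, B0, B1 in K.
  rewrite ?Cplus_0_l, ?Cmult_1_l, ?Cmult_1_r, ?Cmult_0_r, ?Cplus_0_l, ?Cplus_0_r in K.
  repeat rewrite <- ?RtoC_mult, <- ?RtoC_plus, <- ?RtoC_opp in K. apply RtoC_inj in K. lra.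
Qed.

(** Let c be the coefficient of q^l.  The forms f^2 - c^2 Delta^(2l) E4 and
    f^3 - c^3 Delta^(3l) E6 have an order that exceeds what their weights allow, so they
    vanish.  Comparing the sixth powers gives c = 0, and f itself has too large an order. *)
Lemma valence_2 l a : modular_series (12 * l + 2) a -> ord_ge l a -> forall n, a n = RtoC 0.
Proof.
  intros Ma Ho. set (c := a l). assert (La : lead l c a) by (split; auto).
  pose proof modular_delta as Md. pose proof lead_delta as Ld.
  assert (P : forall p k e, modular_series k e -> lead 0 (RtoC 1) e -> (p * (12 * l + 2) = p * l * 12 + k)%nat -> (k < 12)%nat ->
    forall z, 0 < Im z -> (qs a z ^ p = c ^ p * (qs delta z ^ (p * l) * qs e z))%C).
  { intros p k e Me Le Ek Hk z Hz.
    set (b := pmul (ppow delta (p * l)) e).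
    assert (Mb : modular_series (p * (12 * l + 2)) b) by (rewrite Ek; apply modular_pmul; auto; now apply modular_ppow).
    assert (Lb : lead (p * l) (RtoC 1) b).
    { replace (p * l)%nat with (p * l * 1 + 0)%nat at 1 by lia.
      replace (RtoC 1) with (RtoC 1 ^ (p * l) * RtoC 1)%C by (rewrite Cpow_1_l; ring).
      apply lead_pmul; auto. now apply lead_ppow. }
    pose proof (modular_ppow _ _ p Ma) as Mp. pose proof (lead_ppow _ _ _ p La) as Lp.
    assert (Z : forall n, (ppow a p n + - c ^ p * b n)%C = RtoC 0).
    { apply (valence (p * (12 * l + 2)) (S (p * l))).
      - now apply modular_comb.
      - intros i Hi. destruct (Nat.eq_dec i (p * l)) as [->|E].
        + rewrite (proj2 Lp), (proj2 Lb). ring.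
        + rewrite (proj1 Lp), (proj1 Lb) by lia. ring.
      - lia. }
    assert (Q : qs (fun n => ppow a p n + - c ^ p * b n)%C z = RtoC 0).
    { unfold qs. rewrite (ps_ext _ (fun _ => RtoC 0)) by exact Z. apply ps_zero. }
    rewrite qs_comb in Q by (first [exact (proj1 Mp)|exact (proj1 Mb)|assumption]).
    rewrite qs_ppow in Q by (first [exact (proj1 Ma)|assumption]). unfold b in Q.
    rewrite qs_pmul, qs_ppow in Q by (first [assumption|apply conv_ppow, conv_delta|apply conv_delta|exact (proj1 Me)]).
    replace (qs a z ^ p)%C with ((qs a z ^ p + - c ^ p * (qs delta z ^ (p * l) * qs e z)) + c ^ p * (qs delta z ^ (p * l) * qs e z))%C by ring.
    rewrite Q. ring. }
  assert (c0 : c = RtoC 0).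
  { destruct (Ceq_dec c (RtoC 0)) as [E|E]; auto. exfalso. apply E4_cube_neq_E6_square. intros z Hz.
    pose proof (P 2%nat 4%nat e4 modular_e4 lead_e4 ltac:(lia) ltac:(lia) z Hz) as P2.
    pose proof (P 3%nat 6%nat e6 modular_e6 lead_e6 ltac:(lia) ltac:(lia) z Hz) as P3.
    assert (Q : ((qs a z ^ 2) ^ 3 = (qs a z ^ 3) ^ 2)%C) by (rewrite <- !Cpow_mult_r; reflexivity).
    rewrite P2, P3 in Q. rewrite !Cpow_mult_l, <- !Cpow_mult_r in Q.
    replace (2 * l * 3)%nat with (6 * l)%nat in Q by lia. replace (3 * l * 2)%nat with (6 * l)%nat in Q by lia.
    change (2 * 3)%nat with 6%nat in Q. change (3 * 2)%nat with 6%nat in Q.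
    assert (N1 : (c ^ 6)%C <> RtoC 0) by now apply Cpow_nz.
    assert (N2 : (qs delta z ^ (6 * l))%C <> RtoC 0).
    { apply Cpow_nz, ps_delta_neq_0; [apply nome_neq_0|now apply nome_disc]. }
    set (X := (c ^ 6)%C) in *. set (Y := (qs delta z ^ (6 * l))%C) in *.
    replace (qs e4 z ^ 3)%C with (X * (Y * qs e4 z ^ 3) * / (X * Y))%C by (field; auto).
    rewrite Q. field. auto. }
  apply (valence (12 * l + 2) (S l)); auto; [|lia]. now apply (lead_S _ c).
Qed.

(** * Modular forms and their q-series *)

(** The two normed module structures on the complex numbers have the same norm, and the
    derivative depends on nothing else. *)
Lemma cder_ex_derive f z l : cder f z l -> ex_derive (K := C_AbsRing) (V := C_NormedModule) f z.
Proof.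
  intros H. exists l. split; [apply is_linear_scal_l|].
  intros x Hx [eps He].
  assert (z = x) as <-.
  { exact (@is_filter_lim_locally_unique C_AbsRing (AbsRing_NormedModule C_AbsRing) z x Hx). }
  destruct (proj1 (cder_eps _ _ _) H eps He) as [d [Hd0 Hd]].
  exists (mkposreal d Hd0). intros y Hy. exact (Hd y Hy).
Qed.

Lemma sum_n_csum (u : nat -> C) n : sum_n (G := C_AbelianMonoid) u n = csum (S n) u.
Proof.
  induction n.
  - rewrite sum_O. cbn [csum]. rewrite Cplus_0_l. reflexivity.
  - rewrite sum_Sn, IHn. reflexivity.
Qed.

Lemma pow_n_Cpow (x : C) n : pow_n (K := C_Ring) x n = (x ^ n)%C.
Proof. induction n; [reflexivity|]. simpl. rewrite IHn. reflexivity. Qed.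

Lemma is_pseries_ps a x : conv 1 a -> Cmod x < 1 ->
  is_pseries (K := C_AbsRing) (V := C_NormedModule) a x (ps a x).
Proof.
  intros Ha Hx. pose proof (conv_csummable 1 a x Ha Hx) as S0.
  unfold is_pseries.
  apply (is_series_ext (K := C_AbsRing) (V := C_NormedModule) (fun n => a n * x ^ n)%C).
  { intros n. rewrite <- pow_n_Cpow, Cmult_comm. reflexivity. }
  unfold is_series. apply (proj2 (filterlim_locally (U := C_UniformSpace) _ _)). intros [eps He].
  destruct (Series_tail _ eps S0 He) as [N0 HN]. exists N0. intros n Hn.
  apply C_NormedModule_mixin_compat1.
  change (Cmod (sum_n (G := C_AbelianMonoid) (fun n => a n * x ^ n)%C n - ps a x)%C < eps).
  rewrite sum_n_csum, Cmod_minus_sym. unfold ps. rewrite (CSum_split (S n) _ S0).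
  match goal with |- Cmod ?e < _ => replace e with (CSum (fun k => a (S n + k)%nat * x ^ (S n + k))%C) by ring end.
  eapply Rle_lt_trans; [|exact (HN (S n) ltac:(lia))]. eapply Rle_trans; [|apply Rle_abs].
  apply Cmod_CSum_le.
  apply (ex_series_incr_n_R (fun n => Cmod (a n * x ^ n)%C)). exact S0.
Qed.

Lemma is_pseries_unique_ps a x l : conv 1 a -> Cmod x < 1 ->
  is_pseries (K := C_AbsRing) (V := C_NormedModule) a x l -> l = ps a x.
Proof.
  intros Ha Hx H. pose proof (is_pseries_ps a x Ha Hx) as H'.
  exact (filterlim_locally_unique (K := C_AbsRing) (V := C_NormedModule) _ _ _ H H').
Qed.

(** A convergent series has bounded terms. *)
Lemma conv_of_pseries a :
  (forall r, 0 < r < 1 -> exists l, is_pseries (K := C_AbsRing) (V := C_NormedModule) a (RtoC r) l) ->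
  conv 1 a.
Proof.
  intros H. apply conv_bounded. intros r Hr.
  destruct (H ((r + 1) / 2)) as [l Hl]; [lra|].
  destruct (filterlim_bounded (K := C_AbsRing) (V := C_NormedModule) _ (ex_intro _ l Hl)) as [M HM].
  set (rho := (r + 1) / 2) in *.
  assert (K : forall n, Cmod (csum (S n) (fun n => a n * RtoC rho ^ n)%C) <= M).
  { intros n. specialize (HM n). rewrite <- sum_n_csum.
    erewrite sum_n_ext; [exact HM|]. intros k. cbv beta. rewrite <- pow_n_Cpow, Cmult_comm. reflexivity. }
  assert (M0 : 0 <= M) by (apply Rle_trans with (2 := K O), Cmod_ge_0).
  assert (T : forall n, Cmod (a n * RtoC rho ^ n)%C <= 2 * M).
  { intros [|n].
    - pose proof (K O) as K0. cbn [csum] in K0. rewrite Cplus_0_l in K0. lra.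
    - pose proof (K (S n)) as K1. pose proof (K n) as K2.
      replace (a (S n) * RtoC rho ^ S n)%C
        with (csum (S (S n)) (fun n => a n * RtoC rho ^ n)%C - csum (S n) (fun n => a n * RtoC rho ^ n)%C)%C
        by (cbn [csum]; ring).
      unfold Cminus. eapply Rle_trans; [apply Cmod_triangle|]. rewrite Cmod_opp. lra. }
  exists (2 * M). intros n. apply Rle_trans with (2 := T n).
  rewrite Cmod_mult, Cmod_pow, Cmod_R, Rabs_pos_eq by (unfold rho; lra).
  apply Rmult_le_compat_l; [apply Cmod_ge_0|]. apply pow_incr. unfold rho; lra.
Qed.

Lemma modular_form_series k f : modular_form k f ->
  exists a, modular_series k a /\ forall z, 0 < Im z -> f z = qs a z.
Proof.
  intros (_ & HW & a & Ha).
  assert (Ca : conv 1 a).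
  { apply conv_of_pseries. intros r Hr. destruct (nome_surj (RtoC r)) as (z & Hz & E).
    - rewrite Cmod_R, Rabs_pos_eq; lra.
    - exists (f z). rewrite <- E. now apply Ha. }
  assert (E : forall z, 0 < Im z -> f z = qs a z).
  { intros z Hz. apply is_pseries_unique_ps; auto using nome_disc. }
  exists a. split; auto. split; auto. intros z Hz.
  destruct (Im_inv_pt z Hz) as (z0 & _ & Ht).
  rewrite <- !E by auto. pose proof (HW 0%Z (-1)%Z 1%Z 0%Z ltac:(lia) z Hz) as Q.
  unfold ZtoC in Q. replace (RtoC (IZR 1) * z + RtoC (IZR 0))%C with z in Q by ring.
  rewrite <- Q. f_equal. unfold inv_pt. field. auto.
Qed.

(** Induction on |c| by Euclid's algorithm: with d = c m + r, the matrix is factored through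
    z -> z + m and z -> -1/z, and the remaining matrix has bottom row (r, -c). *)
Lemma modular_series_weakly_modular n a : modular_series (2 * n) a -> weakly_modular (2 * n) (qs a).
Proof.
  intros [Ha Ma].
  assert (Peven : forall x, ((- x) ^ (2 * n) = x ^ (2 * n))%C).
  { intros x. rewrite !Cpow_mult_r. f_equal. simpl. ring. }
  assert (K : forall (N : nat) a0 b c d, (Z.abs_nat c < N)%nat -> (a0 * d - b * c = 1)%Z ->
    forall z, 0 < Im z -> qs a ((ZtoC a0 * z + ZtoC b) / (ZtoC c * z + ZtoC d))%C
      = ((ZtoC c * z + ZtoC d) ^ (2 * n) * qs a z)%C).
  { induction N; intros a0 b c d HN Hdet z Hz; [lia|].
    destruct (Z.eq_dec c 0) as [->|Hc].
    - assert (H1 : (a0 * d = 1)%Z) by lia.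
      assert ((a0 = 1 /\ d = 1) \/ (a0 = -1 /\ d = -1))%Z as [[-> ->]|[-> ->]].
      { destruct (Z.mul_eq_1 _ _ H1) as [->| ->]; lia. }
      + unfold ZtoC. replace ((RtoC 1 * z + RtoC (IZR b)) / (RtoC 0 * z + RtoC 1))%C with (z + RtoC (IZR b))%C.
        * rewrite qs_translate. replace (RtoC 0 * z + RtoC 1)%C with (RtoC 1) by ring. rewrite Cpow_1_l. ring.
        * replace (RtoC 0 * z + RtoC 1)%C with (RtoC 1) by ring. field.
      + unfold ZtoC. replace (RtoC (IZR (-1))) with (- RtoC 1)%C by (rewrite <- RtoC_opp; f_equal; ring).
        replace (RtoC 0 * z + - RtoC 1)%C with (- RtoC 1)%C by ring.
        replace ((- RtoC 1 * z + RtoC (IZR b)) / - RtoC 1)%C with (z + RtoC (IZR (- b)))%C.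
        * rewrite qs_translate, Peven, Cpow_1_l. ring.
        * rewrite opp_IZR, RtoC_opp. field.
    - set (m := (d / c)%Z). set (r := (d mod c)%Z).
      pose proof (Z.div_mod d c Hc) as Ed. fold m r in Ed.
      assert (Hr : (Z.abs_nat r < N)%nat).
      { assert (Z.abs r < Z.abs c)%Z; [|lia]. unfold r.
        destruct (Z_lt_le_dec 0 c) as [L|L].
        - pose proof (Z.mod_pos_bound d c L). lia.
        - pose proof (Z.mod_neg_bound d c ltac:(lia)). lia. }
      (* After z -> z + m and w = -1/(z + m), the induction hypothesis applies at w. *)
      set (zm := (z + RtoC (IZR m))%C).
      assert (Izm : 0 < Im zm) by (unfold zm; rewrite Im_plus, Im_RtoC; lra).
      destruct (Im_inv_pt zm Izm) as (zm0 & _ & Iw).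
      pose proof (IHN (b - a0 * m)%Z (- a0)%Z r (- c)%Z Hr ltac:(nia) (inv_pt zm) Iw) as IH.
      rewrite Ma in IH by auto. replace (qs a zm) with (qs a z) in IH by (symmetry; apply qs_translate).
      assert (Hcz : (ZtoC c * z + ZtoC d)%C <> RtoC 0).
      { intros E. assert (I : Im (ZtoC c * z + ZtoC d)%C = 0) by (rewrite E; reflexivity).
        unfold ZtoC in I. rewrite Im_plus, Im_scal_l, Im_RtoC in I.
        assert (IZR c <> 0) by (now apply not_0_IZR).
        assert (IZR c * Im z <> 0) by (apply Rmult_integral_contrapositive_currified; lra). lra. }
      assert (Ec : (ZtoC c * z + ZtoC d = RtoC (IZR r) + RtoC (IZR c) * zm)%C).
      { unfold ZtoC, zm. rewrite Ed, plus_IZR, mult_IZR, RtoC_plus, RtoC_mult. ring. }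
      assert (E1 : (ZtoC r * inv_pt zm + ZtoC (- c) = - (ZtoC c * z + ZtoC d) / zm)%C).
      { rewrite Ec. unfold ZtoC, inv_pt. rewrite opp_IZR, RtoC_opp. field. auto. }
      assert (E2 : (ZtoC (b - a0 * m) * inv_pt zm + ZtoC (- a0) = - (ZtoC a0 * z + ZtoC b) / zm)%C).
      { unfold ZtoC, inv_pt. rewrite minus_IZR, mult_IZR, opp_IZR, RtoC_minus, RtoC_mult, RtoC_opp.
        replace z with (zm - RtoC (IZR m))%C by (unfold zm; ring). field. auto. }
      rewrite E1, E2 in IH.
      replace (- (ZtoC a0 * z + ZtoC b) / zm / (- (ZtoC c * z + ZtoC d) / zm))%C
        with ((ZtoC a0 * z + ZtoC b) / (ZtoC c * z + ZtoC d))%C in IH by (field; auto).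
      rewrite IH, Cmult_assoc, <- Cpow_mult_l.
      replace (- (ZtoC c * z + ZtoC d) / zm * zm)%C with (- (ZtoC c * z + ZtoC d))%C by (field; auto).
      now rewrite Peven. }
  intros a0 b c d Hdet z Hz. exact (K (S (Z.abs_nat c)) a0 b c d (Nat.lt_succ_diag_r _) Hdet z Hz).
Qed.

Lemma series_modular_form n a : modular_series (2 * n) a -> modular_form (2 * n) (qs a).
Proof.
  intros H. split; [|split].
  - intros z Hz. eapply cder_ex_derive, cder_qs; auto. apply H.
  - now apply modular_series_weakly_modular.
  - exists a. intros z Hz. apply is_pseries_ps; [apply H|now apply nome_disc].
Qed.

(** * The dimension *)

(** Delta^j times a monomial in E4 and E6 of weight 2n - 12j.  With u = n - 6j, the factor
    is E4^(u/2) for even u and E6 E4^((u-3)/2) for odd u; the case u = 1 does not arise for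
    j < form_dim n. *)
Definition basis_series (n j : nat) : nat -> C :=
  let u := (n - 6 * j)%nat in
  pmul (ppow delta j)
    (if Nat.even u then ppow e4 (u / 2) else pmul e6 (ppow e4 ((u - 3) / 2))).

Lemma form_dim_lt n j : (j < form_dim n)%nat -> (6 * j <= n /\ n - 6 * j <> 1)%nat.
Proof.
  unfold form_dim. intros H. pose proof (Nat.div_mod n 6 ltac:(lia)). pose proof (Nat.mod_upper_bound n 6 ltac:(lia)).
  destruct (n mod 6 =? 1)%nat eqn:E; [apply Nat.eqb_eq in E|apply Nat.eqb_neq in E]; lia.
Qed.

Lemma modular_basis_series n j : (j < form_dim n)%nat -> modular_series (2 * n) (basis_series n j) /\ lead j (RtoC 1) (basis_series n j).
Proof.
  intros H. apply form_dim_lt in H. destruct H as [H1 H2]. unfold basis_series. set (u := (n - 6 * j)%nat) in *.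
  assert (G : forall e, modular_series (2 * u) e /\ lead 0 (RtoC 1) e ->
     modular_series (2 * n) (pmul (ppow delta j) e) /\ lead j (RtoC 1) (pmul (ppow delta j) e)).
  { intros e [Me Le]. split.
    - replace (2 * n)%nat with (j * 12 + 2 * u)%nat by (unfold u; lia).
      apply modular_pmul; auto. apply modular_ppow, modular_delta.
    - pose proof (lead_pmul _ _ _ _ _ _ (lead_ppow _ _ _ j lead_delta) Le) as Q.
      rewrite Cpow_1_l, Cmult_1_l, Nat.mul_1_r, Nat.add_0_r in Q. exact Q. }
  assert (L4 : forall p, lead 0 (RtoC 1) (ppow e4 p)).
  { intros p. pose proof (lead_ppow _ _ _ p lead_e4) as Q. rewrite Cpow_1_l, Nat.mul_0_r in Q. exact Q. }
  apply G. destruct (Nat.even u) eqn:E.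
  - apply Nat.even_spec in E. destruct E as [v Ev]. split; auto.
    replace (u / 2)%nat with v by (rewrite Ev, Nat.mul_comm, Nat.div_mul; lia).
    replace (2 * u)%nat with (v * 4)%nat by lia. apply modular_ppow, modular_e4.
  - assert (O : Nat.odd u = true) by (rewrite <- Nat.negb_even, E; reflexivity).
    apply Nat.odd_spec in O. destruct O as [v Ev].
    replace ((u - 3) / 2)%nat with (v - 1)%nat.
    2:{ replace (u - 3)%nat with ((v - 1) * 2)%nat by lia. now rewrite Nat.div_mul. }
    split.
    + replace (2 * u)%nat with (6 + (v - 1) * 4)%nat by lia. apply modular_pmul; [apply modular_e6|apply modular_ppow, modular_e4].
    + pose proof (lead_pmul _ _ _ _ _ _ lead_e6 (L4 (v - 1)%nat)) as Q.
      rewrite Cmult_1_l in Q. exact Q.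
Qed.

Lemma modular_vanish n a : modular_series (2 * n) a -> ord_ge (form_dim n) a -> forall i, a i = RtoC 0.
Proof.
  unfold form_dim. intros Ma Ho. pose proof (Nat.div_mod n 6 ltac:(lia)) as E.
  pose proof (Nat.mod_upper_bound n 6 ltac:(lia)) as B.
  destruct (n mod 6 =? 1)%nat eqn:Em; [apply Nat.eqb_eq in Em|apply Nat.eqb_neq in Em].
  - apply (valence_2 (n / 6)).
    + replace (12 * (n / 6) + 2)%nat with (2 * n)%nat by lia. exact Ma.
    + rewrite Nat.add_0_r in Ho. exact Ho.
  - apply (valence (2 * n) (n / 6 + 1)); auto. lia.
Qed.

Lemma sum_n_m_csum (u : nat -> C) d : sum_n_m (G := C_AbelianMonoid) u 1 d = csum d (fun i => u (S i)).
Proof.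
  induction d.
  - rewrite sum_n_m_zero by lia. reflexivity.
  - rewrite sum_n_Sm by lia. rewrite IHd. reflexivity.
Qed.

Lemma modular_csum_comb n (c : nat -> C) d : (d <= form_dim n)%nat ->
  modular_series (2 * n) (fun i => csum d (fun j => c j * basis_series n j i)%C) /\
  forall z, 0 < Im z -> qs (fun i => csum d (fun j => c j * basis_series n j i)%C) z = csum d (fun j => c j * qs (basis_series n j) z)%C.
Proof.
  induction d; intros H; cbn [csum].
  - split; [apply modular_zero|]. intros. apply ps_zero.
  - destruct (IHd ltac:(lia)) as [I1 I2]. destruct (modular_basis_series n d ltac:(lia)) as [M L].
    split; [now apply modular_comb|]. intros z Hz. rewrite qs_comb by (auto; first [apply I1|apply M]).
    now rewrite I2.
Qed.

Lemma dimension n : has_dimension upper_half_plane (modular_form (2 * n)) (form_dim n).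
Proof.
  exists (fun i => qs (basis_series n (pred i))). split; [|split].
  - intros i Hi. apply series_modular_form, modular_basis_series. lia.
  - intros c Hc.
    destruct (modular_csum_comb n (fun j => c (S j)) (form_dim n) (le_n _)) as [M E].
    assert (Z : forall m, csum (form_dim n) (fun j => c (S j) * basis_series n j m)%C = RtoC 0).
    { apply (qs_zero_coef _ (proj1 M)). intros z Hz. rewrite E by auto.
      rewrite <- (Hc z Hz). unfold lin_comb. rewrite sum_n_m_csum. reflexivity. }
    assert (K : forall j, (j < form_dim n)%nat -> c (S j) = RtoC 0).
    { intros j. induction j as [j IH] using (well_founded_induction lt_wf). intros Hj.
      specialize (Z j). rewrite (csum_single _ j) in Z; [|exact Hj|].
      2:{ intros k Hk Hkj. destruct (modular_basis_series n k Hk) as [_ [L1 L2]].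
          destruct (lt_dec k j) as [L|L]; [rewrite IH by auto; ring|rewrite L1 by lia; ring]. }
      destruct (modular_basis_series n j Hj) as [_ [L1 L2]]. rewrite L2 in Z. rewrite <- Z. ring. }
    intros [|i] Hi; [lia|]. apply K. lia.
  - intros f Hf. destruct (modular_form_series _ _ Hf) as (a & Ma & Ea).
    assert (K : forall d, (d <= form_dim n)%nat -> exists c : nat -> C,
      ord_ge d (fun i => a i + - (1) * csum d (fun j => c j * basis_series n j i))%C).
    { induction d; intros Hd.
      - exists (fun _ => RtoC 0). intros i Hi. lia.
      - destruct (IHd ltac:(lia)) as [c Hc].
        destruct (modular_basis_series n d ltac:(lia)) as [_ [L1 L2]].
        set (x := (a d + - (1) * csum d (fun j => c j * basis_series n j d))%C).
        exists (fun j => if (j <? d)%nat then c j else x). intros i Hi. cbn [csum].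
        rewrite Nat.ltb_irrefl.
        rewrite (csum_ext d _ (fun j => c j * basis_series n j i)%C)
          by (intros k Hk; rewrite (proj2 (Nat.ltb_lt k d) Hk); reflexivity).
        destruct (Nat.eq_dec i d) as [->|Hid].
        + rewrite L2. unfold x. ring.
        + rewrite L1 by lia.
          replace (a i + - (1) * (csum d (fun j => c j * basis_series n j i) + x * RtoC 0))%C
            with (a i + - (1) * csum d (fun j => c j * basis_series n j i))%C by ring.
          apply Hc. lia. }
    destruct (K (form_dim n) (le_n _)) as [c Hc].
    destruct (modular_csum_comb n c (form_dim n) (le_n _)) as [M E].
    pose proof (modular_vanish n _ (modular_comb _ _ _ (- (1))%C Ma M) Hc) as Z. cbv beta in Z.
    exists (fun i => c (pred i)). intros z Hz. rewrite Ea by auto.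
    unfold lin_comb. rewrite sum_n_m_csum. cbn [pred].
    rewrite <- E by auto. unfold qs. apply ps_ext. intros i.
    specialize (Z i). replace (a i) with ((a i + - (1) * csum (form_dim n) (fun j => c j * basis_series n j i)) + csum (form_dim n) (fun j => c j * basis_series n j i))%C by ring.
    rewrite Z. ring.
Qed.

Local Close Scope R_scope.

Theorem mainTheorem6 : forall (n : nat) (alpha : vec),
  (2 <= n)%nat ->
  is_dimvec alpha ->
  size alpha = n ->
  evenly_distributed alpha ->
  exists d : nat,
    has_dimension upper_half_plane (modular_form (2 * n)) d /\
    is_min_codim alpha (Z.of_nat d).
Proof.
  intros n alpha Hn Da Hs He. subst n. exists (form_dim (size alpha)). split; [apply dimension|].
  split; [now apply codim_attained|].
  intros b c. now apply codim_ge_dim.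
Qed.
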